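(* Among all pairs $(T,\mathcal{B})$, where $T\subset\overline{\mathbf{H}}^3$ is a plane symmetric fully asymptotic tetrahedron and $\mathcal{B}$ is an admissible horoball arrangement for $T$, the maximum of the generalized simplicial density $\delta(\mathcal{B})$ is attained by the arrangement $\mathcal{B}_3(x_3(z_3))$ on the tetrahedron $T$ with parameter $z=z_3$ (both described in the context), and $$\delta(\mathcal{B}_3(x_3(z_3)))\approx 0.87499429 .$$
   Context: $\mathbf{H}^3$ is hyperbolic 3-space of curvature $-1$, and $\overline{\mathbf{H}}^3$ is $\mathbf{H}^3$ together with its ideal boundary $\partial\mathbf{H}^3$. In the Beltrami-Cayley-Klein ball model, $\mathbf{H}^3$ is the open unit ball with straight chords as geodesics, and $\partial\mathbf{H}^3$ is the unit sphere. A point with projective coordinates $(1,x,y,z)$ is the Cartesian point $(x,y,z)$. A fully asymptotic (ideal) tetrahedron $T=E_0E_1E_2E_3$ is a nondegenerate tetrahedron all of whose vertices lie on $\partial\mathbf{H}^3$. It is called plane symmetric if it has at least one plane of symmetry. Up to isometry and relabelling of the vertices, every plane symmetric fully asymptotic tetrahedron has vertices $$E_0=(1,0,\sqrt{1-z^2},z),\quad E_1=\Big(1,\tfrac{\sqrt3}{2},0,-\tfrac12\Big),\quad E_2=\Big(1,-\tfrac{\sqrt3}{2},0,-\tfrac12\Big),\quad E_3=(1,0,0,1)$$ with a parameter $z\in(-1,1)$. The dihedral angles at $E_0E_1,E_0E_2,E_1E_3,E_2E_3$ are equal to some $\alpha\in(0,\pi/2)$, and those at $E_0E_3$ and $E_1E_2$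 equal $\pi-2\alpha$. The regular ideal tetrahedron is the case $z=0$. An admissible horoball arrangement for $T$ is a family $\mathcal{B}=\{B_0,B_1,B_2,B_3\}$, where $B_i$ is a (closed) horoball with ideal center $E_i$, such that: (1) the $B_i$ form a packing, i.e. their interiors are pairwise disjoint; (2) for each $i$, $B_i$ has at most one common point with the plane spanned by the other three vertices of $T$ (so $B_i$ may touch, but not cross, the plane of the face opposite to $E_i$). The horoballs at different vertices may be of different types, i.e. no equality between the volumes $\mathrm{vol}(B_i\cap T)$ is required. The generalized simplicial density is $$\delta(\mathcal{B})=\frac{\sum_{i=0}^{3}\mathrm{vol}(B_i\cap T)}{\mathrm{vol}(T)},$$ with hyperbolic volumes. The parameter $z_3$ is $$z_3=\frac{4}{73}\sqrt{3}\sqrt{178}\,\cos\Big(\tfrac13\arctan\big(\tfrac{73}{8001}\sqrt3\sqrt{229}\big)\Big)-\frac{26}{73}\approx 0.9061774494,$$ which corresponds to $\alpha\approx 1.44340117$. The arrangement $\mathcal{B}_3(x_3(z_3))=\{B_0,B_1,B_2,B_3\}$ on the tetrahedron with $z=z_3$ is the one in which: $B_3$ touches its opposite face plane $E_0E_1E_2$; $B_2$ touches its opposite face plane $E_0E_1E_3$; $B_2$ and $B_3$ touch each other; $B_0$ touches $B_3$; and $B_1$ touches $B_2$. *)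

(* Defs.v *)
From HB Require Import structures.
From mathcomp Require Import all_boot all_order all_algebra.
From mathcomp Require Import all_classical all_reals all_analysis.
Import Order.TTheory GRing.Theory Num.Theory numFieldNormedType.Exports.

Set Implicit Arguments.
Unset Strict Implicit.
Unset Printing Implicit Defensive.

Local Open Scope classical_set_scope.
Local Open Scope ring_scope.

(** Hyperbolic 3-space of curvature -1 in the Beltrami-Cayley-Klein ball model:
    the point with projective coordinates (1, x, y, z) is [(x, y, z)]. *)

Notation pt3 R := (R * R * R)%type (only parsing).

Definition dot (R : realType) (p q : pt3 R) : R :=
  p.1.1 * q.1.1 + p.1.2 * q.1.2 + p.2 * q.2.

(* Projective coordinates live in [R * pt3 R], the time coordinate first;
   the Lorentz form has signature (-, +, +, +). *)
Definition lorentz (R : realType) (X Y : R * pt3 R) : R :=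
  dot X.2 Y.2 - X.1 * Y.1.

Definition homog (R : realType) (p : pt3 R) : R * pt3 R := (1, p).

Definition dehomog (R : realType) (X : R * pt3 R) : pt3 R := X.1^-1 *: X.2.

Definition H3 (R : realType) : set (pt3 R) := [set p | dot p p < 1].

Definition ideal_boundary (R : realType) : set (pt3 R) :=
  [set p | dot p p = 1].

(* The Riemannian volume element of the Klein model in dimension n is
   (1 - |p|^2)^(-(n+1)/2) dp; here n = 3. *)
Definition hyp_vol (R : realType) (A : set (pt3 R)) : R :=
  (\int[((@lebesgue_measure R \x @lebesgue_measure R) \x @lebesgue_measure R)%E]_(p in
      A `&` @H3 R) ((1 - dot p p) ^+ 2)^-1)%R.

(** Fully asymptotic tetrahedra, given by their vertices. *)

(* Geodesics are chords, so the hyperbolic convex hull is the Euclidean one;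
   it contains the ideal vertices. *)
Definition tetrahedron (R : realType) (E : 'I_4 -> pt3 R) : set (pt3 R) :=
  [set p | exists w : 'I_4 -> R,
     [/\ forall i, 0 <= w i, \sum_i w i = 1 & p = \sum_i w i *: E i]].

(* Nondegeneracy is affine independence of the vertices. *)
Definition ideal_tetrahedron (R : realType) (E : 'I_4 -> pt3 R) : Prop :=
  (forall i, ideal_boundary (E i)) /\
  (forall w : 'I_4 -> R, \sum_i w i = 0 -> \sum_i w i *: E i = 0 ->
     forall i, w i = 0).

(* A hyperbolic plane is the set of the p in H3 with
   lorentz (homog p) u = 0, for some u with lorentz u u > 0; the reflection in
   it is the projective map induced by the Lorentz reflection along u. *)
Definition reflection (R : realType) (u : R * pt3 R) (p : pt3 R) : pt3 R :=
  dehomog (homog p - (2 * lorentz (homog p) u / lorentz u u) *: u).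

Definition plane_symmetric (R : realType) (E : 'I_4 -> pt3 R) : Prop :=
  exists u : R * pt3 R,
    0 < lorentz u u /\ reflection u @` tetrahedron E = tetrahedron E.

Definition face_plane (R : realType) (E : 'I_4 -> pt3 R) (i : 'I_4) :
    set (pt3 R) :=
  [set p | H3 p /\ exists w : 'I_4 -> R,
     [/\ w i = 0, \sum_j w j = 1 & p = \sum_j w j *: E j]].

(** Horoballs. *)

(* The closed sublevel sets of the Busemann function of the ideal point e,
   p |-> ln ((1 - dot e p) / sqrt (1 - dot p p)); equivalently, the ball bounded
   by lorentz (homog p) (homog e) ^+ 2 = - s * lorentz (homog p) (homog p).
   For e = (0, 0, 1) the bounding ellipsoid goes through (0, 0, t) with
   s = (1 - t) / (1 + t). The ideal center itself is not included. *)
Definition horoball (R : realType) (e : pt3 R) (s : R) : set (pt3 R) :=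
  [set p | H3 p /\ (1 - dot e p) ^+ 2 <= s * (1 - dot p p)].

Definition is_horoball (R : realType) (e : pt3 R) (A : set (pt3 R)) : Prop :=
  exists2 s : R, 0 < s & A = horoball e s.

(* H3 is open in R^3, so that the interiors may be taken in R^3. *)
Definition admissible (R : realType) (E : 'I_4 -> pt3 R)
    (B : 'I_4 -> set (pt3 R)) : Prop :=
  [/\ forall i, is_horoball (E i) (B i),
      forall i j, i != j -> (B i)° `&` (B j)° = set0
    & forall i p q, (B i `&` face_plane E i) p ->
                    (B i `&` face_plane E i) q -> p = q].

Definition density (R : realType) (E : 'I_4 -> pt3 R)
    (B : 'I_4 -> set (pt3 R)) : R :=
  (\sum_i hyp_vol (B i `&` tetrahedron E)) / hyp_vol (tetrahedron E).

(* Horoballs are strictly convex: closed horoballs with distinct ideal centers,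
   or a closed horoball and a plane that misses its ideal center, are tangent
   exactly when they have a single common point. *)
Definition touches (R : realType) (A B : set (pt3 R)) : Prop :=
  exists p, A `&` B = [set p].

(** The extremal arrangement. *)

Definition v0 : 'I_4 := @Ordinal 4 0 isT.
Definition v1 : 'I_4 := @Ordinal 4 1 isT.
Definition v2 : 'I_4 := @Ordinal 4 2 isT.
Definition v3 : 'I_4 := @Ordinal 4 3 isT.

Definition symmetric_tetra (R : realType) (z : R) : 'I_4 -> pt3 R :=
  tnth [tuple (0, Num.sqrt (1 - z ^+ 2), z);
              (Num.sqrt 3 / 2, 0, - (1 / 2));
              (- (Num.sqrt 3 / 2), 0, - (1 / 2));
              (0, 0, 1)].

Definition z3 (R : realType) : R :=
  4 / 73 * Num.sqrt 3 * Num.sqrt 178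
    * cos (1 / 3 * atan (73 / 8001 * Num.sqrt 3 * Num.sqrt 229)) - 26 / 73.

Definition arrangement3 (R : realType) (E : 'I_4 -> pt3 R)
    (B : 'I_4 -> set (pt3 R)) : Prop :=
  [/\ forall i, is_horoball (E i) (B i),
      touches (B v3) (face_plane E v3) /\ touches (B v2) (face_plane E v2),
      touches (B v2) (B v3),
      touches (B v0) (B v3)
    & touches (B v1) (B v2)].

(* Main.v *)
(** Write [N_ij = 1 - dot E_i E_j] for the vertices. A reflection preserving the tetrahedron
    swaps two vertices and fixes the other two, so that, up to relabelling,
    [N_01 N_23 = N_02 N_13 = P], and the shape is determined by [k = N_03 N_12 / P], which
    lies in (0, 4). Integrating first along the chords through a vertex shows that, up to the
    common factor [|det| / (4 P)], the volume of the tetrahedron is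
    [F k = \int_0^1 - ln y / (1 - y) dx] with [y = k x (1 - x)], and that of [B_i] inside the
    tetrahedron is [(4 - k) u_i / 2], where [u_i] is the ratio of the radius of [B_i] to the
    radius at which [B_i] touches the opposite face.

    Admissibility then reads [u_i <= 1], [(4 - k)^2 u_0 u_3 <= 1], [(4 - k)^2 u_1 u_2 <= 1], and
    [k (4 - k)^2 u_i u_j <= 1] for the other four pairs, and the density is
    [(4 - k) (u_0 + u_1 + u_2 + u_3) / (2 F k)]. Maximising over the [u_i] for fixed [k] leaves
    inequalities between rational functions of [k] and [F k], which follow from explicit bounds
    for [F]. They are sharp only at the root of [k (4 - k)^2 = 1] below 1/10, which is the shape
    with parameter [z3], with [u_2 = u_3 = 1] and [u_0 = u_1 = (4 - k)^-2]. *)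

Require Import Defs.
From HB Require Import structures.
From mathcomp Require Import all_boot all_order all_algebra.
From mathcomp Require Import all_classical all_reals all_analysis.
From mathcomp Require Import measurable_realfun ring lra.
Import Order.TTheory GRing.Theory Num.Theory numFieldNormedType.Exports.

Set Implicit Arguments.
Unset Strict Implicit.
Unset Printing Implicit Defensive.

Local Open Scope classical_set_scope.
Local Open Scope ring_scope.

(** * Affine changes of variables *)

(** Under a Lorentz map each [N_ij] is rescaled by one factor per vertex, so only the ratios of the
    three products over opposite edges are intrinsic. No normal form of the tetrahedron is therefore
    chosen: the symmetry enters as an equality of two products. The double transpositions of the
    vertices preserve that equality and [k], so facts are proved at one vertex and transported. The
    obstacle is that the density bound is an equality at the critical value [c], where numerical
    bounds for [F] cannot decide. The maximum there is a corner: for [k < c] the four bounds with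
    constant [k (4 - k)^2] follow from [u_i <= 1], just above [c] they bind, and the two resulting
    estimates of the sum of the [u_i] agree where [k (4 - k)^2 = 1]. Each side thus leaves a margin
    linear in [|k - c|], and crude one-sided Lipschitz estimates of [F] at [c] suffice. For
    [k > 1/10] the maximal density is replaced by the lower bound 0.8749, which leaves polynomial
    inequalities. *)

Section FiberwiseAffine.
Context {R : realType}.
Local Open Scope ereal_scope.
Local Notation mu := (@lebesgue_measure R).

Let measurable_affine (a b : R) :
  measurable_fun [set: measurableTypeR R] (fun x : measurableTypeR R => a * x + b : measurableTypeR R)%R.
Proof. by apply: measurable_funD => //; apply: measurable_funM. Qed.

(** The pushforward of Lebesgue measure scaled by [|a|] agrees with it on half-open intervals, and
    such a measure is unique. A negative slope turns []c, d]] into an interval closed on the left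
    only, so the two signs are computed apart. *)
Lemma lebesgue_measure_affine (a b : R) (A : set R) : a != 0%R ->
  measurable A ->
  `|a|%:E * mu ((fun x : R => a * x + b)%R @^-1` A) = mu A.
Proof.
move=> a0 mA.
pose phi (x : measurableTypeR R) : measurableTypeR R := (a * x + b)%R.
pose na : {nonneg R} := NngNum (normr_ge0 a).
have mphi : measurable_fun setT phi by exact: measurable_affine.
pose pm : {measure set (measurableTypeR R) -> \bar R} :=
  measure_function_pushforward__canonical__measure_function_Measure mu mphi.
pose m := mscale na pm.
suff H : forall X, measurable X -> mu X = m X by rewrite (H A mA).
apply: lebesgue_measure_unique => _ [[c d] _ <-].
transitivity (`|a|%:E * mu (phi @^-1` `]c, d]%classic)); last by [].
rewrite /phi lebesgue_measure_itv/= lte_fin.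
have [agt0|alt0] : (0 < a \/ a < 0)%R.
  by apply/orP; rewrite orbC -neq_lt.
- rewrite (_ : _ @^-1` _ = `]((c - b) / a)%R, ((d - b) / a)%R]%classic); last first.
    apply/seteqP; split => x; rewrite /= !in_itv/= ltr_pdivrMr// ler_pdivlMr//.
      by rewrite ltrBlDr lerBrDr (mulrC x).
    by rewrite ltrBlDr lerBrDr (mulrC x).
  rewrite lebesgue_measure_itv/= lte_fin ltr_pM2r ?invr_gt0//.
  rewrite ltrD2r; case: ifPn => _; last by rewrite mule0.
  rewrite -EFinD -EFinM gtr0_norm//; congr EFin.
  by field.
- rewrite (_ : _ @^-1` _ = `[((d - b) / a)%R, ((c - b) / a)%R[%classic); last first.
    apply/seteqP; split => x; rewrite /= !in_itv/= ler_ndivrMr// ltr_ndivlMr//.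
      by rewrite ltrBlDr lerBrDr (mulrC x) andbC.
    by rewrite ltrBlDr lerBrDr (mulrC x) andbC.
  rewrite lebesgue_measure_itv/= lte_fin ltr_nM2r ?invr_lt0//.
  rewrite ltrD2r; case: ifPn => _; last by rewrite mule0.
  rewrite -EFinD ltr0_norm//.
  by rewrite -EFinM; congr EFin; field.
Qed.

Lemma ge0_integral_affine (a b : R) (f : R -> \bar R) : a != 0%R ->
  measurable_fun [set: measurableTypeR R] f -> (forall x, 0 <= f x) ->
  \int[mu]_x f x = `|a|%:E * \int[mu]_x f (a * x + b)%R.
Proof.
move=> a0 mf f0.
pose phi (x : measurableTypeR R) : measurableTypeR R := (a * x + b)%R.
pose na : {nonneg R} := NngNum (normr_ge0 a).
have mphi : measurable_fun setT phi by exact: measurable_affine.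
pose pm : {measure set (measurableTypeR R) -> \bar R} :=
  measure_function_pushforward__canonical__measure_function_Measure mu mphi.
transitivity (\int[mscale na pm]_x f x).
  apply: eq_measure_integral => A mA _.
  by rewrite /= /mscale /pm /= /pushforward /= lebesgue_measure_affine.
rewrite ge0_integral_mscale//= ge0_integral_pushforward//.
Qed.

(* When the slope vanishes the fibre of [G] is required to be null. *)
Lemma fiberwise_affine d (T : measurableType d)
    (m : {sigma_finite_measure set T -> \bar R})
    (G : T * measurableTypeR R -> \bar R) (l k : T -> R) :
  measurable_fun setT G -> (forall p, 0 <= G p) ->
  measurable_fun setT l -> measurable_fun setT k ->
  (forall t, l t = 0%R -> \int[mu]_c G (t, c) = 0) ->
  \int[m \x mu]_p G p =
  \int[m \x mu]_p (`|l p.1|%:E * G (p.1, l p.1 * p.2 + k p.1)%R).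
Proof.
move=> mG G0 ml mk l0.
have mA : measurable_fun [set: T * measurableTypeR R]
    (fun p : T * measurableTypeR R => (p.1, l p.1 * p.2 + k p.1)%R
     : T * measurableTypeR R).
  apply: measurable_fun_pair => //.
  apply: measurable_funD; last exact: measurableT_comp.
  apply: measurable_funM; last exact: measurable_snd.
  exact: measurableT_comp.
have mGt t : measurable_fun [set: measurableTypeR R] (fun c => G (t, c)).
  exact: measurableT_comp (pair1_measurable t).
rewrite fubini_tonelli1// [RHS]fubini_tonelli1; last 2 first.
  apply: emeasurable_funM.
    apply/measurable_EFinP; apply: measurableT_comp => //.
    by apply: measurableT_comp => //.
  exact: measurableT_comp.
  by move=> p; rewrite mule_ge0.
apply: eq_integral => t _; rewrite /fubini_F/=.
have [lt0|lt0] := eqVneq (l t) 0%R.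
  by rewrite l0// integral0_eq// => c _; rewrite lt0 normr0 mul0e.
rewrite (ge0_integral_affine (k t) lt0)// ge0_integralZl//.
exact: (measurableT_comp (mGt t) (measurable_affine (l t) (k t))).
Qed.

End FiberwiseAffine.

(** * Linear changes of variables in space *)

Definition det3 (R : realType) (A B C : pt3 R) : R :=
  A.1.1 * (B.1.2 * C.2 - B.2 * C.1.2)
  - A.1.2 * (B.1.1 * C.2 - B.2 * C.1.1)
  + A.2 * (B.1.1 * C.1.2 - B.1.2 * C.1.1).

Definition lin3 (R : realType) (A B C p : pt3 R) : pt3 R :=
  p.1.1 *: A + p.1.2 *: B + p.2 *: C.

Lemma pt3P (R : realType) (p q : pt3 R) :
  p.1.1 = q.1.1 -> p.1.2 = q.1.2 -> p.2 = q.2 -> p = q.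
Proof. by case: p q => [[? ?] ?] [[? ?] ?] /= -> -> ->. Qed.

Lemma lin3E (R : realType) (A B C p : pt3 R) : lin3 A B C p =
  (p.1.1 * A.1.1 + p.1.2 * B.1.1 + p.2 * C.1.1,
   p.1.1 * A.1.2 + p.1.2 * B.1.2 + p.2 * C.1.2,
   p.1.1 * A.2 + p.1.2 * B.2 + p.2 * C.2).
Proof. by []. Qed.

Notation leb R := (@lebesgue_measure R).

(** Fubini for the triple product needs the planar factor as a sigma-finite measure; the squares of
    a monotone exhaustion of the line exhaust the plane. [leb2] packs this and stays convertible to
    the product in [hyp_vol]. *)
Lemma sigma_finite_leb2 (R : realType) : sigma_finite setT (leb R \x leb R)%E.
Proof.
have /sigma_finiteP[F [TF ndF Foo]] := sigma_finiteT (leb R).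
exists (fun n => F n `*` F n).
  rewrite -setXTT TF predeqE => -[x y]; split.
    move=> [/= [n _ Fnx] [k _ Gky]]; exists (maxn n k) => //; split.
    - by move: x Fnx; exact/subsetPset/ndF/leq_maxl.
    - by move: y Gky; exact/subsetPset/ndF/leq_maxr.
  by move=> [n _ []/= ? ?]; split; exists n.
move=> k; have [mF Fk] := Foo k.
split; first exact: measurableX.
rewrite [X in (X < _)%E]product_measure1E//.
by rewrite lte_mul_pinfty// ge0_fin_numE.
Qed.

Definition leb2 (R : realType) :
    {sigma_finite_measure set (measurableTypeR R * measurableTypeR R)%type -> \bar R} :=
  HB.pack (leb R \x leb R)%E
    (Measure_isSigmaFinite.Build _ _ _ (leb R \x leb R)%E (sigma_finite_leb2 R)).
Notation leb3 R := (leb2 R \x leb R)%E.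
Notation mpt3 R :=
  (measurableTypeR R * measurableTypeR R * measurableTypeR R)%type.

Section LinearChange.
Context {R : realType}.
Local Open Scope ereal_scope.
Local Notation mu := (leb R).
Local Notation mu3 := (leb3 R).
Implicit Types (G : mpt3 R -> \bar R) (A B C : pt3 R).

Lemma integral3_z G : measurable_fun setT G -> (forall p, 0 <= G p) ->
  \int[mu3]_p G p = \int[mu]_z \int[leb2 R]_xy G (xy, z).
Proof. by move=> mG G0; exact: (fubini_tonelli2 G mG G0). Qed.

Lemma integral3_xy G : measurable_fun setT G -> (forall p, 0 <= G p) ->
  \int[mu3]_p G p = \int[leb2 R]_xy \int[mu]_z G (xy, z).
Proof. by move=> mG G0; exact: (fubini_tonelli1 G mG G0). Qed.

Lemma integral2_xy (H : measurableTypeR R * measurableTypeR R -> \bar R) :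
  measurable_fun setT H -> (forall p, 0 <= H p) ->
  \int[leb2 R]_p H p = \int[mu]_x \int[mu]_y H (x, y).
Proof. by move=> mG G0; exact: (fubini_tonelli1 (m1 := mu) H mG G0). Qed.

Lemma integral2_yx (H : measurableTypeR R * measurableTypeR R -> \bar R) :
  measurable_fun setT H -> (forall p, 0 <= H p) ->
  \int[leb2 R]_p H p = \int[mu]_y \int[mu]_x H (x, y).
Proof. by move=> mG G0; exact: (fubini_tonelli2 (m1 := mu) H mG G0). Qed.

Lemma integral3_xyz G : measurable_fun setT G -> (forall p, 0 <= G p) ->
  \int[mu3]_p G p = \int[mu]_x \int[mu]_y \int[mu]_z G (x, y, z).
Proof.
move=> mG G0; rewrite integral3_xy// integral2_xy//.
  exact: (measurable_fun_fubini_tonelli_F (m2 := mu) G mG G0).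
by move=> xy; exact: integral_ge0.
Qed.

Lemma integral3_swap12 G : measurable_fun setT G -> (forall p, 0 <= G p) ->
  \int[mu3]_p G p = \int[mu3]_p G (p.1.2, p.1.1, p.2).
Proof.
move=> mG G0.
have ms : measurable_fun [set: mpt3 R]
    (fun p : mpt3 R => (p.1.2, p.1.1, p.2) : mpt3 R).
  apply: measurable_fun_pair; last exact: measurable_snd.
  apply: measurable_fun_pair.
    exact: measurableT_comp measurable_snd measurable_fst.
  exact: measurableT_comp measurable_fst measurable_fst.
have mGs : measurable_fun [set: mpt3 R] (fun p => G (p.1.2, p.1.1, p.2)).
  exact: measurableT_comp mG ms.
have Gs0 p : 0 <= G (p.1.2, p.1.1, p.2) by exact: G0.
rewrite (integral3_z mG G0) (integral3_z mGs Gs0).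
apply: eq_integral => z _.
have mH := measurableT_comp mG (pair2_measurable z).
have mHs := measurableT_comp mGs (pair2_measurable z).
rewrite (integral2_xy mH (fun xy => G0 (xy, z))).
by rewrite (integral2_yx mHs (fun xy => Gs0 (xy, z))).
Qed.

Lemma integral3_swap23 G : measurable_fun setT G -> (forall p, 0 <= G p) ->
  \int[mu3]_p G p = \int[mu3]_p G (p.1.1, p.2, p.1.2).
Proof.
move=> mG G0.
have ms : measurable_fun [set: mpt3 R]
    (fun p : mpt3 R => (p.1.1, p.2, p.1.2) : mpt3 R).
  apply: measurable_fun_pair.
    apply: measurable_fun_pair; last exact: measurable_snd.
    exact: measurableT_comp measurable_fst measurable_fst.
  exact: measurableT_comp measurable_snd measurable_fst.
have mGs : measurable_fun [set: mpt3 R] (fun p => G (p.1.1, p.2, p.1.2)).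
  exact: measurableT_comp mG ms.
have Gs0 p : 0 <= G (p.1.1, p.2, p.1.2) by exact: G0.
rewrite (integral3_xyz mG G0) (integral3_xyz mGs Gs0).
apply: eq_integral => x _.
have mx : measurable_fun [set: measurableTypeR R * measurableTypeR R]
    (fun yz : measurableTypeR R * measurableTypeR R => (x, yz.1, yz.2) : mpt3 R).
  apply: measurable_fun_pair; last exact: measurable_snd.
  by apply: measurable_fun_pair => //; exact: measurable_fst.
have mH := measurableT_comp mG mx.
exact: (fubini_tonelli (m1 := mu) (m2 := mu) _ mH (fun yz => G0 (x, yz.1, yz.2))).
Qed.

(** The change of variables formula for the matrix with columns [A], [B], [C], as a property that
    column operations propagate from the identity. *)
Let lin_change A B C := forall G, measurable_fun setT G -> (forall p, 0 <= G p) ->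
  \int[mu3]_p G p = `|det3 A B C|%:E * \int[mu3]_p G (lin3 A B C p).

Lemma measurable_lin3 A B C :
  measurable_fun [set: mpt3 R] (lin3 A B C : mpt3 R -> mpt3 R).
Proof.
have mc (a b c : R) : measurable_fun [set: mpt3 R]
    (fun p : mpt3 R => (p.1.1 * a + p.1.2 * b + p.2 * c)%R : measurableTypeR R).
  apply: measurable_funD; last first.
    by apply: measurable_funM => //; exact: measurable_snd.
  apply: measurable_funD; apply: measurable_funM => //.
    exact: measurableT_comp measurable_fst measurable_fst.
  exact: measurableT_comp measurable_snd measurable_fst.
rewrite (_ : lin3 A B C = fun p : mpt3 R =>
  ((p.1.1 * A.1.1 + p.1.2 * B.1.1 + p.2 * C.1.1)%R,
   (p.1.1 * A.1.2 + p.1.2 * B.1.2 + p.2 * C.1.2)%R,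
   (p.1.1 * A.2 + p.1.2 * B.2 + p.2 * C.2)%R)); last exact/funext.
by apply: measurable_fun_pair => //; exact: measurable_fun_pair.
Qed.

Let lin_change_swap12 A B C : lin_change B A C -> lin_change A B C.
Proof.
move=> BAC G mG G0; rewrite BAC// (_ : det3 B A C = - det3 A B C)%R; last first.
  by rewrite /det3; ring.
rewrite normrN; congr (_ * _).
rewrite integral3_swap12//; last first.
  exact: measurableT_comp mG (measurable_lin3 _ _ _).
by apply: eq_integral => p _; rewrite /lin3/= (addrC (_ *: B)).
Qed.

Let lin_change_swap23 A B C : lin_change A C B -> lin_change A B C.
Proof.
move=> ACB G mG G0; rewrite ACB// (_ : det3 A C B = - det3 A B C)%R; last first.
  by rewrite /det3; ring.
rewrite normrN; congr (_ * _).
rewrite integral3_swap23//; last first.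
  exact: measurableT_comp mG (measurable_lin3 _ _ _).
by apply: eq_integral => p _; rewrite /lin3/= addrAC.
Qed.

(** [lin3] of the new columns at [(x, y, z)] is [lin3] of the old ones at [(x, y, l z + j x + k y)],
    a map that is affine on each vertical fibre. *)
Let lin_change_add A B C (j k l : R) : l != 0%R -> lin_change A B C ->
  lin_change (A + j *: C)%R (B + k *: C)%R (l *: C)%R.
Proof.
move=> l0 ABC G mG G0; rewrite ABC//.
have -> : det3 (A + j *: C)%R (B + k *: C)%R (l *: C)%R = (l * det3 A B C)%R.
  rewrite /det3 /=; set e := _ *: _; rewrite /e /GRing.scale /=.
  by ring.
rewrite normrM EFinM (muleC `|l|%:E) -muleA; congr (_ * _).
have mGl := measurableT_comp mG (measurable_lin3 A B C).
pose kk (t : measurableTypeR R * measurableTypeR R) : R :=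
  (t.1 * j + t.2 * k)%R.
have mk : measurable_fun setT kk.
  by apply: measurable_funD; apply: measurable_funM.
have lN0 t : cst l t = 0%R ->
    \int[mu]_c (G \o lin3 A B C) (t : measurableTypeR R * measurableTypeR R, c) = 0.
  by move=> l0'; rewrite -[l]/(cst l t) l0' eqxx in l0.
rewrite [LHS](@fiberwise_affine _ _ _ (leb2 R) _ (cst l) kk mGl (fun p => G0 _)
  (@measurable_cst _ _ _ _ _ l) mk lN0).
rewrite -ge0_integralZl//; last first.
  exact: measurableT_comp mG (measurable_lin3 _ _ _).
apply: eq_integral => p _; congr (_ * G _).
by rewrite !lin3E /= /kk; congr ((_, _), _); rewrite /GRing.scale/=; ring.
Qed.

Let e1 : pt3 R := (1%R, 0%R, 0%R).
Let e2 : pt3 R := (0%R, 1%R, 0%R).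
Let e3 : pt3 R := (0%R, 0%R, 1%R).

Let lin_change_id : lin_change e1 e2 e3.
Proof.
move=> G mG G0; rewrite (_ : det3 e1 e2 e3 = 1)%R; last first.
  by rewrite /det3/=; ring.
rewrite normr1 mul1e; apply: eq_integral => p _; congr G.
by case: p => [[x y] z]; rewrite lin3E /=; congr ((_, _), _); ring.
Qed.

(* One step of Gaussian elimination by columns, with [C] as the pivot. *)
Let lin_change_pivot A B C (a b c : R) : c != 0%R ->
  lin_change (A - a *: C)%R (B - b *: C)%R (c^-1 *: C)%R -> lin_change A B C.
Proof.
move=> c0 /(@lin_change_add _ _ _ (a * c) (b * c) c c0)%R.
rewrite !scalerA -!mulrA !divff// !mulr1 !subrK.
by rewrite scale1r.
Qed.

Let lin_change_diag A B C : A.1.1 != 0%R -> A.1.2 = 0%R -> A.2 = 0%R ->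
  B.1.2 = 1%R -> B.2 = 0%R -> C.1.2 = 0%R -> C.2 = 1%R -> lin_change A B C.
Proof.
case: A B C => [[a1 a2] a3] [[b1 b2] b3] [[c1 c2] c3] /= a0 -> -> -> -> -> ->.
apply/lin_change_swap12/lin_change_swap23.
apply: (@lin_change_pivot _ _ _ (b1 / a1) (c1 / a1) _ a0)%R.
apply/lin_change_swap23/lin_change_swap12.
have -> : (a1^-1 *: (a1, 0, 0) = e1)%R.
  by apply: pt3P; rewrite /= /GRing.scale/= ?mulr0// mulVf.
have -> : ((b1, 1, 0) - b1 / a1 *: (a1, 0, 0) = e2)%R.
  by apply: pt3P; rewrite /= /GRing.scale/= ?mulr0 ?subr0// divfK// subrr.
have -> : ((c1, 0, 1) - c1 / a1 *: (a1, 0, 0) = e3)%R.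
  by apply: pt3P; rewrite /= /GRing.scale/= ?mulr0 ?subr0// divfK// subrr.
exact: lin_change_id.
Qed.

Let lin_change_plane A B C : det3 A B C != 0%R -> A.2 = 0%R -> B.2 = 0%R ->
  C.2 = 1%R -> lin_change A B C.
Proof.
wlog b0 : A B / B.1.2 != 0%R.
  move=> H d A2 B2 C2; have [b0|b0] := eqVneq B.1.2 0%R; last exact: H.
  apply: lin_change_swap12; apply: H => //.
    by apply: contraNneq d => a0; rewrite /det3 a0 b0 A2 B2; apply/eqP; ring.
  by rewrite (_ : det3 B A C = - det3 A B C)%R ?oppr_eq0// /det3; ring.
case: A B C b0 => [[a1 a2] a3] [[b1 b2] b3] [[c1 c2] c3] /= b0 d a30 b30 c31.
move: a30 b30 c31 d => -> -> -> d.
apply: lin_change_swap23.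
apply: (@lin_change_pivot _ _ _ (a2 / b2) (c2 / b2) _ b0)%R.
apply: lin_change_swap23.
apply: lin_change_diag; rewrite /= /GRing.scale/= ?mulr0 ?subr0//.
- apply: contraNneq d; rewrite /det3 /= => h; apply/eqP.
  by transitivity (b2 * (a1 - a2 / b2 * b1))%R; [field|rewrite h mulr0].
- by rewrite divfK// subrr.
- by rewrite mulVf.
- by rewrite divfK// subrr.
Qed.

Lemma ge0_integral_lin3 A B C G : det3 A B C != 0%R ->
  measurable_fun setT G -> (forall p, 0 <= G p) ->
  \int[mu3]_p G p = `|det3 A B C|%:E * \int[mu3]_p G (lin3 A B C p).
Proof.
suff: det3 A B C != 0%R -> lin_change A B C by move=> H /H; apply.
(* As the determinant is nonzero, some column has a nonzero third coordinate; a permutation of the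
   columns makes it the pivot. *)
wlog c0 : A B C / C.2 != 0%R.
  move=> H d; have [c0|] := eqVneq C.2 0%R; last by move=> c0; exact: H.
  have [b0|b0] := eqVneq B.2 0%R.
    apply/lin_change_swap12/lin_change_swap23; apply: H.
      apply: contraNneq d => a0; rewrite /det3 a0 b0 c0; apply/eqP; ring.
    by rewrite (_ : det3 B C A = det3 A B C)%R// /det3; ring.
  apply: lin_change_swap23; apply: H => //.
  by rewrite (_ : det3 A C B = - det3 A B C)%R ?oppr_eq0// /det3; ring.
case: A B C c0 => [[a1 a2] a3] [[b1 b2] b3] [[c1 c2] c3] /= c0 d.
apply: (@lin_change_pivot _ _ _ (a3 / c3) (b3 / c3) _ c0)%R.
apply: lin_change_plane; rewrite /= /GRing.scale/=.
- apply: contraNneq d; rewrite /det3 /= /GRing.scale/= => h; apply/eqP.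
  by rewrite -[RHS](mulr0 c3) -[X in _ = (c3 * X)%R]h; field.
- by rewrite divfK// subrr.
- by rewrite divfK// subrr.
- by rewrite mulVf.
Qed.

Let integral3_shift_z (c : R) G : measurable_fun setT G ->
  (forall p, 0 <= G p) ->
  \int[mu3]_p G p = \int[mu3]_p G (p.1, p.2 + c)%R.
Proof.
move=> mG G0.
have N0 t : cst (1%R : R) t = 0%R -> \int[mu]_z
    G (t : measurableTypeR R * measurableTypeR R, z : measurableTypeR R) = 0.
  by move=> h; have := oner_neq0 R; rewrite -[1%R]/(cst (1%R : R) t) h eqxx.
rewrite [LHS](@fiberwise_affine _ _ _ (leb2 R) G (cst 1%R) (cst c) mG G0
  (@measurable_cst _ _ _ _ _ (1%R : R)) (@measurable_cst _ _ _ _ _ c) N0).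
by apply: eq_integral => p _; rewrite /= normr1 mul1e mul1r.
Qed.

Let measurable_perm12 :
  measurable_fun [set: mpt3 R] (fun p : mpt3 R => (p.1.2, p.1.1, p.2) : mpt3 R).
Proof.
apply: measurable_fun_pair; last exact: measurable_snd.
apply: measurable_fun_pair.
  exact: measurableT_comp measurable_snd measurable_fst.
exact: measurableT_comp measurable_fst measurable_fst.
Qed.

Let measurable_perm23 :
  measurable_fun [set: mpt3 R] (fun p : mpt3 R => (p.1.1, p.2, p.1.2) : mpt3 R).
Proof.
apply: measurable_fun_pair.
  apply: measurable_fun_pair; last exact: measurable_snd.
  exact: measurableT_comp measurable_fst measurable_fst.
exact: measurableT_comp measurable_snd measurable_fst.
Qed.

Let measurable_shift_z (c : R) :
  measurable_fun [set: mpt3 R] (fun p : mpt3 R => (p.1, p.2 + c)%R : mpt3 R).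
Proof.
by apply: measurable_fun_pair => //; apply: measurable_funD.
Qed.

Let integral3_shift_y (b : R) G : measurable_fun setT G ->
  (forall p, 0 <= G p) ->
  \int[mu3]_p G p = \int[mu3]_p G (p.1.1, p.1.2 + b, p.2)%R.
Proof.
move=> mG G0; rewrite integral3_swap23//.
rewrite (integral3_shift_z b (measurableT_comp mG measurable_perm23) (fun p => G0 _)).
have mS := measurableT_comp mG
  (measurableT_comp measurable_perm23 (measurable_shift_z b)).
exact: (integral3_swap23 mS (fun p => G0 _)).
Qed.

Let measurable_shift_y (b : R) : measurable_fun [set: mpt3 R]
  (fun p : mpt3 R => (p.1.1, p.1.2 + b, p.2)%R : mpt3 R).
Proof.
exact: measurableT_comp measurable_perm23
  (measurableT_comp (measurable_shift_z b) measurable_perm23).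
Qed.

Let integral3_shift_x (a : R) G : measurable_fun setT G ->
  (forall p, 0 <= G p) ->
  \int[mu3]_p G p = \int[mu3]_p G (p.1.1 + a, p.1.2, p.2)%R.
Proof.
move=> mG G0; rewrite integral3_swap12//.
rewrite (integral3_shift_y a (measurableT_comp mG measurable_perm12) (fun p => G0 _)).
have mS := measurableT_comp mG
  (measurableT_comp measurable_perm12 (measurable_shift_y a)).
exact: (integral3_swap12 mS (fun p => G0 _)).
Qed.

Lemma ge0_integral_affine3 (e : pt3 R) A B C G : det3 A B C != 0%R ->
  measurable_fun setT G -> (forall p, 0 <= G p) ->
  \int[mu3]_p G p =
  `|det3 A B C|%:E * \int[mu3]_p G (e + lin3 A B C p)%R.
Proof.
move=> d mG G0.
have mz := measurableT_comp mG (measurable_shift_z e.2).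
have myz := measurableT_comp mz (measurable_shift_y e.1.2).
have mxyz : measurable_fun [set: mpt3 R] (fun p : mpt3 R =>
    G ((p.1.1 + e.1.1)%R, (p.1.2 + e.1.2)%R, (p.2 + e.2)%R)).
  exact: measurableT_comp myz (measurableT_comp measurable_perm12
    (measurableT_comp (measurable_shift_y e.1.1) measurable_perm12)).
rewrite (integral3_shift_z e.2 mG)//.
rewrite [LHS](integral3_shift_y e.1.2 mz (fun p => G0 _)).
rewrite [LHS](integral3_shift_x e.1.1 myz (fun p => G0 _)).
rewrite [LHS](ge0_integral_lin3 d mxyz (fun p => G0 _)).
congr (_ * _); apply: eq_integral => p _; congr G.
by apply: pt3P => /=; rewrite addrC.
Qed.

End LinearChange.

(** * Integrals over intervals *)

Section OpenIntervals.
Context {R : realType}.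
Local Notation mu := (@lebesgue_measure R).
Implicit Types (F f : R -> R) (a b : R).

(** Monotone convergence along closed intervals carries theorems about compact intervals over to
    integrands with logarithmic singularities at the end points. *)
Lemma ge0_cvg_integral_itv f a b (u v : nat -> R) :
  (forall n, a < u n) -> (forall n, v n < b) ->
  nonincreasing_seq u -> nondecreasing_seq v ->
  u n @[n --> \oo] --> a -> v n @[n --> \oo] --> b ->
  {in `]a, b[, forall x, 0 <= f x} -> {in `]a, b[, continuous f} ->
  (\int[mu]_(x in `[u n, v n]) (f x)%:E @[n --> \oo] -->
   \int[mu]_(x in `]a, b[) (f x)%:E)%E.
Proof.
move=> au vb du dv ua vb' f0 cf.
pose E n : set R := `[u n, v n]%classic.
have sub n x : x \in `[u n, v n] -> x \in `]a, b[.
  rewrite !in_itv/= => /andP[ux xv].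
  by rewrite (lt_le_trans (au n))// (le_lt_trans xv).
have UE : \bigcup_n E n = `]a, b[%classic.
  apply/seteqP; split => [x [n _ /sub//]|x].
  rewrite /= in_itv/= => /andP[ax xb].
  have [n un] : exists n, forall k, (n <= k)%N -> u k <= x.
    have xa : 0 < x - a by rewrite subr_gt0.
    have /cvgrPdist_lt /(_ _ xa)[n _ H] := ua.
    exists n => k nk; have := H k nk; rewrite /= distrC gtr0_norm ?subr_gt0//.
    by rewrite ltrD2r => /ltW.
  have [m vm] : exists m, forall k, (m <= k)%N -> x <= v k.
    have bx : 0 < b - x by rewrite subr_gt0.
    have /cvgrPdist_lt /(_ _ bx)[m _ H] := vb'.
    exists m => k mk; have := H k mk; rewrite /= gtr0_norm ?subr_gt0//.
    by rewrite ltrD2l ltrN2 => /ltW.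
  exists (maxn n m) => //.
  by rewrite /E /= in_itv/= un ?vm// ?leq_maxr ?leq_maxl.
have ndE : nondecreasing_seq E.
  move=> m n mn; apply/subsetPset => x; rewrite /E /= !in_itv/= => /andP[ux xv].
  by rewrite (le_trans (du _ _ mn))// (le_trans xv)// dv.
have mE n : measurable (E n) by exact: measurable_itv.
have mf n : measurable_fun (E n) (EFin \o f).
  apply/measurable_EFinP; apply: subspace_continuous_measurable_fun => //.
  by apply: continuous_in_subspaceT => x /[!inE] xE; apply: cf; exact: sub xE.
have fE0 n x : E n x -> (0 <= (EFin \o f) x)%E.
  by move=> xE; rewrite lee_fin f0// (sub n).
rewrite -UE.
exact: (ge0_nondecreasing_set_cvg_integral (mu := mu) ndE mE mf fE0).
Qed.

(** The factor 1/3 keeps [a + inner_seq] below [b - inner_seq] already at [n = 0], where [harmonic]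
    is 1. *)
Definition inner_seq a b (n : nat) : R := (b - a) / 3 * harmonic n.

Lemma inner_seq_gt0 a b n : a < b -> 0 < inner_seq a b n.
Proof. by move=> ab; rewrite !mulr_gt0 ?subr_gt0 ?harmonic_gt0. Qed.

Lemma inner_seq_lt a b n : a < b -> a + inner_seq a b n < b - inner_seq a b n.
Proof.
move=> ab; have : inner_seq a b n <= (b - a) / 3.
  rewrite -[leRHS]mulr1; apply: ler_wpM2l.
    by rewrite divr_ge0// subr_ge0 ltW.
  by rewrite /harmonic /= invf_le1// ler1n.
by have := ab; lra.
Qed.

Lemma inner_seq_mono a b : a < b -> nonincreasing_seq (inner_seq a b).
Proof.
move=> ab m n mn; apply: ler_wpM2l; first by rewrite divr_ge0// subr_ge0 ltW.
by rewrite /harmonic /= lef_pV2 ?posrE// ler_nat.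
Qed.

Lemma inner_seq_cvg a b : inner_seq a b n @[n --> \oo] --> (0 : R).
Proof.
rewrite -(mulr0 ((b - a) / 3)).
by apply: cvgM; [exact: cvg_cst|exact: cvg_harmonic].
Qed.

Lemma inner_seq_cvgl a b : a + inner_seq a b n @[n --> \oo] --> a.
Proof.
by rewrite -[X in _ --> X]addr0; apply: cvgD; [exact: cvg_cst|exact: inner_seq_cvg].
Qed.

Lemma inner_seq_cvgr a b : b - inner_seq a b n @[n --> \oo] --> b.
Proof.
by rewrite -[X in _ --> X]subr0; apply: cvgB; [exact: cvg_cst|exact: inner_seq_cvg].
Qed.

Lemma cvg_inner_integral f a b : a < b ->
  {in `]a, b[, forall x, 0 <= f x} -> {in `]a, b[, continuous f} ->
  (\int[mu]_(x in `[(a + inner_seq a b n)%R, (b - inner_seq a b n)%R]) (f x)%:E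
     @[n --> \oo] --> \int[mu]_(x in `]a, b[) (f x)%:E)%E.
Proof.
move=> ab f0 cf; apply: ge0_cvg_integral_itv => //.
- by move=> n; rewrite ltrDl inner_seq_gt0.
- by move=> n; rewrite gtrBl inner_seq_gt0.
- by move=> m n mn; rewrite lerD2l inner_seq_mono.
- by move=> m n mn; rewrite lerD2l lerN2 inner_seq_mono.
- exact: inner_seq_cvgl.
- exact: inner_seq_cvgr.
Qed.

(** Only the antiderivative has to extend to the end points; [f] may be unbounded there. *)
Lemma ge0_FTC_open F f a b : a < b ->
  {in `]a, b[, forall x, 0 <= f x} -> {in `]a, b[, continuous f} ->
  {in `]a, b[, forall x : R, is_derive x (1 : R) F (f x)} ->
  F x @[x --> a^'+] --> F a -> F x @[x --> b^'-] --> F b ->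
  (\int[mu]_(x in `]a, b[) (f x)%:E = (F b - F a)%:E)%E.
Proof.
move=> ab f0 cf dF Fa Fb.
pose e n := inner_seq a b n.
have e0 n : 0 < e n by exact: inner_seq_gt0.
have eab n : a + e n < b - e n by exact: inner_seq_lt.
have sub n x : x \in `[a + e n, b - e n] -> x \in `]a, b[.
  rewrite !in_itv/= => /andP[ax xb]; apply/andP; split.
    by apply: lt_le_trans ax; rewrite ltrDl.
  by apply: le_lt_trans xb _; rewrite ltrBlDr ltrDl.
have H := cvg_inner_integral ab f0 cf.
have FE n : (\int[mu]_(x in `[(a + e n)%R, (b - e n)%R]) (f x)%:E =
    (F (b - e n) - F (a + e n))%:E)%E.
  rewrite EFinB; apply: continuous_FTC2 (eab n) _ _ _.
  - by apply: continuous_in_subspaceT => x /[!inE] xE; apply: cf; exact: sub xE.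
  - have dFc x : x \in `[a + e n, b - e n] -> {for x, continuous F}.
      move=> /sub/dF dFx; apply: differentiable_continuous.
      by apply/derivable1_diffP; case: dFx.
    split.
    + by move=> x xE; case: (dF x) => //; apply: (sub n); exact: subset_itv_oo_cc.
    + by apply: cvg_at_right_filter; apply: dFc; rewrite in_itv/= lexx ltW.
    + by apply: cvg_at_left_filter; apply: dFc; rewrite in_itv/= lexx ltW.
  - move=> x xE; rewrite derive1E; have [] := dF x _ => //.
    by apply: (sub n); exact: subset_itv_oo_cc.
have Fae : F (a + e n) @[n --> \oo] --> F a.
  move/cvg_at_rightP : Fa; apply; split=> [n|]; first by rewrite ltrDl.
  exact: inner_seq_cvgl.
have Fbe : F (b - e n) @[n --> \oo] --> F b.
  move/cvg_at_leftP : Fb; apply; split=> [n|]; first by rewrite gtrBl.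
  exact: inner_seq_cvgr.
rewrite (_ : (fun n => _) = fun n => (F (b - e n) - F (a + e n))%:E) in H;
  last exact/funext.
apply: (cvg_unique _ H) => //.
by apply: cvg_EFin; [exact: nearW|apply: cvgB].
Qed.

(** Since [f] may be singular at 0 and 1, substitution is applied on inner intervals. Their images
    under [h] exhaust []0, 1[] because [h] is increasing, continuous and fixes both end points. *)
Lemma ge0_substitution01 (h dh f : R -> R) :
  h 0 = 0 -> h 1 = 1 -> {in `[0, 1] &, {homo h : x y / x < y}} ->
  {in `[0, 1], forall x : R, is_derive x (1 : R) h (dh x)} ->
  {in `[0, 1], forall x, {for x, continuous dh}} ->
  {in `]0, 1[, forall x, 0 <= dh x} ->
  {in `]0, 1[, forall x, 0 <= f x} -> {in `]0, 1[, continuous f} ->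
  (\int[mu]_(x in `]0%R, 1%R[) (f x)%:E =
   \int[mu]_(x in `]0%R, 1%R[) (f (h x) * dh x)%:E)%E.
Proof.
move=> h0 h1 hmono dhE dhc dh0 f0 cf.
pose e n := inner_seq 0 1 n.
have e0 n : 0 < e n by exact: inner_seq_gt0.
have eab n : 0 + e n < 1 - e n by exact: inner_seq_lt.
have ch x : x \in `[0, 1] -> {for x, continuous h}.
  by move=> /dhE[+ _] => /derivable1_diffP; exact: differentiable_continuous.
have h01 x : x \in `]0, 1[ -> h x \in `]0, 1[.
  rewrite !in_itv/= => /andP[x0 x1].
  by rewrite -{1}h0 -h1 !hmono// in_itv/= ?lexx ?ler01// !ltW.
have sub n x : x \in `[0 + e n, 1 - e n] -> x \in `]0, 1[.
  rewrite !in_itv/= => /andP[ax xb]; apply/andP; split.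
    by apply: lt_le_trans ax; rewrite ltrDl.
  by apply: le_lt_trans xb _; rewrite ltrBlDr ltrDl.
have cfh x : x \in `]0, 1[ -> {for x, continuous (fun x => f (h x) * dh x)}.
  move=> x01; apply: cvgM; last by apply: dhc; exact: subset_itv_oo_cc.
  by apply: continuous_comp; [apply: ch; exact: subset_itv_oo_cc|apply: cf; exact: h01].
have H1 := cvg_inner_integral ltr01 _ cfh.
have {}H1 := H1 (fun x x01 => mulr_ge0 (f0 _ (h01 _ x01)) (dh0 _ x01)).
have lo n : 0 + e n \in `]0, 1[.
  by apply: (sub n); rewrite in_itv/= lexx ltW.
have hi n : 1 - e n \in `]0, 1[.
  by apply: (sub n); rewrite in_itv/= lexx ltW.
have wmono : {in `[0, 1] &, {homo h : x y / x <= y}}.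
  by move=> x y x01 y01; rewrite !le_eqVlt => /orP[/eqP->|/(hmono _ _ x01 y01)->];
    rewrite ?eqxx ?orbT.
have cc x : x \in `]0, 1[ -> x \in `[0 : R, 1] by exact: subset_itv_oo_cc.
have H2 : (\int[mu]_(x in `[h (0 + e n)%R, h (1 - e n)%R]) (f x)%:E @[n --> \oo] -->
   \int[mu]_(x in `]0%R, 1%R[) (f x)%:E)%E.
  apply: ge0_cvg_integral_itv => //.
  - by move=> n; have := h01 _ (lo n); rewrite in_itv/= => /andP[].
  - by move=> n; have := h01 _ (hi n); rewrite in_itv/= => /andP[].
  - by move=> m n mn; apply: wmono; rewrite ?cc// lerD2l inner_seq_mono.
  - by move=> m n mn; apply: wmono; rewrite ?cc// lerD2l lerN2 inner_seq_mono.
  - rewrite -[X in _ --> X]h0; apply: continuous_cvg; last exact: inner_seq_cvgl.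
    by apply: ch; rewrite in_itv/= lexx ler01.
  - rewrite -[X in _ --> X]h1; apply: continuous_cvg; last exact: inner_seq_cvgr.
    by apply: ch; rewrite in_itv/= lexx ler01.
have dhE1 x : x \in `[0, 1] -> h^`()%classic x = dh x.
  by move=> x01; rewrite derive1E; have [] := dhE x x01.
rewrite (_ : (fun n => _) = fun n =>
    (\int[mu]_(x in `[(0 + e n)%R, (1 - e n)%R]) (f (h x) * dh x)%:E)%E) in H2.
  exact: cvg_unique H2 H1.
apply/funext => n.
have cdh x : x \in `]0, 1[ -> {for x, continuous h^`()%classic}.
  move=> x01; rewrite /prop_for /continuous_at dhE1 ?cc//.
  apply: (cvg_trans _ (dhc x (cc _ x01))); apply: near_eq_cvg.
  near=> y; rewrite dhE1// cc//.
  by near: y; exact: near_in_itvoo.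
rewrite integration_by_substitution_increasing ?ltW//.
- apply: eq_integral => x; rewrite inE/= => xE; rewrite !fctE/= dhE1//.
  by apply: cc; exact: sub xE.
- by move=> x y xE yE; apply: hmono; apply: cc; [exact: sub xE|exact: sub yE].
- by move=> x xE; apply: cdh; apply: (sub n); exact: subset_itv_oo_cc.
- by apply/cvg_ex; exists (h^`()%classic (0 + e n)); apply: cvg_at_right_filter; exact: cdh.
- by apply/cvg_ex; exists (h^`()%classic (1 - e n)); apply: cvg_at_left_filter; exact: cdh.
- split.
  + move=> x xE; have [] := dhE x _ => //; apply: cc; apply: (sub n).
    exact: subset_itv_oo_cc.
  + by apply: cvg_at_right_filter; apply: ch; exact: cc.
  + by apply: cvg_at_left_filter; apply: ch; exact: cc.
- apply: continuous_in_subspaceT => x /[!inE] xE; apply: cf.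
  move: xE; rewrite /= !in_itv/= => /andP[x1 x2].
  have := h01 _ (lo n); have := h01 _ (hi n); rewrite !in_itv/=.
  by move=> /andP[_ b1] /andP[a0 _]; rewrite (lt_le_trans a0)// (le_lt_trans x2).
Unshelve. all: by end_near. Qed.

End OpenIntervals.

(** * Derivatives of explicit expressions *)

Section Derivatives.
Context {R : realType}.
Implicit Types (f g : R -> R) (x df dg : R).
Local Notation D x f df := (is_derive x (1 : R) f df).

Lemma der_cst x (c : R) : D x (fun=> c) 0.
Proof. exact: is_derive_cst. Qed.

Lemma der_id x : D x (fun y => y) 1.
Proof. exact: is_derive_id. Qed.

Lemma der_add x f g df dg :
  D x f df -> D x g dg -> D x (fun y => f y + g y) (df + dg).
Proof. exact: is_deriveD. Qed.

Lemma der_opp x f df : D x f df -> D x (fun y => - f y) (- df).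
Proof. exact: is_deriveN. Qed.

Lemma der_mul x f g df dg :
  D x f df -> D x g dg -> D x (fun y => f y * g y) (df * g x + f x * dg).
Proof.
move=> hf hg; apply: (@is_derive_eq _ _ _ (f * g)).
by rewrite /GRing.scale/= addrC (mulrC df).
Qed.

Lemma der_exp x f df n :
  D x f df -> D x (fun y => f y ^+ n) (n%:R * f x ^+ n.-1 * df).
Proof.
move=> hf; rewrite (_ : (fun y => _) = f ^+ n); first exact: is_deriveX.
by apply/funext => y; rewrite exprfctE.
Qed.

Lemma der_comp x f g df dg :
  D (g x) f df -> D x g dg -> D x (fun y => f (g y)) (df * dg).
Proof. exact: is_derive1_comp. Qed.

Lemma der_inv x f df : f x != 0 -> D x f df ->
  D x (fun y => (f y)^-1) (- df / f x ^+ 2).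
Proof.
move=> f0 hf; have h := is_deriveV f0; apply: is_derive_eq.
by rewrite /GRing.scale/= mulrC mulrN mulNr.
Qed.

Lemma der_ln x f df : 0 < f x -> D x f df -> D x (fun y => ln (f y)) (df / f x).
Proof.
move=> f0 hf; have h := is_derive1_ln f0; rewrite mulrC; exact: der_comp.
Qed.

Lemma is_derive_continuous x f df : D x f df -> {for x, continuous f}.
Proof. by move=> [+ _] => /derivable1_diffP; exact: differentiable_continuous. Qed.

End Derivatives.

(** The rules above are stated for functions in lambda form so that the goal can be matched
    syntactically. Constant subterms are caught first; the side conditions for inverses and
    logarithms are left as goals. *)
Ltac der := lazymatch goal with
  | |- is_derive _ _ (fun=> ?c) _ => exact (der_cst _ c)
  | |- is_derive _ _ (fun y => y) _ => exact (der_id _)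
  | |- is_derive _ _ (fun y => GRing.add (@?f y) (@?g y)) _ =>
      notypeclasses refine (@der_add _ _ f g _ _ _ _); der
  | |- is_derive _ _ (fun y => GRing.opp (@?f y)) _ =>
      notypeclasses refine (@der_opp _ _ f _ _); der
  | |- is_derive _ _ (fun y => GRing.mul (@?f y) (@?g y)) _ =>
      notypeclasses refine (@der_mul _ _ f g _ _ _ _); der
  | |- is_derive _ _ (fun y => GRing.exp (@?f y) ?n) _ =>
      notypeclasses refine (@der_exp _ _ f _ n _); der
  | |- is_derive _ _ (fun y => GRing.inv (@?f y)) _ =>
      notypeclasses refine (@der_inv _ _ f _ _ _); [|der]
  | |- is_derive _ _ (fun y => ln (@?f y)) _ =>
      notypeclasses refine (@der_ln _ _ f _ _ _); [|der]
  | |- _ => idtac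
  end; cbv beta.

Ltac der_eq := notypeclasses refine (is_derive_eq _ _); [der|].

(** * Integrals of rational functions *)

Section RationalIntegrals.
Context {R : realType}.
Local Notation mu := (@lebesgue_measure R).

(** The derivative [df] of the integrand supplies its continuity in a form that [der] can
    produce. *)
Lemma ge0_FTC_closed (F f df : R -> R) a b : a < b ->
  {in `]a, b[, forall x, 0 <= f x} ->
  {in `[a, b], forall x : R, is_derive x (1 : R) F (f x)} ->
  {in `]a, b[, forall x : R, is_derive x (1 : R) f (df x)} ->
  (\int[mu]_(x in `]a, b[) (f x)%:E = (F b - F a)%:E)%E.
Proof.
move=> ab f0 dF dfE.
have cF x : x \in `[a, b] -> {for x, continuous F}.
  by move=> /dF; exact: is_derive_continuous.
apply: ge0_FTC_open => //.
- by move=> x /dfE; exact: is_derive_continuous.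
- by move=> x xab; apply: dF; exact: subset_itv_oo_cc.
- by apply: cvg_at_right_filter; apply: cF; rewrite in_itv/= lexx ltW.
- by apply: cvg_at_left_filter; apply: cF; rewrite in_itv/= lexx ltW.
Qed.

Lemma ge0_FTC_closedZ (c : R) (F f df : R -> R) a b : 0 <= c -> a < b ->
  {in `]a, b[, forall x, 0 <= f x} ->
  {in `[a, b], forall x : R, is_derive x (1 : R) F (f x)} ->
  {in `]a, b[, forall x : R, is_derive x (1 : R) f (df x)} ->
  (\int[mu]_(x in `]a, b[) (c * f x)%:E = (c * (F b - F a))%:E)%E.
Proof.
move=> c0 ab f0 dF dfE; rewrite mulrBr.
apply: (@ge0_FTC_closed (fun x => c * F x) (fun x => c * f x)
  (fun x => c * df x)) => //.
- by move=> x /f0 fx; rewrite mulr_ge0.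
- by move=> x /dF Fx; have := der_mul (der_cst x c) Fx; rewrite mul0r add0r.
- by move=> x /dfE Fx; have := der_mul (der_cst x c) Fx; rewrite mul0r add0r.
Qed.

Let pos_affine (p q x : R) : 0 < p -> 0 < q -> 0 <= x -> x <= 1 ->
  0 < p * x + q * (1 - x).
Proof. by move=> p0 q0 x0 x1; nra. Qed.

(** The antiderivative [x / (q (p x + q (1 - x)))] differs from the usual one by a constant that
    removes the denominator [p - q], so that [p = q] is no exception. The next lemma uses the same
    device. *)
Lemma integral_inv_affine_sq (c p q t : R) : 0 <= c -> 0 < p -> 0 < q -> 0 < t -> t <= 1 ->
  (\int[mu]_(x in `]0%R, t[) (c * (p * x + q * (1 - x)) ^- 2)%:E =
   (c * (t / (q * (p * t + q * (1 - t)))))%:E)%E.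
Proof.
move=> c0 p0 q0 t0 t1.
have pos x : 0 <= x <= t -> 0 < p * x + q * (1 - x).
  by move=> /andP[x0 xt]; apply: pos_affine => //; exact: le_trans xt t1.
rewrite (@ge0_FTC_closedZ c (fun x => x / (q * (p * x + q * (1 - x)))) _
  (fun x => - 2 * (p - q) / (p * x + q * (1 - x)) ^+ 3))//.
- by rewrite mul0r subr0.
- by move=> x _; rewrite invr_ge0 sqr_ge0.
- move=> x; rewrite in_itv/= => xt; have {}xt := pos _ xt.
  apply: is_derive_eq.
    by der; rewrite mulf_neq0// gt_eqF.
  by rewrite /GRing.scale/=; field; rewrite !gt_eqF.
- move=> x /subset_itv_oo_cc; rewrite in_itv/= => xt; have {}xt := pos _ xt.
  apply: is_derive_eq.
    by der; rewrite expf_neq0// gt_eqF.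
  by rewrite /GRing.scale/=; field; rewrite !gt_eqF.
Qed.

Lemma integral_id_div_cube (c p q : R) : 0 <= c -> 0 < p -> 0 < q ->
  (\int[mu]_(x in `]0%R, 1%R[) (c * (x / (p * x + q * (1 - x)) ^+ 3))%:E =
   (c / (2 * p ^+ 2 * q))%:E)%E.
Proof.
move=> c0 p0 q0.
have pos x : 0 <= x <= 1 -> 0 < p * x + q * (1 - x).
  by move=> /andP[x0 x1]; exact: pos_affine.
rewrite (@ge0_FTC_closedZ c (fun x => x ^+ 2 / (2 * q * (p * x + q * (1 - x)) ^+ 2)) _
  (fun x => (p * x + q * (1 - x) - 3 * x * (p - q)) /
            (p * x + q * (1 - x)) ^+ 4))//.
- by congr EFin; field; rewrite !gt_eqF.
- move=> x; rewrite in_itv/= => /andP[x0 x1].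
  by rewrite divr_ge0 ?exprn_ge0 ?ltW// pos// !ltW.
- move=> x; rewrite in_itv/= => xt; have {}xt := pos _ xt.
  apply: is_derive_eq.
    by der; rewrite !mulf_neq0// ?expf_neq0// gt_eqF.
  by rewrite /GRing.scale/=; field; rewrite !gt_eqF.
- move=> x /subset_itv_oo_cc; rewrite in_itv/= => xt; have {}xt := pos _ xt.
  apply: is_derive_eq.
    by der; rewrite expf_neq0// gt_eqF.
  by rewrite /GRing.scale/=; field; rewrite !gt_eqF.
Qed.

Lemma integral_inv_affine_prod (c p q r s : R) :
  0 <= c -> 0 < p -> 0 < q -> 0 < r -> 0 < s -> p * s != q * r ->
  (\int[mu]_(x in `]0%R, 1%R[)
     (c * ((p * x + q * (1 - x)) * (r * x + s * (1 - x)))^-1)%:E =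
   (c * (ln (p * s / (q * r)) / (p * s - q * r)))%:E)%E.
Proof.
move=> c0 p0 q0 r0 s0 pqrs.
have d0 : p * s - q * r != 0 by rewrite subr_eq0.
have pos x (a b : R) : 0 < a -> 0 < b -> 0 <= x <= 1 -> 0 < a * x + b * (1 - x).
  by move=> a0 b0 /andP[x0 x1]; exact: pos_affine.
rewrite (@ge0_FTC_closedZ c (fun x => (ln (p * x + q * (1 - x)) -
    ln (r * x + s * (1 - x))) / (p * s - q * r)) _
  (fun x => - ((p - q) * (r * x + s * (1 - x)) + (p * x + q * (1 - x)) * (r - s))
    / ((p * x + q * (1 - x)) * (r * x + s * (1 - x))) ^+ 2))//.
- rewrite !mulr1 !mulr0 !subrr !subr0 !mulr0 !addr0 !mulr1 !add0r.
  rewrite -mulrBl ln_div ?posrE ?mulr_gt0// !lnM ?posrE//.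
  by congr (EFin (_ * (_ / _))); ring.
- move=> x /subset_itv_oo_cc; rewrite in_itv/= => xt.
  by rewrite invr_ge0 mulr_ge0// ltW// pos.
- move=> x; rewrite in_itv/= => xt.
  have X := pos _ p q p0 q0 xt; have Y := pos _ r s r0 s0 xt.
  apply: is_derive_eq; first by der.
  by rewrite /GRing.scale/=; field; rewrite d0 !gt_eqF.
- move=> x /subset_itv_oo_cc; rewrite in_itv/= => xt.
  have X := pos _ p q p0 q0 xt; have Y := pos _ r s r0 s0 xt.
  apply: is_derive_eq; first by der; rewrite mulf_neq0// gt_eqF.
  by rewrite /GRing.scale/=; field; rewrite !gt_eqF.
Qed.

End RationalIntegrals.

(** * Volumes in the Klein model *)

Definition bary (R : realType) (e0 e1 e2 e3 : pt3 R) (w0 w1 w2 w3 : R) : pt3 R :=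
  w0 *: e0 + w1 *: e1 + w2 *: e2 + w3 *: e3.

Definition hull4 (R : realType) (e0 e1 e2 e3 : pt3 R) : set (pt3 R) :=
  [set p | exists w0 w1 w2 w3 : R,
    [/\ 0 <= w0, 0 <= w1, 0 <= w2 & 0 <= w3] /\
    w0 + w1 + w2 + w3 = 1 /\ p = bary e0 e1 e2 e3 w0 w1 w2 w3].

(** The edge vectors follow the path [e0, e3, e2, e1]: in these coordinates the hull is the ordered
    simplex [0 <= u3 <= u2 <= u1 <= 1], which two fibrewise scalings open into a cube. *)
Definition vol4 (R : realType) (e0 e1 e2 e3 : pt3 R) : R :=
  det3 (e3 - e0) (e2 - e3) (e1 - e2).

(** [a] runs along the chord from [e0] to the opposite face, [s] from [e3] to the edge [e1 e2], and
    [x] along that edge; the Jacobian is proportional to [a ^ 2 s]. *)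
Definition cube_pt (R : realType) (e0 e1 e2 e3 : pt3 R) (x s a : R) : pt3 R :=
  bary e0 e1 e2 e3 (1 - a) (a * (s * x)) (a * (s * (1 - x))) (a * (1 - s)).

Section SimplexIntegral.
Context {R : realType}.
Local Open Scope ereal_scope.
Local Notation mu := (leb R).
Local Notation mu3 := (leb3 R).

Let integral_clip (h : R -> \bar R) :
  measurable_fun [set: measurableTypeR R] h ->
  (forall t, ~~ (0 <= t <= 1)%R -> h t = 0) ->
  \int[mu]_t h t = \int[mu]_(t in `]0%R, 1%R[) h t.
Proof.
move=> mh h0; rewrite -(@integral_itv_bndoo _ _ _ _ true false); last first.
  exact: measurable_funTS.
rewrite [RHS]integral_mkcond; apply: eq_integral => t _.
rewrite patchE; case: ifPn => // /negP; rewrite inE/= in_itv/= => /negP.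
exact: h0.
Qed.

Let integral_supp0 (h : R -> \bar R) :
  (forall t, t != 0%R -> h t = 0) -> \int[mu]_t h t = 0.
Proof.
move=> h0; transitivity (\int[mu]_(t in [set 0%R]) h t).
  rewrite [RHS]integral_mkcond; apply: eq_integral => t _.
  rewrite patchE; case: ifPn => // /negP; rewrite inE/= => /eqP.
  exact: h0.
exact: integral_set1.
Qed.

Variables (e0 e1 e2 e3 : pt3 R).
Local Notation A := (e3 - e0)%R.
Local Notation B := (e2 - e3)%R.
Local Notation C := (e1 - e2)%R.
Local Notation d := (vol4 e0 e1 e2 e3).
Hypothesis d0 : d != 0%R.

Let S : set (mpt3 R) :=
  [set u | (0 <= u.2)%R /\ (u.2 <= u.1.2)%R /\ (u.1.2 <= u.1.1)%R /\
           (u.1.1 <= 1)%R].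

Let measurableS : measurable S.
Proof.
have m1 : measurable_fun [set: mpt3 R] (fun u : mpt3 R => u.1.1).
  exact: measurableT_comp measurable_fst measurable_fst.
have m2 : measurable_fun [set: mpt3 R] (fun u : mpt3 R => u.1.2).
  exact: measurableT_comp measurable_snd measurable_fst.
have m3 : measurable_fun [set: mpt3 R] (fun u : mpt3 R => u.2).
  exact: measurable_snd.
have mle (f g : mpt3 R -> R) : measurable_fun [set: mpt3 R] f ->
    measurable_fun [set: mpt3 R] g -> measurable [set u | (f u <= g u)%R].
  move=> mf mg; have := measurable_fun_ler mf mg measurableT (Y := [set true]).
  by rewrite setTI; apply.
apply: measurableI; first exact: mle.
apply: measurableI; first exact: mle.
by apply: measurableI; exact: mle.
Qed.

(* Cramer's rule: the coordinates of [p - e0] in the basis [A, B, C]. *)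
Let coord (p : pt3 R) : pt3 R :=
  (det3 p B C / d, det3 A p C / d, det3 A B p / d)%R.

Let lin3_coord p : lin3 A B C (coord p) = p.
Proof.
move: d0; rewrite lin3E /coord /vol4 /det3 /=.
case: e0 e1 e2 e3 p => [[a1 a2] a3] [[b1 b2] b3] [[c1 c2] c3] [[f1 f2] f3] [[x y] z] /= D.
by congr ((_, _), _); field.
Qed.

Let coord_lin3 u : coord (lin3 A B C u) = u.
Proof.
move: d0; rewrite lin3E /coord /vol4 /det3 /=.
case: e0 e1 e2 e3 u => [[a1 a2] a3] [[b1 b2] b3] [[c1 c2] c3] [[f1 f2] f3] [[x y] z] /= D.
by congr ((_, _), _); field.
Qed.

Let hull4E p : hull4 e0 e1 e2 e3 p <-> S (coord (p - e0)%R).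
Proof.
split.
  move=> [w0 [w1 [w2 [w3 [[h0 h1 h2 h3] [hs ->]]]]]].
  have -> : (bary e0 e1 e2 e3 w0 w1 w2 w3 - e0 =
      lin3 A B C (1 - w0, w1 + w2, w1))%R.
    have -> : w3 = (1 - w0 - w1 - w2)%R by lra.
    by rewrite lin3E; apply: pt3P; rewrite /= /GRing.scale/=; ring.
  by rewrite coord_lin3 /S /=; do !split; lra.
pose u := coord (p - e0)%R; rewrite -/u => -[h1 [h2 [h3 h4]]].
exists (1 - u.1.1)%R, u.2, (u.1.2 - u.2)%R, (u.1.1 - u.1.2)%R.
split; first by split; lra.
split; first by ring.
have -> : p = (e0 + lin3 A B C u)%R by rewrite lin3_coord addrCA subrr addr0.
by rewrite lin3E; apply: pt3P; rewrite /= /GRing.scale/=; ring.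
Qed.

Let hull4_lin3 u : hull4 e0 e1 e2 e3 (e0 + lin3 A B C u)%R <-> S u.
Proof. by rewrite hull4E addrC addKr coord_lin3. Qed.

Lemma measurable_hull4 : measurable (hull4 e0 e1 e2 e3 : set (mpt3 R)).
Proof.
have ms : measurable_fun [set: mpt3 R] (fun p : mpt3 R =>
    ((p.1.1 - e0.1.1)%R, (p.1.2 - e0.1.2)%R, (p.2 - e0.2)%R) : mpt3 R).
  apply: measurable_fun_pair.
    apply: measurable_fun_pair; apply: measurable_funB => //.
      exact: measurableT_comp measurable_fst measurable_fst.
    exact: measurableT_comp measurable_snd measurable_fst.
  by apply: measurable_funB.
have mc := measurableT_comp (measurable_lin3 (coord (1, 0, 0)%R)
  (coord (0, 1, 0)%R) (coord (0, 0, 1)%R)) ms.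
rewrite (_ : hull4 _ _ _ _ = [set p | S (lin3 (coord (1, 0, 0)%R)
  (coord (0, 1, 0)%R) (coord (0, 0, 1)%R) (p - e0)%R)]).
  by have := mc measurableT _ measurableS; rewrite setTI.
apply/seteqP; split => p; rewrite /= (_ : lin3 _ _ _ _ = coord (p - e0)%R);
  try exact: (hull4E p).1; try exact: (hull4E p).2.
all: by rewrite lin3E /coord /det3; congr ((_, _), _); rewrite /=; ring.
Qed.

Variables (X : set (mpt3 R)) (f : mpt3 R -> \bar R).
Hypotheses (mX : measurable X) (mf : measurable_fun X f)
  (f0 : forall p, 0 <= f p).

Let g := f \_ X.

Let mg : measurable_fun [set: mpt3 R] g.
Proof. by apply/(measurable_restrictT f mX). Qed.

Let g0 p : 0 <= g p.
Proof. by rewrite /g patchE; case: ifPn. Qed.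

Let G := (fun u => g (e0 + lin3 A B C u)%R) \_ S.

Let mG : measurable_fun [set: mpt3 R] G.
Proof.
apply/(measurable_restrictT _ measurableS); apply: measurable_funTS.
apply: measurableT_comp mg _.
have ma : measurable_fun [set: mpt3 R] (fun p : mpt3 R =>
    ((e0.1.1 + p.1.1)%R, (e0.1.2 + p.1.2)%R, (e0.2 + p.2)%R) : mpt3 R).
  apply: measurable_fun_pair.
    apply: measurable_fun_pair; apply: measurable_funD => //.
      exact: measurableT_comp measurable_fst measurable_fst.
    exact: measurableT_comp measurable_snd measurable_fst.
  by apply: measurable_funD.
exact: measurableT_comp ma (measurable_lin3 A B C).
Qed.

Let G0 u : 0 <= G u.
Proof. by rewrite /G patchE; case: ifPn. Qed.

Let GE u : ~ S u -> G u = 0.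
Proof. by move=> uS; rewrite /G patchE memNset. Qed.

Let integral_hull4_G : \int[mu3]_(p in hull4 e0 e1 e2 e3 `&` X) f p =
  `|d|%:E * \int[mu3]_u G u.
Proof.
rewrite integral_mkcondr integral_mkcond.
have mgh : measurable_fun [set: mpt3 R] (g \_ (hull4 e0 e1 e2 e3)).
  apply/(measurable_restrictT g measurable_hull4); exact: measurable_funTS.
rewrite (ge0_integral_affine3 e0 d0 mgh); last first.
  by move=> p; rewrite patchE; case: ifPn.
congr (_ * _); apply: eq_integral => u _; rewrite /G !patchE.
congr (if _ then _ else _); apply/idP/idP; rewrite !inE => h;
  exact/hull4_lin3.
Qed.

Let G1 (p : mpt3 R) : \bar R :=
  `|p.1.2|%:E * G (p.1, p.1.2 * p.2 + cst 0 p.1)%R.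

Let mG1 : measurable_fun [set: mpt3 R] G1.
Proof.
apply: emeasurable_funM.
  apply/measurable_EFinP; apply: measurableT_comp => //.
  exact: measurableT_comp measurable_snd measurable_fst.
apply: (measurableT_comp mG); apply: measurable_fun_pair => //.
apply: measurable_funD => //; apply: measurable_funM => //.
exact: measurableT_comp measurable_snd measurable_fst.
Qed.

Let G10 p : 0 <= G1 p. Proof. by rewrite mule_ge0. Qed.

(** The third coordinate is scaled by the second. Where this scale is 0, the fibre of [S] is the
    single point 0, hence null. *)
Let integral_G_G1 : \int[mu3]_u G u = \int[mu3]_u G1 u.
Proof.
apply: (@fiberwise_affine _ _ _ (leb2 R) G snd (cst 0%R)) => //.
move=> t t0; apply: integral_supp0 => c c0; apply: GE => -[/= c1 [c2 _]].
by rewrite t0 in c2; move/negP: c0; apply; rewrite eq_le c1 c2.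
Qed.

Let G2 (p : mpt3 R) : \bar R :=
  `|p.1.1|%:E * G1 (p.1.1, p.1.1 * p.2 + cst 0 p.1, p.1.2)%R.

Let mG1s : measurable_fun [set: mpt3 R] (fun p : mpt3 R => G1 (p.1.1, p.2, p.1.2)).
Proof.
apply: (measurableT_comp mG1); apply: measurable_fun_pair.
  apply: measurable_fun_pair; last exact: measurable_snd.
  exact: measurableT_comp measurable_fst measurable_fst.
exact: measurableT_comp measurable_snd measurable_fst.
Qed.

Let mG2 : measurable_fun [set: mpt3 R] G2.
Proof.
apply: emeasurable_funM.
  apply/measurable_EFinP; apply: measurableT_comp => //.
  exact: measurableT_comp measurable_fst measurable_fst.
apply: (measurableT_comp mG1); apply: measurable_fun_pair.
  apply: measurable_fun_pair.
    exact: measurableT_comp measurable_fst measurable_fst.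
  apply: measurable_funD => //; apply: measurable_funM => //.
  exact: measurableT_comp measurable_fst measurable_fst.
exact: measurableT_comp measurable_snd measurable_fst.
Qed.

Let G20 p : 0 <= G2 p. Proof. by rewrite mule_ge0. Qed.

Let integral_G1_G2 : \int[mu3]_u G1 u = \int[mu3]_u G2 u.
Proof.
rewrite (integral3_swap23 mG1 G10).
rewrite [LHS](@fiberwise_affine _ _ _ (leb2 R) _ fst (cst 0%R) mG1s)//.
move=> t t0; apply: integral_supp0 => c c0 /=; rewrite /G1 /= GE ?mule0//.
move=> -[/= c1 [c2 [c3 _]]]; rewrite t0 in c3.
move/negP: c0; apply; rewrite eq_le c3/=.
exact: le_trans c2.
Qed.

Let G3 (x s a : R) : \bar R := G2 (a, x, s).

Let G3E (x s a : R) : G3 x s a =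
  if [&& 0 <= x <= 1, 0 <= s <= 1 & 0 <= a <= 1]%R
  then (a ^+ 2 * s)%:E * g (cube_pt e0 e1 e2 e3 x s a) else 0.
Proof.
rewrite /G3 /G2 /G1 /= !addr0.
have [->|a0] := eqVneq a 0%R.
  by rewrite normr0 mul0e expr2 !mul0r mul0e; case: ifP.
have [->|s0] := eqVneq s 0%R.
  by rewrite !mulr0 normr0 mul0e mule0 mul0e; case: ifP.
rewrite muleA -EFinM -normrM mulrA -expr2.
case: ifPn => [/and3P[/andP[x0 x1] /andP[s0' s1] /andP[a0' a1]]|H].
  rewrite ger0_norm; last by rewrite mulr_ge0 ?sqr_ge0.
  congr (_ * _); rewrite /G patchE mem_set; last first.
    rewrite /S /=; repeat split => //.
    - by rewrite !mulr_ge0.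
    - by rewrite ler_piMr// mulr_ge0.
    - by rewrite ler_piMr.
  by congr g; rewrite lin3E; apply: pt3P; rewrite /cube_pt /bary /= /GRing.scale/=; ring.
rewrite GE ?mule0// => -[/= h1 [h2 [h3 h4]]]; move/negP: H; apply.
have ap : (0 < a)%R by rewrite lt_neqAle eq_sym a0/=; lra.
have sp : (0 < s)%R.
  rewrite lt_neqAle eq_sym s0/=; rewrite -(pmulr_rge0 _ ap); lra.
have asp : (0 < a * s)%R by exact: mulr_gt0.
rewrite -(pmulr_rge0 x asp) h1 -(ler_pM2l asp) mulr1 h2 (ltW sp) (ltW ap) h4.
by rewrite -(ler_pM2l ap) mulr1 h3.
Qed.

(** The ordered simplex is parametrised by [(a, a s, a s x)]. The variable [a] comes innermost
    because a horoball at [e0] cuts every chord through [e0] in an interval of values of [a]. *)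
Lemma integral_hull4 : \int[mu3]_(p in hull4 e0 e1 e2 e3 `&` X) f p =
  `|d|%:E * \int[mu]_(x in `]0%R, 1%R[) \int[mu]_(s in `]0%R, 1%R[)
    \int[mu]_(a in `]0%R, 1%R[)
      ((a ^+ 2 * s)%:E * (f \_ X) (cube_pt e0 e1 e2 e3 x s a)).
Proof.
rewrite integral_hull4_G integral_G_G1 integral_G1_G2; congr (_ * _).
have mperm : measurable_fun [set: mpt3 R]
    (fun p : mpt3 R => (p.2, p.1.1, p.1.2) : mpt3 R).
  apply: measurable_fun_pair; last exact: measurableT_comp measurable_snd measurable_fst.
  apply: measurable_fun_pair; first exact: measurable_snd.
  exact: measurableT_comp measurable_fst measurable_fst.
have mH := measurableT_comp mG2 mperm.
transitivity (\int[mu3]_p G2 (p.2, p.1.1, p.1.2)).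
  rewrite (integral3_swap12 mG2 G20).
  apply: (integral3_swap23 _ (fun p => G20 (p.1.2, p.1.1, p.2))).
  apply: (measurableT_comp mG2); apply: measurable_fun_pair; last exact: measurable_snd.
  apply: measurable_fun_pair.
    exact: measurableT_comp measurable_snd measurable_fst.
  exact: measurableT_comp measurable_fst measurable_fst.
rewrite (integral3_xyz mH (fun p => G20 _)).
have mF := measurable_fun_fubini_tonelli_F (m2 := mu) _ mH (fun p => G20 _).
have F0 xs : 0 <= \int[mu]_a (G2 \o (fun p : mpt3 R => (p.2, p.1.1, p.1.2))) (xs, a).
  by apply: integral_ge0 => a _; exact: G20.
have mFF := measurable_fun_fubini_tonelli_F (m2 := mu) _ mF F0.
have out x s a : ~~ [&& 0 <= x <= 1, 0 <= s <= 1 & 0 <= a <= 1]%R ->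
    G2 (a, x, s) = 0.
  by move=> /negbTE xsa; rewrite -/(G3 x s a) G3E xsa.
have clip1 x : ~~ (0 <= x <= 1)%R ->
    \int[mu]_s \int[mu]_a G2 (a, x, s) = 0.
  move=> x01; apply: integral0_eq => s _; apply: integral0_eq => a _.
  by apply: out; rewrite (negbTE x01).
apply: (etrans (integral_clip mFF clip1)).
apply: eq_integral => x; rewrite inE/= in_itv/= => /andP[x0 x1].
have clip2 s : ~~ (0 <= s <= 1)%R -> \int[mu]_a G2 (a, x, s) = 0.
  move=> s01; apply: integral0_eq => a _.
  by apply: out; rewrite (negbTE s01) andbF.
apply: (etrans (integral_clip (measurableT_comp mF (pair1_measurable x)) clip2)).
apply: eq_integral => s; rewrite inE/= in_itv/= => /andP[s0 s1].
have clip3 a : ~~ (0 <= a <= 1)%R -> G2 (a, x, s) = 0.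
  by move=> a01; apply: out; rewrite (negbTE a01) !andbF.
apply: (etrans (integral_clip (measurableT_comp mH (pair1_measurable (x, s))) clip3)).
apply: eq_integral => a; rewrite inE/= in_itv/= => /andP[a0 a1].
by rewrite -[LHS]/(G3 x s a) G3E !ltW.
Qed.

End SimplexIntegral.

(** Minus the Lorentz product of [homog e] and [homog f]: affine in each argument, hence linear in
    barycentric weights. For unit vectors it is half the squared Euclidean distance. *)
Definition chord (R : realType) (e f : pt3 R) : R := 1 - dot e f.

(** * Volumes of ideal tetrahedra and of their horoball pieces *)

Section VolumeFormulas.
Context {R : realType}.
Local Notation mu := (leb R).

Lemma chordC (e f : pt3 R) : chord e f = chord f e.
Proof. by rewrite /chord /dot; ring. Qed.

Lemma dot_bary (e e0 e1 e2 e3 : pt3 R) (w0 w1 w2 w3 : R) :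
  dot e (bary e0 e1 e2 e3 w0 w1 w2 w3) =
  w0 * dot e e0 + w1 * dot e e1 + w2 * dot e e2 + w3 * dot e e3.
Proof. by rewrite /bary /dot /= /GRing.scale/=; ring. Qed.

Lemma chord_bary (e e0 e1 e2 e3 : pt3 R) (w0 w1 w2 w3 : R) :
  w0 + w1 + w2 + w3 = 1 ->
  chord e (bary e0 e1 e2 e3 w0 w1 w2 w3) =
  w0 * chord e e0 + w1 * chord e e1 + w2 * chord e e2 + w3 * chord e e3.
Proof. by rewrite /chord dot_bary => ws; rewrite -{1}ws; ring. Qed.

Lemma dotC (e f : pt3 R) : dot e f = dot f e.
Proof. by rewrite /dot; ring. Qed.

Lemma dot_ge0 (p : pt3 R) : 0 <= dot p p.
Proof. by rewrite /dot -!expr2 !addr_ge0 ?sqr_ge0. Qed.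

Lemma dot_eq0 (p : pt3 R) : dot p p = 0 -> p = 0.
Proof.
rewrite /dot -!expr2 => h.
have s1 := sqr_ge0 p.1.1; have s2 := sqr_ge0 p.1.2; have s3 := sqr_ge0 p.2.
by apply: pt3P; apply/eqP; rewrite -sqrf_eq0 eq_le; apply/andP; split => //=; lra.
Qed.

Lemma dot_cauchy (e p : pt3 R) : dot e e = 1 -> dot e p ^+ 2 <= dot p p.
Proof.
move=> he; rewrite -subr_ge0 -[dot p p]mul1r -he.
rewrite (_ : _ - _ = (e.1.1 * p.1.2 - e.1.2 * p.1.1) ^+ 2
  + (e.1.1 * p.2 - e.2 * p.1.1) ^+ 2 + (e.1.2 * p.2 - e.2 * p.1.2) ^+ 2).
  by rewrite !addr_ge0 ?sqr_ge0.
by rewrite /dot; ring.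
Qed.

(** Ideal points are null vectors, so the Lorentz square of a combination has no diagonal terms. *)
Lemma chord_self_bary (e0 e1 e2 e3 : pt3 R) (w0 w1 w2 w3 : R) :
  dot e0 e0 = 1 -> dot e1 e1 = 1 -> dot e2 e2 = 1 -> dot e3 e3 = 1 ->
  w0 + w1 + w2 + w3 = 1 ->
  1 - dot (bary e0 e1 e2 e3 w0 w1 w2 w3) (bary e0 e1 e2 e3 w0 w1 w2 w3) =
  2 * (w0 * w1 * chord e0 e1 + w0 * w2 * chord e0 e2 + w0 * w3 * chord e0 e3
     + w1 * w2 * chord e1 e2 + w1 * w3 * chord e1 e3 + w2 * w3 * chord e2 e3).
Proof.
move=> h0 h1 h2 h3 ws.
rewrite [X in X - _ = _](_ : 1 = (w0 + w1 + w2 + w3) ^+ 2); last first.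
  by rewrite ws expr1n.
rewrite dot_bary !(dotC (bary _ _ _ _ _ _ _ _)) !dot_bary h0 h1 h2 h3.
rewrite /chord (dotC e1 e0) (dotC e2 e0) (dotC e3 e0) (dotC e2 e1).
by rewrite (dotC e3 e1) (dotC e3 e2); ring.
Qed.

Lemma measurable_dot (f g : mpt3 R -> mpt3 R) :
  measurable_fun setT f -> measurable_fun setT g ->
  measurable_fun [set: mpt3 R] (fun p => dot (f p) (g p)).
Proof.
move=> mf mg.
have m1 (h : mpt3 R -> mpt3 R) : measurable_fun setT h ->
    measurable_fun setT (fun p => (h p).1.1).
  by move=> mh; exact: measurableT_comp measurable_fst (measurableT_comp measurable_fst mh).
have m2 (h : mpt3 R -> mpt3 R) : measurable_fun setT h ->
    measurable_fun setT (fun p => (h p).1.2).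
  by move=> mh; exact: measurableT_comp measurable_snd (measurableT_comp measurable_fst mh).
have m3 (h : mpt3 R -> mpt3 R) : measurable_fun setT h ->
    measurable_fun setT (fun p => (h p).2).
  by move=> mh; exact: measurableT_comp measurable_snd mh.
apply: measurable_funD; last by apply: measurable_funM; exact: m3.
by apply: measurable_funD; apply: measurable_funM; [exact: m1|exact: m1|exact: m2|exact: m2].
Qed.

Let mdotp : measurable_fun [set: mpt3 R] (fun p : mpt3 R => 1 - dot p p).
Proof. by apply: measurable_funB => //; exact: measurable_dot. Qed.

Let mset_ltr (f g : mpt3 R -> R) : measurable_fun [set: mpt3 R] f ->
  measurable_fun [set: mpt3 R] g -> measurable [set u | f u < g u].
Proof.
move=> mf mg; have := measurable_fun_ltr mf mg measurableT (Y := [set true]).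
by rewrite setTI; apply.
Qed.

Let mset_ler (f g : mpt3 R -> R) : measurable_fun [set: mpt3 R] f ->
  measurable_fun [set: mpt3 R] g -> measurable [set u | f u <= g u].
Proof.
move=> mf mg; have := measurable_fun_ler mf mg measurableT (Y := [set true]).
by rewrite setTI; apply.
Qed.

Lemma measurable_H3 : measurable (@H3 R : set (mpt3 R)).
Proof. by apply: mset_ltr => //; exact: measurable_dot. Qed.

Lemma measurable_horoball (e : pt3 R) s : measurable (horoball e s : set (mpt3 R)).
Proof.
apply: measurableI; first exact: measurable_H3.
apply: mset_ler; last exact: measurable_funM.
apply: measurable_funX; apply: measurable_funB => //.
exact: measurable_dot.
Qed.

Let mdensity (X : set (mpt3 R)) : measurable X -> X `<=` @H3 R ->
  measurable_fun X (fun p => (((1 - dot p p) ^+ 2)^-1)%:E).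
Proof.
move=> mX XH; apply/measurable_EFinP.
(* The density becomes a real power, a measurable function; the two agree because [1 - dot p p] is
   positive on [H3]. *)
apply: (eq_measurable_fun (fun p => (1 - dot p p) `^ (- 2))).
  move=> p; rewrite inE => /XH; rewrite /H3/= => p1.
  by rewrite powRN powR_mulrn// subr_ge0 ltW.
apply: measurable_funTS.
exact: measurableT_comp (measurable_powR _) mdotp.
Qed.

Variables e0 e1 e2 e3 : pt3 R.
Hypotheses (h0 : dot e0 e0 = 1) (h1 : dot e1 e1 = 1) (h2 : dot e2 e2 = 1)
  (h3 : dot e3 e3 = 1).
Hypothesis d0 : vol4 e0 e1 e2 e3 != 0.
Local Notation N01 := (chord e0 e1).
Local Notation N02 := (chord e0 e2).
Local Notation N03 := (chord e0 e3).
Local Notation N12 := (chord e1 e2).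
Local Notation N13 := (chord e1 e3).
Local Notation N23 := (chord e2 e3).
Hypotheses (n01 : 0 < N01) (n02 : 0 < N02) (n03 : 0 < N03) (n12 : 0 < N12)
  (n13 : 0 < N13) (n23 : 0 < N23).

(* [bary] coordinates of the point of the face opposite to [e0] through which
   the chord from [e0] to [cube_pt e0 e1 e2 e3 x s a] passes. *)
Let n (x s : R) := (N01 * x + N02 * (1 - x)) * s + N03 * (1 - s).
Let m (x s : R) :=
  2 * s * (N12 * x * (1 - x) * s + (N13 * x + N23 * (1 - x)) * (1 - s)).

Let n_gt0 x s : 0 < x < 1 -> 0 < s < 1 -> 0 < n x s.
Proof.
move=> /andP[x0 x1] /andP[s0 s1]; rewrite /n.
have X : 0 < 1 - x by lra.
have S : 0 < 1 - s by lra.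
apply: addr_gt0; last exact: mulr_gt0.
by apply: mulr_gt0 => //; apply: addr_gt0; exact: mulr_gt0.
Qed.

Let m_gt0 x s : 0 < x < 1 -> 0 < s < 1 -> 0 < m x s.
Proof.
move=> /andP[x0 x1] /andP[s0 s1]; rewrite /m.
have X : 0 < 1 - x by lra.
have S : 0 < 1 - s by lra.
apply: mulr_gt0; first exact: mulr_gt0.
apply: addr_gt0; first by do !apply: mulr_gt0 => //.
by apply: mulr_gt0 => //; apply: addr_gt0; exact: mulr_gt0.
Qed.

Let chord_cube x s a : chord e0 (cube_pt e0 e1 e2 e3 x s a) = a * n x s.
Proof.
rewrite /cube_pt chord_bary; last by ring.
by rewrite {1}/chord h0 /n; ring.
Qed.

Let chord_self_cube x s a : 1 - dot (cube_pt e0 e1 e2 e3 x s a)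
    (cube_pt e0 e1 e2 e3 x s a) = a * (m x s * a + 2 * n x s * (1 - a)).
Proof.
rewrite /cube_pt chord_self_bary//; last by ring.
by rewrite /n /m; ring.
Qed.

(** As [e0] is ideal, [1 - dot p p] has a factor [a]; its square cancels the [a ^ 2] of the
    Jacobian, and the inverse square of an affine function of [a] remains. *)
Let hyp_vol_hull X : measurable (X : set (mpt3 R)) -> X `<=` @H3 R ->
  hyp_vol (X `&` hull4 e0 e1 e2 e3) = fine (
  `|vol4 e0 e1 e2 e3|%:E * \int[mu]_(x in `]0%R, 1%R[) \int[mu]_(s in `]0%R, 1%R[)
    \int[mu]_(a in `]0%R, 1%R[)
    ((fun a => (s * (m x s * a + 2 * n x s * (1 - a)) ^- 2)%:E) \_
       [set a | X (cube_pt e0 e1 e2 e3 x s a)]) a)%E.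
Proof.
move=> mX XH; rewrite /hyp_vol /Rintegral.
rewrite (_ : X `&` hull4 e0 e1 e2 e3 `&` _ = hull4 e0 e1 e2 e3 `&` X); last first.
  by apply/seteqP; split => [p [[]]|p [hp Xp]] //; split => //; exact: XH.
congr fine; rewrite [LHS](integral_hull4 d0 mX); last 2 first.
- exact: mdensity.
- by move=> p; rewrite lee_fin invr_ge0 sqr_ge0.
apply: (congr1 (mule `|vol4 e0 e1 e2 e3|%:E)).
apply: eq_integral => x; rewrite inE/= in_itv/= => x01.
apply: eq_integral => s; rewrite inE/= in_itv/= => s01.
apply: eq_integral => a; rewrite inE/= in_itv/= => /andP[a0 a1].
rewrite !patchE.
have -> : (cube_pt e0 e1 e2 e3 x s a \in X) =
    (a \in [set a | X (cube_pt e0 e1 e2 e3 x s a)]).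
  by apply/idP/idP; rewrite !inE.
case: ifPn => _; last by rewrite mule0.
rewrite -EFinM chord_self_cube; congr EFin; field.
rewrite (gt_eqF a0) gt_eqF//; apply: addr_gt0.
  by apply: mulr_gt0 => //; exact: m_gt0.
apply: mulr_gt0; last lra.
by apply: mulr_gt0 => //; exact: n_gt0.
Qed.

(** The hypothesis on the weights says that the horoball does not cross the triangle opposite to
    [e0], so each chord from [e0] leaves it no later than at that face. This makes the volume linear
    in [r]. *)
Lemma hyp_vol_horoball (r : R) : 0 < r ->
  (forall w1 w2 w3, 0 <= w1 -> 0 <= w2 -> 0 <= w3 -> w1 + w2 + w3 = 1 ->
    r * (2 * (w1 * w2 * N12 + w1 * w3 * N13 + w2 * w3 * N23)) <=
    (w1 * N01 + w2 * N02 + w3 * N03) ^+ 2) ->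
  hyp_vol (horoball e0 r `&` hull4 e0 e1 e2 e3) =
  `|vol4 e0 e1 e2 e3| * (r / (4 * N01 * N02 * N03)).
Proof.
move=> r0 face; rewrite hyp_vol_hull//; [|exact: measurable_horoball|by move=> p []].
transitivity (fine (`|vol4 e0 e1 e2 e3|%:E * (r / (4 * N01 * N02 * N03))%:E)%E);
  last by [].
congr fine; apply: (congr1 (mule `|vol4 e0 e1 e2 e3|%:E)).
have inner x s : 0 < x < 1 -> 0 < s < 1 ->
    (\int[mu]_(a in `]0%R, 1%R[)
      ((fun a => (s * (m x s * a + 2 * n x s * (1 - a)) ^- 2)%:E) \_
         [set a | horoball e0 r (cube_pt e0 e1 e2 e3 x s a)]) a)%E =
    (r / 2 * (s / n x s ^+ 3))%:E.
  move=> x01 s01.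
  have np := n_gt0 x01 s01; have mp := m_gt0 x01 s01.
  have nm : r * m x s <= n x s ^+ 2.
    have {x01 s01} [[x0 x1] [s0 s1]] := (andP x01, andP s01).
    have -> : m x s = 2 * (s * x * (s * (1 - x)) * N12 + s * x * (1 - s) * N13
        + s * (1 - x) * (1 - s) * N23) by rewrite /m; ring.
    have -> : n x s = s * x * N01 + s * (1 - x) * N02 + (1 - s) * N03.
      by rewrite /n; ring.
    by apply: face; rewrite ?mulr_ge0 ?subr_ge0 ?ltW//; ring.
  (* After division by [a] the horoball condition is the linear inequality [a D <= 2 r n], so [t] is
     the exit parameter of the chord; [t <= 1] is the face condition [r m <= n ^ 2]. *)
  pose D := n x s ^+ 2 + 2 * r * n x s - r * m x s.
  have D0 : 0 < D by rewrite /D; have := mulr_gt0 r0 np; lra.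
  pose t := 2 * r * n x s / D.
  have t0 : 0 < t by rewrite divr_gt0 ?mulr_gt0.
  have t1 : t <= 1 by rewrite ler_pdivrMr// mul1r /D; lra.
  have hor a : 0 < a -> ((a * n x s) ^+ 2 <=
      r * (a * (m x s * a + 2 * n x s * (1 - a)))) = (a <= t).
    move=> a0; have -> : (a * n x s) ^+ 2 = a * (a * n x s ^+ 2) by ring.
    have -> : r * (a * (m x s * a + 2 * n x s * (1 - a))) =
      a * (r * (m x s * a + 2 * n x s * (1 - a))) by ring.
    rewrite ler_pM2l// /t ler_pdivlMr// -subr_ge0 -[RHS]subr_ge0.
    by congr (0 <= _); rewrite /D; ring.
  have hE a : 0 < a < 1 ->
      (a \in [set a | horoball e0 r (cube_pt e0 e1 e2 e3 x s a)]) = (a <= t).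
    move=> /andP[a0 a1]; apply/idP/idP; rewrite inE /=.
      by move=> [_]; rewrite -/(chord e0 _) chord_cube chord_self_cube hor.
    move=> h; split.
      rewrite /H3/= -subr_gt0 chord_self_cube mulr_gt0// addr_gt0//.
        exact: mulr_gt0.
      by rewrite !mulr_gt0// subr_gt0.
    by rewrite -/(chord e0 _) chord_cube chord_self_cube hor.
  have mint : measurable_fun `]0, t[ (fun a : R =>
      (s * (m x s * a + 2 * n x s * (1 - a)) ^- 2)%:E).
    apply/measurable_EFinP; apply: open_continuous_measurable_fun => // a.
    rewrite inE/= in_itv/= => /andP[a0 at_].
    apply: is_derive_continuous; der.
    rewrite expf_neq0// gt_eqF// addr_gt0// mulr_gt0//.
      by rewrite mulr_gt0.
    by rewrite subr_gt0 (lt_le_trans at_).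
  transitivity (\int[mu]_(a in `]0%R, t[)
      (s * (m x s * a + 2 * n x s * (1 - a)) ^- 2)%:E)%E.
    rewrite -integral_mkcondr.
    have -> : `]0, 1[%classic `&` [set a | horoball e0 r (cube_pt e0 e1 e2 e3 x s a)]
        = `]0, 1[%classic `&` [set a | a <= t].
      apply/seteqP; split => a /= [a01 ha]; split => //.
        by rewrite -hE// inE.
      by rewrite -hE// inE in ha.
    have [t1'|t1'] := ltP t 1.
      rewrite (_ : _ `&` _ = `]0, t]%classic).
        by rewrite integral_itv_bndoo//; exact: mint.
      apply/seteqP; split => a /=; rewrite !in_itv/=.
        by move=> [/andP[-> _] ->].
      by move=> /andP[-> at_]; split => //=; exact: le_lt_trans t1'.
    have t1E : t = 1 by apply/eqP; rewrite eq_le t1.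
    rewrite t1E (_ : _ `&` _ = `]0, 1[%classic)//.
    apply/seteqP; split => a /=; rewrite !in_itv/=; first by case.
    by move=> /andP[-> /[dup] /ltW -> ->].
  rewrite (integral_inv_affine_sq _ mp (mulr_gt0 _ np) t0 t1)//; last first.
    by case/andP: s01 => /ltW.
  congr EFin.
  have -> : m x s * t + 2 * n x s * (1 - t) = 2 * n x s ^+ 3 / D.
    by rewrite /t; rewrite /D; field; rewrite gt_eqF.
  by rewrite /t; field; rewrite !gt_eqF.
have mid x : 0 < x < 1 -> (\int[mu]_(s in `]0%R, 1%R[) \int[mu]_(a in `]0%R, 1%R[)
      ((fun a => (s * (m x s * a + 2 * n x s * (1 - a)) ^- 2)%:E) \_
         [set a | horoball e0 r (cube_pt e0 e1 e2 e3 x s a)]) a)%E =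
    (r / (4 * N03) * (N01 * x + N02 * (1 - x)) ^- 2)%:E.
  move=> x01; have [x0 x1] := andP x01.
  transitivity (\int[mu]_(s in `]0%R, 1%R[) (r / 2 * (s / n x s ^+ 3))%:E)%E.
    apply: eq_integral => s; rewrite inE/= in_itv/= => s01; exact: inner.
  have X0 : 0 < 1 - x by rewrite subr_gt0.
  have A0 : 0 < N01 * x + N02 * (1 - x) by apply: addr_gt0; exact: mulr_gt0.
  rewrite integral_id_div_cube ?divr_ge0 ?ltW//; congr EFin; field.
  by rewrite !gt_eqF.
transitivity (\int[mu]_(x in `]0%R, 1%R[)
    (r / (4 * N03) * (N01 * x + N02 * (1 - x)) ^- 2)%:E)%E.
  apply: eq_integral => x; rewrite inE/= in_itv/= => x01; exact: mid.
rewrite integral_inv_affine_sq//; last by rewrite divr_ge0 ?mulr_ge0 ?ltW.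
by congr EFin; field; rewrite !gt_eqF.
Qed.

(** The integral over [a] cancels the remaining factor [s] and leaves the reciprocal of a product of
    two affine functions of [s]. The hypothesis keeps these from being proportional, and their
    partial fractions give the logarithm. *)
Lemma hyp_vol_ideal_hull :
  (forall x, 0 < x < 1 ->
    N03 * (N12 * x * (1 - x)) <
    (N01 * x + N02 * (1 - x)) * (N13 * x + N23 * (1 - x))) ->
  hyp_vol (hull4 e0 e1 e2 e3) = fine (`|vol4 e0 e1 e2 e3|%:E *
    \int[mu]_(x in `]0%R, 1%R[)
     (4^-1 * (ln ((N01 * x + N02 * (1 - x)) * (N13 * x + N23 * (1 - x))
         / (N03 * (N12 * x * (1 - x)))) /
     ((N01 * x + N02 * (1 - x)) * (N13 * x + N23 * (1 - x))
         - N03 * (N12 * x * (1 - x)))))%:E)%E.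
Proof.
move=> dist.
rewrite (_ : hyp_vol _ = hyp_vol (@H3 R `&` hull4 e0 e1 e2 e3)); last first.
  by rewrite /hyp_vol setIAC setIid setIC.
rewrite hyp_vol_hull//; last exact: measurable_H3.
congr fine; apply: (congr1 (mule `|vol4 e0 e1 e2 e3|%:E)).
apply: eq_integral => x; rewrite inE/= in_itv/= => x01.
have {x01} [x0 x1] := andP x01; have x01 : 0 < x < 1 by rewrite x0.
have X0 : 0 < 1 - x by rewrite subr_gt0.
transitivity (\int[mu]_(s in `]0%R, 1%R[)
    (4^-1 * (((N01 * x + N02 * (1 - x)) * s + N03 * (1 - s)) *
     (N12 * x * (1 - x) * s + (N13 * x + N23 * (1 - x)) * (1 - s)))^-1)%:E)%E.
  apply: eq_integral => s; rewrite inE/= in_itv/= => s01.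
  have {s01} [s0 s1] := andP s01; have s01 : 0 < s < 1 by rewrite s0.
  have np := n_gt0 x01 s01; have mp := m_gt0 x01 s01.
  transitivity (\int[mu]_(a in `]0%R, 1%R[)
      (s * (m x s * a + 2 * n x s * (1 - a)) ^- 2)%:E)%E.
    apply: eq_integral => a; rewrite inE/= in_itv/= => /andP[a0 a1].
    rewrite patchE mem_set// /H3/= -subr_gt0 chord_self_cube mulr_gt0// addr_gt0//.
      exact: mulr_gt0.
    by rewrite !mulr_gt0// subr_gt0.
  rewrite (integral_inv_affine_sq (ltW s0) mp (mulr_gt0 _ np) ltr01 (lexx 1))//.
  congr EFin; rewrite subrr mulr0 addr0 mulr1.
  have Q0 : 0 < N12 * x * (1 - x) * s + (N13 * x + N23 * (1 - x)) * (1 - s).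
    by move: mp; rewrite /m pmulr_rgt0// mulr_gt0.
  move: np mp; rewrite /n /m => np mp; field.
  by rewrite !gt_eqF.
apply: integral_inv_affine_prod.
- by rewrite invr_ge0.
- by apply: addr_gt0; exact: mulr_gt0.
- by [].
- by do !apply: mulr_gt0.
- by apply: addr_gt0; exact: mulr_gt0.
- by rewrite gt_eqF// dist.
Qed.

End VolumeFormulas.

(** * Bounds for the volume function *)

Section LogIntegrals.
Context {R : realType}.
Local Notation mu := (@lebesgue_measure R).

(** From [ln x = 2 ln (sqrt x)] and [ln y <= y - 1] at [y = 1 / sqrt x], the absolute value is at
    most [2 sqrt x] near 0. *)
Lemma cvg_xlnx : (x * ln x) @[x --> (0 : R)^'+] --> (0 : R).
Proof.
apply/cvgrPdist_le => /= e e0.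
near=> x.
have x0 : 0 < x by near: x; exact: nbhs_right_gt.
have s0 : 0 < Num.sqrt x by rewrite sqrtr_gt0.
have x1 : x < 1 by near: x; apply: nbhs_right_lt.
have xe : x < (e / 2) ^+ 2 by near: x; apply: nbhs_right_lt; rewrite exprn_gt0// divr_gt0.
rewrite sub0r normrN ler0_norm; last by rewrite pmulr_rle0// ln_le0// ltW.
have xs : x = Num.sqrt x ^+ 2 by rewrite sqr_sqrtr// ltW.
have se : Num.sqrt x < e / 2.
  by rewrite -(@ltr_pXn2r _ 2)// ?nnegrE ?sqrtr_ge0 ?divr_ge0 ?ltW// -xs.
have h : - ln (Num.sqrt x) <= (Num.sqrt x)^-1 - 1.
  rewrite -lnV ?posrE//.
  have := @le_ln1Dx R ((Num.sqrt x)^-1 - 1).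
  by rewrite addrCA subrr addr0; apply; rewrite ltrBrDr addNr invr_gt0.
have : ln x = 2 * ln (Num.sqrt x) by rewrite {1}xs lnXn// mulr_natl.
move=> ->; rewrite {1}xs.
rewrite (_ : - _ = Num.sqrt x ^+ 2 * (2 * (- ln (Num.sqrt x)))); last by ring.
apply: (@le_trans _ _ (Num.sqrt x ^+ 2 * (2 * ((Num.sqrt x)^-1 - 1)))).
  by rewrite ler_pM2l ?exprn_gt0// ler_pM2l.
rewrite (_ : _ * _ = 2 * Num.sqrt x - 2 * Num.sqrt x ^+ 2).
  by have := sqr_ge0 (Num.sqrt x); lra.
by field; rewrite gt_eqF.
Unshelve. all: by end_near. Qed.

(* The antiderivative is
   [- ln x * (x * S x) + T x + ln (1 - x) * ((1 - x) * S (1 - x)) - T (1 - x) + K x]. *)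
Lemma integral_log_moments (p S T K k : R -> R) :
  (forall x, is_derive x (1 : R) (fun y => y * S y) (p x)) ->
  (forall x, is_derive x (1 : R) T (S x)) ->
  (forall x, is_derive x (1 : R) K (k x)) ->
  (forall x, {for x, continuous p}) -> (forall x, {for x, continuous S}) ->
  (forall x, {for x, continuous k}) ->
  (forall x, p (1 - x) = p x) ->
  (forall x, 0 < x < 1 -> 0 <= p x * (- ln x - ln (1 - x)) + k x) ->
  (\int[mu]_(x in `]0%R, 1%R[) (p x * (- ln x - ln (1 - x)) + k x)%:E =
   (2 * (T 1 - T 0) + (K 1 - K 0))%:E)%E.
Proof.
move=> dP dT dK cp cS ck psym pos.
pose H x := - (ln x * (x * S x)) + T x.
have ln_cont (x : R) : 0 < x -> {for x, continuous (@ln R)}.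
  by move=> x0; exact: continuous_ln.
have dH (x : R) : 0 < x -> is_derive x (1 : R) H (- (ln x * p x)).
  move=> x0; have dl : is_derive x (1 : R) (@ln R) x^-1 by exact: is_derive1_ln.
  have := der_add (der_opp (der_mul dl (dP x))) (dT x).
  move=> h; apply: (is_derive_eq h).
  by rewrite mulrA mulVf ?gt_eqF// mul1r; ring.
pose G x := H x - H (1 - x) + K x.
have d1 (x : R) : is_derive x (1 : R) (fun y : R => 1 - y) (-1).
  by have := der_add (der_cst x 1) (der_opp (der_id x)); rewrite add0r.
have dG (x : R) : 0 < x < 1 ->
    is_derive x (1 : R) G (p x * (- ln x - ln (1 - x)) + k x).
  move=> /andP[x0 x1]; have x1' : 0 < 1 - x by rewrite subr_gt0.
  have dHx1 := @der_comp R x H (fun y => 1 - y) _ _ (dH _ x1') (d1 x).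
  have := der_add (der_add (dH x x0) (der_opp dHx1)) (dK x).
  by move=> h; apply: (is_derive_eq h); rewrite psym; ring.
have cvgS (x : R) : {for x, continuous S} by exact: cS.
have H0 : H x @[x --> (0 : R)^'+] --> H 0.
  rewrite /H mul0r mulr0 oppr0; apply: cvgD; last first.
    by apply: cvg_at_right_filter; exact: is_derive_continuous (dT 0).
  rewrite -[X in _ --> X]oppr0; apply: cvgN.
  rewrite (_ : (fun x => _) = fun x => (x * ln x) * S x); last first.
    by apply/funext => x; ring.
  rewrite -[X in _ --> X](mul0r (S 0)); exact: (cvgM cvg_xlnx (cvg_at_right_filter (cS 0))).
have cH (x : R) : 0 < x -> {for x, continuous H}.
  by move=> /dH; exact: is_derive_continuous.
have H01 : H (1 - x) @[x --> (0 : R)^'+] --> H 1.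
  rewrite -[in X in _ --> X](subr0 1).
  apply: cvg_at_right_filter.
  apply: (@continuous_comp _ _ _ (fun y : R => 1 - y) H).
    exact: is_derive_continuous (d1 0).
  by rewrite subr0; exact: cH.
have H10 : H (1 - x) @[x --> (1 : R)^'-] --> H 0.
  apply/cvg_at_leftP => u [u1 ucvg].
  move/cvg_at_rightP : H0 => /(_ (fun n => 1 - u n)); apply; split.
    by move=> n; rewrite subr_gt0.
  by rewrite -[X in _ --> X](subrr (1 : R)); apply: cvgB => //; exact: cvg_cst.
rewrite (@ge0_FTC_open _ G _ 0 1)//.
- by rewrite /G subrr subr0; congr EFin; rewrite /H ln1 !mul0r !mulr0; ring.
- move=> x; rewrite in_itv/= => x01; have [x0 x1] := andP x01.
  have x1' : 0 < 1 - x by rewrite subr_gt0.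
  apply: cvgD; last exact: ck.
  apply: cvgM; first exact: cp.
  apply: cvgB; first by apply: cvgN; exact: ln_cont.
  apply: (@continuous_comp _ _ _ (fun y : R => 1 - y) (@ln R)).
    exact: is_derive_continuous (d1 x).
  exact: ln_cont.
- rewrite /G subr0; apply: cvgD; first exact: cvgB.
  by apply: cvg_at_right_filter; exact: is_derive_continuous (dK 0).
- rewrite /G subrr; apply: cvgD.
    apply: cvgB => //; apply: cvg_at_left_filter; exact: cH.
  by apply: cvg_at_left_filter; exact: is_derive_continuous (dK 1).
Qed.

(* [T 1 - T 0] and [K 1 - K 0] are the numbers \int_0^1 (x (1 - x))^n (- ln x) dx
   and \int_0^1 (x (1 - x))^n dx for n = 0, ..., 4. *)
Lemma integral_log_poly (c0 c1 c2 c3 c4 l d2 d3 : R) :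
  (forall x, 0 < x < 1 -> let z := x * (1 - x) in
    0 <= (c0 + c1 * z + c2 * z ^+ 2 + c3 * z ^+ 3 + c4 * z ^+ 4) *
         (- l - ln z) + d2 * z ^+ 2 + d3 * z ^+ 3) ->
  (\int[mu]_(x in `]0%R, 1%R[) (let z := x * (1 - x) in
    (c0 + c1 * z + c2 * z ^+ 2 + c3 * z ^+ 3 + c4 * z ^+ 4) *
         (- l - ln z) + d2 * z ^+ 2 + d3 * z ^+ 3)%:E =
   (c0 * (2 - l) + c1 * (5 / 18 - l / 6) + c2 * (47 / 900 - l / 30)
    + c3 * (319 / (140 * 210) - l / 140) + c4 * (1879 / (630 * 1260) - l / 630)
    + d2 / 30 + d3 / 140)%:E)%E.
Proof.
move=> pos.
pose p (z : R) := c0 + c1 * z + c2 * z ^+ 2 + c3 * z ^+ 3 + c4 * z ^+ 4.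
pose P (x : R) := p (x * (1 - x)).
pose S x := c0 + c1 * (x / 2 - x ^+ 2 / 3)
  + c2 * (x ^+ 2 / 3 - x ^+ 3 / 2 + x ^+ 4 / 5)
  + c3 * (x ^+ 3 / 4 - 3 * x ^+ 4 / 5 + x ^+ 5 / 2 - x ^+ 6 / 7)
  + c4 * (x ^+ 4 / 5 - 2 * x ^+ 5 / 3 + 6 * x ^+ 6 / 7 - x ^+ 7 / 2 + x ^+ 8 / 9).
pose T x := c0 * x + c1 * (x ^+ 2 / 4 - x ^+ 3 / 9)
  + c2 * (x ^+ 3 / 9 - x ^+ 4 / 8 + x ^+ 5 / 25)
  + c3 * (x ^+ 4 / 16 - 3 * x ^+ 5 / 25 + x ^+ 6 / 12 - x ^+ 7 / 49)
  + c4 * (x ^+ 5 / 25 - x ^+ 6 / 9 + 6 * x ^+ 7 / 49 - x ^+ 8 / 16 + x ^+ 9 / 81).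
pose k x := - l * P x + d2 * (x * (1 - x)) ^+ 2 + d3 * (x * (1 - x)) ^+ 3.
pose K x := - l * (x * S x) + d2 * (x ^+ 3 / 3 - x ^+ 4 / 2 + x ^+ 5 / 5)
  + d3 * (x ^+ 4 / 4 - 3 * x ^+ 5 / 5 + x ^+ 6 / 2 - x ^+ 7 / 7).
have dS (x : R) : is_derive x (1 : R) S (c1 * (2^-1 - 2 * x / 3)
  + c2 * (2 * x / 3 - 3 * x ^+ 2 / 2 + 4 * x ^+ 3 / 5)
  + c3 * (3 * x ^+ 2 / 4 - 12 * x ^+ 3 / 5 + 5 * x ^+ 4 / 2 - 6 * x ^+ 5 / 7)
  + c4 * (4 * x ^+ 3 / 5 - 10 * x ^+ 4 / 3 + 36 * x ^+ 5 / 7 - 7 * x ^+ 6 / 2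
          + 8 * x ^+ 7 / 9)).
  by rewrite ?/S; der_eq; rewrite /=; field.
have dXS (x : R) : is_derive x (1 : R) (fun y => y * S y) (P x).
  have := der_mul (der_id x) (dS x) => h; apply: (is_derive_eq h).
  by rewrite /S /P /p; field.
have dT (x : R) : is_derive x (1 : R) T (S x).
  by rewrite /T; der_eq; rewrite /S /=; field.
have dK (x : R) : is_derive x (1 : R) K (k x).
  have d : is_derive x (1 : R) (fun x : R => d2 * (x ^+ 3 / 3 - x ^+ 4 / 2 + x ^+ 5 / 5)
      + d3 * (x ^+ 4 / 4 - 3 * x ^+ 5 / 5 + x ^+ 6 / 2 - x ^+ 7 / 7))
      (d2 * (x * (1 - x)) ^+ 2 + d3 * (x * (1 - x)) ^+ 3).
    by rewrite ?/S; der_eq; rewrite /=; field.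
  have := der_add (der_mul (der_cst x (- l)) (dXS x)) d.
  rewrite mul0r add0r => h.
  have {}h : is_derive x (1 : R) K (- l * P x +
      (d2 * (x * (1 - x)) ^+ 2 + d3 * (x * (1 - x)) ^+ 3)).
    apply: (is_derive_eq _ erefl); move: h; congr (is_derive _ _ _ _).
    by apply/funext => y; rewrite /K; ring.
  by apply: (is_derive_eq h); rewrite /k addrA.
have dP x : exists q, is_derive x (1 : R) P q.
  by eexists; rewrite /P /p; der.
have dk x : exists q, is_derive x (1 : R) k q.
  by eexists; rewrite /k /P /p; der.
transitivity (\int[mu]_(x in `]0%R, 1%R[)
    (P x * (- ln x - ln (1 - x)) + k x)%:E)%E.
  apply: eq_integral => x; rewrite inE/= in_itv/= => /andP[x0 x1].
  congr EFin; rewrite lnM ?posrE ?subr_gt0// /k /P /p.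
  by ring.
rewrite (@integral_log_moments P S T K k)//.
- by congr EFin; rewrite /T /K /S; field.
- by move=> x; have [q] := dP x; exact: is_derive_continuous.
- by move=> x; exact: is_derive_continuous (dS x).
- by move=> x; have [q] := dk x; exact: is_derive_continuous.
- by move=> x; rewrite /P; congr p; ring.
- move=> x x01; have := pos x x01; have [x0 x1] := andP x01.
  rewrite /= lnM ?posrE ?subr_gt0// /k -/(p _) -/(P x).
  by move=> /le_trans; apply; rewrite le_eqVlt; apply/orP; left; apply/eqP; rewrite /P /p; ring.
Qed.

End LogIntegrals.

(** * Rational bounds for logarithms *)

Section LogBounds.
Context {R : realType}.

Lemma is_derive_le (f df : R -> R) (a b : R) : a <= b ->
  (forall x, a <= x <= b -> is_derive x (1 : R) f (df x)) ->
  (forall x, a < x < b -> 0 <= df x) -> f a <= f b.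
Proof.
move=> ab dfE df0.
apply: (@ger0_derive1_le_cc _ f a b); rewrite ?in_itv/= ?lexx ?ab//.
- move=> x; rewrite in_itv/= => /andP[ax xb].
  by have [] := dfE x; rewrite ?ltW.
- move=> x; rewrite in_itv/= => xab; rewrite derive1E.
  have [|_ ->] := dfE x; last exact: df0.
  by case/andP: xab => ax xb; rewrite !ltW.
- apply: continuous_in_subspaceT => x /[!inE]; rewrite /= in_itv/= => xab.
  exact: is_derive_continuous (dfE x xab).
Qed.

(** The difference of the two sides has derivative [(y - 1) ^ 3 / y], which changes sign at 1 only:
    the Taylor polynomial of odd degree bounds [ln] on both sides of 1. *)
Lemma ln_le_cubic (y : R) : 0 < y ->
  ln y <= (y - 1) - (y - 1) ^+ 2 / 2 + (y - 1) ^+ 3 / 3.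
Proof.
move=> y0.
pose f (x : R) := (x - 1) - (x - 1) ^+ 2 / 2 + (x - 1) ^+ 3 / 3 - ln x.
have df (x : R) : 0 < x -> is_derive x (1 : R) f ((x - 1) ^+ 3 / x).
  move=> x0; rewrite /f; der_eq => //=.
  by field; rewrite gt_eqF.
have f1 : f 1 = 0 by rewrite /f ln1; field.
rewrite -subr_ge0 -/(f y) -f1.
have [y1|y1] := leP 1 y.
  refine (@is_derive_le f (fun x => (x - 1) ^+ 3 / x) _ _ y1 _ _).
    by move=> x /andP[x1 _]; apply: df; exact: lt_le_trans x1.
  move=> x /andP[x1 _]; rewrite divr_ge0//; last exact/ltW/(lt_trans ltr01).
  by rewrite exprn_ge0// subr_ge0 ltW.
rewrite -lerN2.
refine (@is_derive_le (fun x => - f x) (fun x => - ((x - 1) ^+ 3 / x)) _ _ (ltW y1) _ _).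
- by move=> x /andP[yx _]; apply: der_opp; apply: df; exact: lt_le_trans yx.
- move=> x /andP[yx x1]; rewrite -mulNr divr_ge0//; last exact/ltW/(lt_trans y0).
  rewrite -[x - 1]opprB exprNn -signr_odd/= expr1 mulN1r opprK.
  by rewrite exprn_ge0// subr_ge0 ltW.
Qed.

(** Partial sum of the Taylor series of [2 artanh t = ln ((1 + t) / (1 - t))]. *)
Definition atanh_sum (n : nat) (t : R) : R :=
  2 * \sum_(k < n) t ^+ k.*2.+1 / k.*2.+1%:R.

Let der_atanh_sum n (x : R) : x != 1 -> x != -1 ->
  is_derive x (1 : R) (atanh_sum n) (2 * (1 - x ^+ n.*2) / (1 - x ^+ 2)).
Proof.
move=> x1 xN1.
have d0 : 1 - x ^+ 2 != 0.
  by rewrite subr_eq0 eq_sym sqrf_eq1 negb_or x1.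
elim: n => [|n IH].
  rewrite (_ : atanh_sum 0 = fun=> 0); last first.
    by apply/funext => y; rewrite /atanh_sum big_ord0 mulr0.
  by rewrite double0 expr0 subrr mulr0 mul0r; exact: der_cst.
rewrite (_ : atanh_sum n.+1 = fun y => atanh_sum n y +
    2 * (y ^+ n.*2.+1 / n.*2.+1%:R)); last first.
  by apply/funext => y; rewrite /atanh_sum big_ord_recr/= mulrDr.
notypeclasses refine (is_derive_eq (der_add IH _) _).
  exact: (der_mul (der_cst x 2) (der_mul (der_exp n.*2.+1 (der_id x)) (der_cst x _))).
rewrite /= doubleS !exprS mul0r add0r mulr0 addr0 mulr1.
have n0 : n.*2.+1%:R != 0 :> R by rewrite pnatr_eq0.
move: (n.*2.+1%:R) n0 => m n0.
by field; rewrite n0 d0.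
Qed.

Let der_ln_atanh (x : R) : 0 <= x -> x < 1 ->
  is_derive x (1 : R) (fun y => ln ((1 + y) / (1 - y))) (2 / (1 - x ^+ 2)).
Proof.
move=> x0 x1.
have a0 : 0 < 1 - x by rewrite subr_gt0.
have b0 : 0 < 1 + x by lra.
have c0 : 1 - x ^+ 2 != 0 by rewrite gt_eqF// subr_gt0 expr2; nra.
der_eq; [exact: divr_gt0|by rewrite gt_eqF|].
rewrite /=; field.
by rewrite c0 !gt_eqF.
Qed.

Lemma ln_atanh_ge n (t : R) : 0 <= t < 1 ->
  atanh_sum n t <= ln ((1 + t) / (1 - t)).
Proof.
move=> /andP[t0 t1]; rewrite -subr_ge0.
pose f y := ln ((1 + y) / (1 - y)) - atanh_sum n y.
have -> : 0 = f 0.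
  rewrite /f subr0 addr0 divr1 ln1 /atanh_sum big1 ?mulr0 ?subrr// => k _.
  by rewrite expr0n mul0r.
refine (@is_derive_le f (fun x => 2 * x ^+ n.*2 / (1 - x ^+ 2)) _ _ t0 _ _).
- move=> x /andP[x0 xt]; have x1 : x < 1 by exact: le_lt_trans t1.
  have d0 : 1 - x ^+ 2 != 0 by rewrite gt_eqF// subr_gt0 expr2; nra.
  have xN1 : x != -1 by rewrite gt_eqF//; lra.
  have xN : x != 1 by rewrite lt_eqF.
  apply: (is_derive_eq (der_add (der_ln_atanh x0 x1)
    (der_opp (@der_atanh_sum n x xN xN1)))).
  by move: (x ^+ n.*2) => X; field.
- move=> x /andP[x0 xt]; rewrite divr_ge0 ?mulr_ge0 ?exprn_ge0 ?ltW//.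
  by rewrite subr_gt0 expr2; nra.
Qed.

(** The tail of the series is dominated by a geometric series of ratio [t ^ 2]; the proof compares
    derivatives instead of summing it. *)
Lemma ln_atanh_le n (t : R) : 0 <= t < 1 ->
  ln ((1 + t) / (1 - t)) <=
  atanh_sum n t + 2 * t ^+ n.*2.+1 / (n.*2.+1%:R * (1 - t ^+ 2)).
Proof.
move=> /andP[t0 t1]; rewrite -subr_ge0.
have n0 : n.*2.+1%:R != 0 :> R by rewrite pnatr_eq0.
pose f y := atanh_sum n y + 2 * y ^+ n.*2.+1 / (n.*2.+1%:R * (1 - y ^+ 2))
  - ln ((1 + y) / (1 - y)).
have -> : 0 = f 0.
  rewrite /f subr0 addr0 divr1 ln1 /atanh_sum big1 => [|k _].
    by rewrite expr0n/= !mulr0 mul0r addr0 subrr.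
  by rewrite expr0n mul0r.
refine (@is_derive_le f (fun x => 4 * x ^+ n.*2.+2 /
    (n.*2.+1%:R * (1 - x ^+ 2) ^+ 2)) _ _ t0 _ _).
- move=> x /andP[x0 xt]; have x1 : x < 1 by exact: le_lt_trans t1.
  have d0 : 1 - x ^+ 2 != 0 by rewrite gt_eqF// subr_gt0 expr2; nra.
  have xN1 : x != -1 by rewrite gt_eqF//; lra.
  have h : is_derive x (1 : R) (fun y => 2 * y ^+ n.*2.+1 /
      (n.*2.+1%:R * (1 - y ^+ 2))) (2 * x ^+ n.*2 / (1 - x ^+ 2) +
      4 * x ^+ n.*2.+2 / (n.*2.+1%:R * (1 - x ^+ 2) ^+ 2)).
    der_eq; first by rewrite mulf_neq0.
    rewrite /= !exprS; move: (n.*2.+1%:R) n0 => m n0; field.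
    by rewrite n0 d0.
  have hN := der_opp (der_ln_atanh x0 x1).
  have xN : x != 1 by rewrite lt_eqF.
  apply: (is_derive_eq (der_add (der_add (@der_atanh_sum n x xN xN1) h) hN)).
  rewrite !exprS; move: (x ^+ n.*2) (n.*2.+1%:R) n0 => X m n0; field.
  by rewrite n0 d0.
- move=> x /andP[x0 xt]; apply: divr_ge0; apply: mulr_ge0 => //.
    by rewrite exprn_ge0// ltW.
  exact: sqr_ge0.
Qed.

(** For [t <= 1/3] the factor [2 / (1 - t ^ 2)] is at most 9/4, which leaves a polynomial in [t]. *)
Lemma ln_atanh_le_third n (t : R) : 0 <= t <= 3^-1 ->
  ln ((1 + t) / (1 - t)) <=
  atanh_sum n t + 9 / 4 * (t ^+ n.*2.+1 / n.*2.+1%:R).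
Proof.
move=> /andP[t0 t3]; have t1 : t < 1 by lra.
have t01 : 0 <= t < 1 by rewrite t0.
apply: (le_trans (ln_atanh_le n t01)); rewrite lerD2l.
have d0 : 8 / 9 <= 1 - t ^+ 2 by rewrite expr2; nra.
have X0 : 0 <= t ^+ n.*2.+1 / n.*2.+1%:R by rewrite divr_ge0 ?exprn_ge0.
have n0 : n.*2.+1%:R != 0 :> R by rewrite pnatr_eq0.
rewrite (_ : 2 * _ / _ = 2 / (1 - t ^+ 2) * (t ^+ n.*2.+1 / n.*2.+1%:R)).
  apply: ler_wpM2r => //; rewrite ler_pdivrMr; lra.
move: (t ^+ n.*2.+1) (n.*2.+1%:R) n0 => X m n0; field.
by rewrite n0 /= gt_eqF//; lra.
Qed.

Lemma ln2_bounds :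
  693 / 10 ^+ 3 + 147 / 10 ^+ 6 + 1803 / 10 ^+ 10 <= ln (2 : R)
    <= 693 / 10 ^+ 3 + 147 / 10 ^+ 6 + 1807 / 10 ^+ 10.
Proof.
have t01 : 0 <= (3^-1 : R) < 1 by apply/andP; split; lra.
have t03 : 0 <= (3^-1 : R) <= 3^-1 by apply/andP; split; lra.
have E : (1 + 3^-1) / (1 - 3^-1) = 2 :> R by field.
apply/andP; split.
  have := ln_atanh_ge 9 t01; rewrite E; apply: le_trans.
  by rewrite /atanh_sum !big_ord_recr big_ord0 /= /double /=; lra.
have := ln_atanh_le_third 9 t03; rewrite E => /le_trans; apply.
by rewrite /atanh_sum !big_ord_recr big_ord0 /= /double /=; lra.
Qed.

End LogBounds.

(** * Bounds for the integral that gives the volume *)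

Definition ln_ratio (R : realType) (y : R) : R := - ln y / (1 - y).

(* [vol T = sqrt (k * (4 - k)) / 4 * ideal_integral k] for the plane symmetric
   ideal tetrahedron [T] with [k = 4 (cos alpha)^2]. *)
Definition ideal_integral (R : realType) (k : R) : R :=
  fine (\int[@lebesgue_measure R]_(x in `]0%R, 1%R[)
    (ln_ratio (k * (x * (1 - x))))%:E)%E.

Section IdealIntegral.
Context {R : realType}.
Local Notation mu := (@lebesgue_measure R).
Local Notation I01 := (`]0%R, 1%R[%classic : set (measurableTypeR R)).
Implicit Types (k x y l : R).

Let zP x : 0 < x < 1 -> 0 < x * (1 - x) <= 4^-1.
Proof.
move=> /andP[x0 x1]; rewrite mulr_gt0 ?subr_gt0//=.
by have := sqr_ge0 (x - 2^-1); rewrite expr2; lra.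
Qed.

Let yP k x : 0 < k < 4 -> 0 < x < 1 -> 0 < k * (x * (1 - x)) <= k / 4.
Proof.
move=> /andP[k0 k4] /zP /andP[z0 z1].
by rewrite mulr_gt0//= ler_pM2l.
Qed.

Lemma continuous_ln_ratio y : 0 < y < 1 -> {for y, continuous (@ln_ratio R)}.
Proof.
move=> /andP[y0 y1].
have [q dq] : exists q, is_derive y (1 : R) (@ln_ratio R) q.
  eexists; rewrite /ln_ratio; der => //.
  by rewrite subr_eq0 gt_eqF.
exact: is_derive_continuous dq.
Qed.

Lemma ln_ratio_ge0 y : 0 < y < 1 -> 0 <= ln_ratio y.
Proof.
move=> /andP[y0 y1]; apply: divr_ge0; last by rewrite subr_ge0 ltW.
by rewrite oppr_ge0 ln_le0// ltW.
Qed.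

Let y01 k x : 0 < k < 4 -> 0 < x < 1 -> 0 < k * (x * (1 - x)) < 1.
Proof.
move=> k04 x01; have /andP[y0 y1] := yP k04 x01.
by rewrite y0 (le_lt_trans y1)//; case/andP: k04 => _ k4; lra.
Qed.

Let cont_z x : {for x, continuous (fun x : R => x * (1 - x))}.
Proof.
have [q dq] : exists q, is_derive x (1 : R) (fun x : R => x * (1 - x)) q.
  by eexists; der.
exact: is_derive_continuous dq.
Qed.

Lemma continuous_integrand k x : 0 < k < 4 -> 0 < x < 1 ->
  {for x, continuous (fun x => ln_ratio (k * (x * (1 - x))))}.
Proof.
move=> k04 x01.
apply: (@continuous_comp _ _ _ (fun x : R => k * (x * (1 - x))) (@ln_ratio R)).
  by apply: cvgM; [exact: cvg_cst|exact: cont_z].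
by apply: continuous_ln_ratio; exact: y01.
Qed.

Let measurable_integrand k : 0 < k < 4 -> measurable_fun I01
  (EFin \o (fun x => ln_ratio (k * (x * (1 - x))))).
Proof.
move=> k04; apply/measurable_EFinP.
apply: open_continuous_measurable_fun => // x.
by rewrite inE/= in_itv/= => x01; exact: continuous_integrand.
Qed.

Let poly5 (c0 c1 c2 c3 c4 l d2 d3 x : R) := let z := x * (1 - x) in
    (c0 + c1 * z + c2 * z ^+ 2 + c3 * z ^+ 3 + c4 * z ^+ 4) *
         (- l - ln z) + d2 * z ^+ 2 + d3 * z ^+ 3.

Let measurable_poly5 c0 c1 c2 c3 c4 l d2 d3 :
  measurable_fun I01 (EFin \o poly5 c0 c1 c2 c3 c4 l d2 d3).
Proof.
apply/measurable_EFinP.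
apply: open_continuous_measurable_fun => // x.
rewrite inE/= in_itv/= => /zP /andP[z0 _].
have [q dq] : exists q, is_derive x (1 : R) (poly5 c0 c1 c2 c3 c4 l d2 d3) q.
  by eexists; rewrite /poly5 /=; der.
exact: is_derive_continuous dq.
Qed.

Let moments (c0 c1 c2 c3 c4 l d2 d3 : R) :=
  c0 * (2 - l) + c1 * (5 / 18 - l / 6) + c2 * (47 / 900 - l / 30)
    + c3 * (319 / (140 * 210) - l / 140) + c4 * (1879 / (630 * 1260) - l / 630)
    + d2 / 30 + d3 / 140.

Let ln_neg y : 0 < y < 1 -> 0 < - ln y.
Proof. by move=> yy; rewrite oppr_gt0 ln_lt0. Qed.

Let ln_ratio_split y : 0 < y < 1 -> ln_ratio y =
  (1 + y + y ^+ 2 + y ^+ 3) * (- ln y) + y ^+ 4 * ln_ratio y.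
Proof.
by move=> /andP[y0 y1]; rewrite /ln_ratio; field; rewrite subr_eq0 gt_eqF.
Qed.

(** [1 / (1 - y)] is expanded up to [y ^ 3], and [y <= k / 4] bounds the remainder
    [y ^ 4 / (1 - y)]. This is tight for small [k], in particular at the critical shape. *)
Let upper_integrand k x : 0 < k < 4 -> 0 < x < 1 ->
  ln_ratio (k * (x * (1 - x))) <=
  poly5 1 k (k ^+ 2) (k ^+ 3) (k ^+ 4 / (1 - k / 4)) (ln k) 0 0 x.
Proof.
move=> k04 x01; have [k0 k4] := andP k04; have /andP[z0 z1] := zP x01.
have yy := y01 k04 x01; have /andP[y0 y1] := yP k04 x01.
rewrite ln_ratio_split// /poly5 /= -opprD -lnM ?posrE//.
set y := k * _ in yy y0 y1 *.
have L := ln_neg yy.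
have h : ln_ratio y <= - ln y / (1 - k / 4).
  rewrite /ln_ratio ler_pM2l// lef_pV2 ?posrE; [lra| |]; case/andP: yy; lra.
have h2 : y ^+ 4 * ln_ratio y <= y ^+ 4 * (- ln y / (1 - k / 4)).
  by rewrite ler_pM2l// exprn_gt0.
rewrite (_ : (1 + _ + _ + _ + _) * _ + _ + _ =
  (1 + y + y ^+ 2 + y ^+ 3) * (- ln y) + y ^+ 4 * (- ln y / (1 - k / 4))).
  by rewrite lerD2l.
by rewrite /y; field; rewrite gt_eqF//; lra.
Qed.

Let lower_integrand k x : 0 < k < 4 -> 0 < x < 1 ->
  poly5 1 k (k ^+ 2) (k ^+ 3) (k ^+ 4) (ln k) 0 0 x <=
  ln_ratio (k * (x * (1 - x))).
Proof.
move=> k04 x01; have [k0 k4] := andP k04; have /andP[z0 z1] := zP x01.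
have yy := y01 k04 x01; have /andP[y0 y1] := yP k04 x01.
rewrite ln_ratio_split// /poly5 /= -opprD -lnM ?posrE//.
set y := k * _ in yy y0 y1 *.
have L := ln_neg yy.
have h : - ln y <= ln_ratio y.
  rewrite /ln_ratio ler_pdivlMr; last by case/andP: yy; lra.
  by rewrite ler_piMr ?(ltW L)//; lra.
have h2 : y ^+ 4 * (- ln y) <= y ^+ 4 * ln_ratio y.
  by rewrite ler_pM2l// exprn_gt0.
rewrite (_ : (1 + _ + _ + _ + _) * _ + _ + _ =
  (1 + y + y ^+ 2 + y ^+ 3) * (- ln y) + y ^+ 4 * (- ln y)).
  by rewrite lerD2l.
by rewrite /y; ring.
Qed.

(** Only the part [1 + y] of the series keeps its logarithm; for the rest [ln_le_cubic] gives
    [- ln y >= (1 - y) (3 - y) / 2]. The bound so obtained has few terms and low degree in [k]. *)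
Let lower2_integrand k x : 0 < k < 4 -> 0 < x < 1 ->
  poly5 1 k 0 0 0 (ln k) (3 * k ^+ 2 / 2) (- (k ^+ 3 / 2)) x <=
  ln_ratio (k * (x * (1 - x))).
Proof.
move=> k04 x01; have [k0 k4] := andP k04; have /andP[z0 z1] := zP x01.
have yy := y01 k04 x01; have /andP[y0 y1] := yP k04 x01.
rewrite /poly5 /= -opprD -lnM ?posrE//.
set y := k * _ in yy y0 y1 *.
have [_ y1'] := andP yy.
rewrite (_ : (1 + _ + _ + _ + _) * _ + _ + _ =
  (1 + y) * (- ln y) + y ^+ 2 * (3 - y) / 2); last by rewrite /y; field.
rewrite (_ : ln_ratio y = (1 + y) * (- ln y) + y ^+ 2 * (- ln y) / (1 - y));
  last by rewrite /ln_ratio; field; rewrite subr_eq0 gt_eqF.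
rewrite lerD2l ler_pdivlMr ?subr_gt0//.
rewrite (_ : _ / 2 * _ = y ^+ 2 * ((3 - y) / 2 * (1 - y))); last by field.
rewrite ler_pM2l ?exprn_gt0//.
have := ln_le_cubic y0.
have : 0 <= (1 - y) ^+ 3 by rewrite exprn_ge0// subr_ge0 ltW.
rewrite !exprS !expr0; lra.
Qed.

Let le_int (f g : R -> R) :
  measurable_fun I01 (EFin \o f) -> measurable_fun I01 (EFin \o g) ->
  (forall x, 0 < x < 1 -> 0 <= f x) -> (forall x, 0 < x < 1 -> f x <= g x) ->
  (\int[mu]_(x in `]0%R, 1%R[) (f x)%:E <= \int[mu]_(x in `]0%R, 1%R[) (g x)%:E)%E.
Proof.
by move=> mf mg f0 fg; apply: ge0_le_integral.
Qed.

Let int_poly5 c0 c1 c2 c3 c4 l d2 d3 :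
  (forall x, 0 < x < 1 -> 0 <= poly5 c0 c1 c2 c3 c4 l d2 d3 x) ->
  (\int[mu]_(x in `]0%R, 1%R[) (poly5 c0 c1 c2 c3 c4 l d2 d3 x)%:E =
   (moments c0 c1 c2 c3 c4 l d2 d3)%:E)%E.
Proof. exact: integral_log_poly. Qed.

Lemma ideal_integral_fin k : 0 < k < 4 ->
  (\int[mu]_(x in `]0%R, 1%R[) (ln_ratio (k * (x * (1 - x))))%:E =
   (ideal_integral k)%:E)%E.
Proof.
move=> k04; rewrite /ideal_integral fineK// ge0_fin_numE; last first.
  by apply: integral_ge0 => x; rewrite /= in_itv/= => x01; rewrite lee_fin ln_ratio_ge0// y01.
have pos x : 0 < x < 1 -> 0 <= ln_ratio (k * (x * (1 - x))).
  by move=> x01; rewrite ln_ratio_ge0// y01.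
apply: (@le_lt_trans _ _ (\int[mu]_(x in `]0%R, 1%R[)
    (poly5 1 k (k ^+ 2) (k ^+ 3) (k ^+ 4 / (1 - k / 4)) (ln k) 0 0 x)%:E)%E).
  apply: le_int => //; first exact: measurable_integrand.
  by move=> x x01; exact: upper_integrand.
rewrite int_poly5 ?ltry// => x x01.
by apply: le_trans (upper_integrand k04 x01); exact: pos.
Qed.

Lemma ideal_integral_le k : 0 < k < 4 -> ideal_integral k <=
  moments 1 k (k ^+ 2) (k ^+ 3) (k ^+ 4 / (1 - k / 4)) (ln k) 0 0.
Proof.
move=> k04; rewrite -lee_fin -ideal_integral_fin//.
have pos x : 0 < x < 1 -> 0 <= ln_ratio (k * (x * (1 - x))).
  by move=> x01; rewrite ln_ratio_ge0// y01.
rewrite -int_poly5; last first.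
  by move=> x x01; apply: le_trans (upper_integrand k04 x01); exact: pos.
apply: le_int => //; first exact: measurable_integrand.
by move=> x x01; exact: upper_integrand.
Qed.

Let pos5 k c2 c3 c4 x : 0 < k < 4 -> 0 <= c2 -> 0 <= c3 -> 0 <= c4 -> 0 < x < 1 ->
  0 <= (1 + k * (x * (1 - x)) + c2 * (x * (1 - x)) ^+ 2 + c3 * (x * (1 - x)) ^+ 3
    + c4 * (x * (1 - x)) ^+ 4) * (- ln k - ln (x * (1 - x))).
Proof.
move=> k04 c20 c30 c40 x01.
have [k0 _] := andP k04; have /andP[z0 _] := zP x01.
rewrite -opprD -lnM ?posrE// mulr_ge0//; last exact/ltW/ln_neg/y01.
have z0' := ltW z0; have k0' := ltW k0.
by rewrite !addr_ge0// mulr_ge0// exprn_ge0.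
Qed.

Lemma ideal_integral_ge k : 0 < k < 4 ->
  moments 1 k (k ^+ 2) (k ^+ 3) (k ^+ 4) (ln k) 0 0 <= ideal_integral k.
Proof.
move=> k04; rewrite -lee_fin -ideal_integral_fin//.
have pos x : 0 < x < 1 ->
    0 <= poly5 1 k (k ^+ 2) (k ^+ 3) (k ^+ 4) (ln k) 0 0 x.
  move=> x01; rewrite /poly5 /= !mul0r !addr0 pos5// exprn_ge0//;
  by case/andP: k04 => /ltW.
rewrite -int_poly5//; apply: le_int => //; first exact: measurable_integrand.
by move=> x x01; exact: lower_integrand.
Qed.

Lemma ideal_integral_ge2 k : 0 < k < 4 ->
  2 - ln k + k * (5 / 18 - ln k / 6) + k ^+ 2 / 20 - k ^+ 3 / 280
  <= ideal_integral k.
Proof.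
move=> k04; rewrite -lee_fin -ideal_integral_fin//.
have pos x : 0 < x < 1 ->
    0 <= poly5 1 k 0 0 0 (ln k) (3 * k ^+ 2 / 2) (- (k ^+ 3 / 2)) x.
  move=> x01; rewrite /poly5 /= -addrA addr_ge0 ?pos5//.
  have [k0 k4] := andP k04; have /andP[z0 z1] := zP x01.
  rewrite (_ : _ + _ = (k * (x * (1 - x))) ^+ 2 * ((3 - k * (x * (1 - x))) / 2)).
    have /andP[? ?] := y01 k04 x01.
    rewrite mulr_ge0 ?sqr_ge0//; lra.
  by field.
rewrite (_ : 2 - ln k + _ + _ - _ =
  moments 1 k 0 0 0 (ln k) (3 * k ^+ 2 / 2) (- (k ^+ 3 / 2))); last first.
  by rewrite /moments; field.
rewrite -int_poly5//; apply: le_int => //; first exact: measurable_integrand.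
by move=> x x01; exact: lower2_integrand.
Qed.

Let int_addc k c : 0 < k < 4 -> 0 <= c ->
  (ideal_integral k + c)%:E = (\int[mu]_(x in `]0%R, 1%R[)
    (ln_ratio (k * (x * (1 - x))) + c)%:E)%E.
Proof.
move=> k04 c0; rewrite EFinD -ideal_integral_fin//.
have -> : c%:E = (\int[mu]_(x in `]0%R, 1%R[) (cst c%:E) x)%E.
  by rewrite integral_cst//= lebesgue_measure_itv/= lte_fin ltr01 -EFinB subr0 mule1.
rewrite -ge0_integralD//.
- by move=> x; rewrite /= in_itv/= => x01; rewrite lee_fin ln_ratio_ge0// y01.
- exact: measurable_integrand.
Qed.

(** Nonnegative constants on both sides let two integrals be compared with an error term while only
    nonnegative functions are added. *)
Let le_shift k l c d : 0 < k < 4 -> 0 < l < 4 -> 0 <= c -> 0 <= d ->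
  (forall x, 0 < x < 1 -> ln_ratio (k * (x * (1 - x))) + c <=
     ln_ratio (l * (x * (1 - x))) + d) ->
  ideal_integral k + c <= ideal_integral l + d.
Proof.
move=> k04 l04 c0 d0 kl; rewrite -lee_fin !int_addc//.
have mc j e : 0 < j < 4 -> measurable_fun I01
    (EFin \o (fun x => ln_ratio (j * (x * (1 - x))) + e)).
  move=> j04; apply/measurable_EFinP; apply: measurable_funD => //.
  by apply/measurable_EFinP; exact: measurable_integrand.
apply: le_int => //; try exact: mc.
by move=> x x01; rewrite addr_ge0// ln_ratio_ge0// y01.
Qed.

(** With [m = l / k], write [- ln y = - ln (m y) + ln m]. The first part increases when [1 - y] is
    replaced by [1 - m y]; the error is [ln m <= m - 1] over [1 - y >= 1 - k / 4]. *)
Lemma ideal_integral_right k l : 0 < k -> k <= l -> l < 4 ->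
  ideal_integral k <= ideal_integral l + (l / k - 1) / (1 - k / 4).
Proof.
move=> k0 kl l4.
have k04 : 0 < k < 4 by rewrite k0 (le_lt_trans kl).
have l04 : 0 < l < 4 by rewrite (lt_le_trans k0).
have lk1 : 1 <= l / k by rewrite ler_pdivlMr// mul1r.
rewrite -[leLHS]addr0; apply: le_shift => //; first by rewrite divr_ge0; lra.
move=> x x01; rewrite addr0; have /andP[y0 y1] := yP k04 x01; have /andP[_ w1] := y01 l04 x01.
have ly : l * (x * (1 - x)) = l / k * (k * (x * (1 - x))) by field; rewrite gt_eqF.
have /andP[_ v1] := y01 k04 x01.
rewrite ly in w1 *.
set y := k * _ in y0 y1 w1 v1 *; set m := l / k in lk1 w1 *.
have m0 : 0 < m by exact: lt_le_trans lk1.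
have Lm : ln m <= m - 1.
  by have := @le_ln1Dx R (m - 1); rewrite addrCA subrr addr0; apply; lra.
have my0 : 0 < m * y by rewrite mulr_gt0.
have E1 : ln_ratio y = (- ln (m * y)) / (1 - y) + ln m / (1 - y).
  by rewrite /ln_ratio lnM ?posrE//; field; rewrite subr_eq0 gt_eqF.
rewrite E1 lerD//.
  rewrite /ln_ratio ler_pM2l; last by rewrite ln_neg// my0.
  rewrite lef_pV2 ?posrE; [|lra|lra].
  by rewrite lerD2l lerN2 ler_peMl// ltW.
apply: ler_pM => //; [exact: ln_ge0|rewrite invr_ge0; lra|].
by rewrite lef_pV2 ?posrE; lra.
Qed.

(** With [m = l / k], the term [- ln m] gains at least [1 - m], while the change of denominator from
    [1 - y] to [1 - m y] costs at most [3/10] of it; this leaves [7/10]. *)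
Lemma ideal_integral_left k l : 0 < l -> l <= k -> k <= 15^-1 ->
  ideal_integral k + 7 / 10 * (1 - l / k) <= ideal_integral l.
Proof.
move=> l0 lk k15.
have k0 : 0 < k by exact: lt_le_trans lk.
have k04 : 0 < k < 4 by rewrite k0; lra.
have l04 : 0 < l < 4 by rewrite l0; lra.
have lk1 : l / k <= 1 by rewrite ler_pdivrMr// mul1r.
have lk0 : 0 < l / k by rewrite divr_gt0.
rewrite -[leRHS]addr0; apply: le_shift => //; first by rewrite mulr_ge0; lra.
move=> x x01; rewrite addr0; have /andP[y0 y1] := yP k04 x01.
have ly : l * (x * (1 - x)) = l / k * (k * (x * (1 - x))) by field; rewrite gt_eqF.
rewrite ly; set y := k * _ in y0 y1 *; set m := l / k in lk1 lk0 *.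
have y60 : y <= 60^-1 by lra.
have Lm : ln m <= m - 1.
  by have := @le_ln1Dx R (m - 1); rewrite addrCA subrr addr0; apply; lra.
have my1 : m * y <= y by rewrite ler_piMl// ltW.
(* From [- ln y = 2 ln 2 + ln (1 / (4 y))] and [ln 2 <= 5/6], which is the cubic bound at 2, the
   left side is at most [2 y / 3 + 1/4]; then [y <= 1/60] suffices. *)
have L : y * (- ln y) <= 3 / 10 * (1 - y).
  have y4 : 0 < 4 * y by rewrite pmulr_rgt0.
  have h4 : - ln y = 2 * ln 2 + ln (4 * y)^-1.
    have l4 : ln 4 = 2 * ln 2 :> R.
      by rewrite (_ : 4 = 2 ^+ 2 :> R) ?lnXn ?mulr_natl//; ring.
    by rewrite lnV ?posrE// lnM ?posrE// l4; ring.
  have l2 := ln_le_cubic (ltr0n R 2).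
  have := @le_ln1Dx R ((4 * y)^-1 - 1).
  rewrite addrCA subrr addr0 => /(_ _) hv.
  have {}hv : ln (4 * y)^-1 <= (4 * y)^-1 - 1.
    by apply: hv; rewrite ltrBrDr addNr invr_gt0.
  rewrite h4; apply: (@le_trans _ _ (y * (2 * (5 / 6) + ((4 * y)^-1 - 1)))).
    by rewrite ler_pM2l// lerD//; lra.
  rewrite (_ : y * _ = 2 / 3 * y + 4^-1); last by field; rewrite gt_eqF.
  by lra.
have D1 : 0 < 1 - m * y by lra.
have D0 : 0 < 1 - y by lra.
rewrite /ln_ratio lnM ?posrE// ler_pdivlMr//.
have h : (- ln y / (1 - y)) * (y * (1 - m)) <= 3 / 10 * (1 - m).
  have -> : - ln y / (1 - y) * (y * (1 - m)) = y * (- ln y) / (1 - y) * (1 - m).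
    by field; rewrite gt_eqF.
  by rewrite ler_wpM2r ?subr_ge0// ler_pdivrMr.
have E : - ln y / (1 - y) * (1 - m * y) = - ln y + - ln y / (1 - y) * (y * (1 - m)).
  by field; rewrite gt_eqF.
rewrite mulrDl E.
have : 7 / 10 * (1 - m) * (1 - m * y) <= 7 / 10 * (1 - m).
  by rewrite ler_piMr; [|lra|]; have := mulr_gt0 lk0 y0; lra.
lra.
Qed.

End IdealIntegral.

(** * Optimal radii for a fixed shape *)

Section RegionPolynomials.
Context {R : realType}.
Implicit Types (k l c L U : R).

(** Third-order expansion of [ln] at [c], with [L] in place of [ln c]. A rational centre for each
    interval makes the later bounds polynomial in [k]. *)
Definition cubic_log L c k := L + (k / c - 1) - (k / c - 1) ^+ 2 / 2 + (k / c - 1) ^+ 3 / 3.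

(** The bound of [ideal_integral_ge2] with [U] in place of [ln k]. It decreases in [U], so an upper
    bound for the logarithm is enough. *)
Definition ideal_lower U k := 2 - U + k * (5 / 18 - U / 6) + k ^+ 2 / 20 - k ^+ 3 / 280.

Lemma ln_le_cubic_log L c k : 0 < c -> 0 < k -> ln c <= L -> ln k <= cubic_log L c k.
Proof.
move=> c0 k0 cL.
have -> : ln k = ln c + ln (k / c).
  by rewrite -lnM ?posrE ?divr_gt0// mulrC divfK// gt_eqF.
by rewrite /cubic_log -!addrA lerD// !addrA; apply: ln_le_cubic; rewrite divr_gt0.
Qed.

Lemma ideal_integral_lower U k : 0 < k < 4 -> ln k <= U ->
  ideal_lower U k <= ideal_integral k.
Proof.
move=> k04 kU; apply: (le_trans _ (ideal_integral_ge2 k04)).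
have /andP[k0 _] := k04; rewrite /ideal_lower.
have : k * ln k <= k * U by rewrite ler_pM2l.
lra.
Qed.

Lemma ln3_bounds : 109 / 10 ^+ 2 + 86 / 10 ^+ 4 <= ln (3 : R) <= 109 / 10 ^+ 2 + 87 / 10 ^+ 4.
Proof.
have [l2 u2] := andP (@ln2_bounds R).
have t01 : 0 <= (5^-1 : R) < 1 by apply/andP; split; lra.
have t03 : 0 <= (5^-1 : R) <= 3^-1 by apply/andP; split; lra.
have E : (1 + 5^-1) / (1 - 5^-1) = 3 / 2 :> R by field.
have := ln_atanh_ge 4 t01; have := ln_atanh_le_third 4 t03.
rewrite E ln_div ?posrE// /atanh_sum !big_ord_recr big_ord0 /= /double /=.
by move=> h1 h2; apply/andP; split; lra.
Qed.

Lemma ln5_le : ln (5 : R) <= 160 / 10 ^+ 2 + 95 / 10 ^+ 4.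
Proof.
have [l2 u2] := andP (@ln2_bounds R).
have t03 : 0 <= (9^-1 : R) <= 3^-1 by apply/andP; split; lra.
have E : (1 + 9^-1) / (1 - 9^-1) = 5 / 4 :> R by field.
have l4 : ln 4 = 2 * ln 2 :> R.
  by rewrite (_ : 4 = 2 ^+ 2 :> R) ?lnXn ?mulr_natl//; ring.
have := ln_atanh_le_third 3 t03.
rewrite E ln_div ?posrE// l4 /atanh_sum !big_ord_recr big_ord0 /= /double /=.
by move=> h1; lra.
Qed.

Lemma ln_3_16 : ln (3 / 16 : R) <= - (167 / 10 ^+ 2 + 38 / 10 ^+ 4).
Proof.
have [l2 u2] := andP (@ln2_bounds R); have [l3 u3] := andP ln3_bounds.
have l16 : ln 16 = 4 * ln 2 :> R.
  by rewrite (_ : 16 = 2 ^+ 4 :> R) ?lnXn ?mulr_natl//; ring.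
by rewrite ln_div ?posrE// l16; lra.
Qed.

Lemma ln_1_2 : ln (1 / 2 : R) <= - (69 / 10 ^+ 2 + 31 / 10 ^+ 4).
Proof.
have [l2 u2] := andP (@ln2_bounds R).
by rewrite ln_div ?posrE// ln1; lra.
Qed.

Lemma ln_3_4 : ln (3 / 4 : R) <= - (28 / 10 ^+ 2 + 75 / 10 ^+ 4).
Proof.
have [l2 u2] := andP (@ln2_bounds R); have [l3 u3] := andP ln3_bounds.
have l4 : ln 4 = 2 * ln 2 :> R.
  by rewrite (_ : 4 = 2 ^+ 2 :> R) ?lnXn ?mulr_natl//; ring.
by rewrite ln_div ?posrE// l4; lra.
Qed.

Lemma ln_3_2 : ln (3 / 2 : R) <= 40 / 10 ^+ 2 + 56 / 10 ^+ 4.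
Proof.
have [l2 u2] := andP (@ln2_bounds R); have [l3 u3] := andP ln3_bounds.
by rewrite ln_div ?posrE//; lra.
Qed.

Lemma ln_2 : ln (2 : R) <= 69 / 10 ^+ 2 + 32 / 10 ^+ 4.
Proof. by have [l2 u2] := andP (@ln2_bounds R); lra. Qed.

Lemma ln_5_2 : ln (5 / 2 : R) <= 91 / 10 ^+ 2 + 64 / 10 ^+ 4.
Proof.
have [l2 u2] := andP (@ln2_bounds R); have := ln5_le.
by rewrite ln_div ?posrE//; lra.
Qed.

Let bern l u k : l <= k <= u -> forall i j, 0 <= (k - l) ^+ i * (u - k) ^+ j.
Proof.
by move=> /andP[lk ku] i j; rewrite mulr_ge0// exprn_ge0// subr_ge0.
Qed.

(* On the given interval the difference of the two sides has nonnegative coefficients in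
   the Bernstein basis. *)
Ltac bern_deg6 H := rewrite /ideal_lower /cubic_log;
  have := H 6%N 0%N; have := H 5%N 1%N; have := H 4%N 2%N; have := H 3%N 3%N;
  have := H 2%N 4%N; have := H 1%N 5%N; have := H 0%N 6%N; lra.

Ltac bern_deg5 H := rewrite /ideal_lower /cubic_log;
  have := H 5%N 0%N; have := H 4%N 1%N; have := H 3%N 2%N;
  have := H 2%N 3%N; have := H 1%N 4%N; have := H 0%N 5%N; lra.

(** The factor [875 / 10 ^ 3 - 1 / 10 ^ 4] is the lower bound of the maximal density from
    [max_density_coarse]. This and the following inequalities feed the hypotheses of the [sum_le]
    lemmas for [k] away from the critical value. *)
Lemma small_bound k : 10^-1 <= k <= 268 / 1000 ->
  (1 + k) * (k * (4 - k) ^+ 2 + 1) <= 2 * k * (4 - k) *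
  ((875 / 10 ^+ 3 - 1 / 10 ^+ 4) *
   ideal_lower (cubic_log (- (167 / 10 ^+ 2 + 38 / 10 ^+ 4)) (3 / 16) k) k).
Proof. by move=> /bern H; bern_deg6 H. Qed.

Lemma vertex_bound_left k : 267 / 1000 <= k <= 8 / 10 ->
  k * (4 - k) ^+ 2 + k + 2 <= 2 * k * (4 - k) *
  ((875 / 10 ^+ 3 - 1 / 10 ^+ 4) *
   ideal_lower (cubic_log (- (69 / 10 ^+ 2 + 31 / 10 ^+ 4)) (1 / 2) k) k).
Proof. by move=> /bern H; bern_deg6 H. Qed.

Lemma vertex_bound_middle k : 8 / 10 <= k <= 25 / 10 ->
  k * (4 - k) ^+ 2 + k + 2 <= 2 * k * (4 - k) *
  ((875 / 10 ^+ 3 - 1 / 10 ^+ 4) *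
   ideal_lower (cubic_log (40 / 10 ^+ 2 + 56 / 10 ^+ 4) (3 / 2) k) k).
Proof. by move=> /bern H; bern_deg6 H. Qed.

Lemma vertex_bound_right k : 25 / 10 <= k <= 3 ->
  k * (4 - k) ^+ 2 + k + 2 <= 2 * k * (4 - k) *
  ((875 / 10 ^+ 3 - 1 / 10 ^+ 4) *
   ideal_lower (cubic_log (91 / 10 ^+ 2 + 64 / 10 ^+ 4) (5 / 2) k) k).
Proof. by move=> /bern H; bern_deg6 H. Qed.

Lemma medium_chord_bound_left k : 267 / 1000 <= k <= 9 / 10 ->
  (1 + k) ^+ 2 <= 2 * k * ((875 / 10 ^+ 3 - 1 / 10 ^+ 4) *
   ideal_lower (cubic_log (- (69 / 10 ^+ 2 + 31 / 10 ^+ 4)) (1 / 2) k) k).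
Proof. by move=> /bern H; bern_deg5 H. Qed.

Lemma medium_chord_bound_right k : 9 / 10 <= k <= 1 ->
  (1 + k) ^+ 2 <= 2 * k * ((875 / 10 ^+ 3 - 1 / 10 ^+ 4) *
   ideal_lower (cubic_log (- (28 / 10 ^+ 2 + 75 / 10 ^+ 4)) (3 / 4) k) k).
Proof. by move=> /bern H; bern_deg5 H. Qed.

Lemma large_chord_bound_left k : 1 <= k <= 28 / 10 ->
  k + 1 <= k * ((875 / 10 ^+ 3 - 1 / 10 ^+ 4) *
   ideal_lower (cubic_log (69 / 10 ^+ 2 + 32 / 10 ^+ 4) 2 k) k).
Proof. by move=> /bern H; bern_deg5 H. Qed.

Lemma large_chord_bound_right k : 28 / 10 <= k <= 3 ->
  k + 1 <= k * ((875 / 10 ^+ 3 - 1 / 10 ^+ 4) *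
   ideal_lower (cubic_log (91 / 10 ^+ 2 + 64 / 10 ^+ 4) (5 / 2) k) k).
Proof. by move=> /bern H; bern_deg5 H. Qed.

Lemma generic_bound k : 3 <= k <= 35 / 10 ->
  k * (4 - k) ^+ 2 + 1 <= k * (4 - k) * ((875 / 10 ^+ 3 - 1 / 10 ^+ 4) *
   ideal_lower (cubic_log (91 / 10 ^+ 2 + 64 / 10 ^+ 4) (5 / 2) k) k).
Proof. by move=> /bern H; bern_deg6 H. Qed.

End RegionPolynomials.

(** * Maximal sum of the normalised radii *)

Section Optimisation.
Context {R : realType}.
Implicit Types (a b k s t : R).

(** Along the hyperbola [x y = b] the sum is convex, so it is largest at the corner where the
    greater variable equals [z]. *)
Let pair_bound (x y z b : R) : 0 <= x -> 0 <= y -> 0 < z -> x <= z -> y <= z -> x * y <= b ->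
  b <= z ^+ 2 -> x + y <= z + b / z.
Proof.
move=> x0 y0 z0 xz yz xyb bz.
wlog yx : x y x0 y0 xz yz xyb / y <= x.
  move=> H; have [yx|xy] := leP y x; first exact: H.
  by rewrite addrC; apply: H; rewrite 1?mulrC// ltW.
rewrite -(ler_pM2r z0) mulrDl [leRHS]mulrDl divfK ?gt_eqF//.
have [xzb|xzb] := leP b (x * z).
  have [->|x0'] := eqVneq x 0; first by move: bz; rewrite expr2; nra.
  have xp : 0 < x by rewrite lt_neqAle eq_sym x0'.
  rewrite -(ler_pM2l xp); move: bz; rewrite expr2 => bz.
  have h1 : 0 <= (z - x) * (x * z - b) by rewrite mulr_ge0 ?subr_ge0.
  have h2 : 0 <= z * (b - x * y) by rewrite mulr_ge0 ?subr_ge0// ltW.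
  lra.
move: bz; rewrite expr2 => bz.
have := mulr_ge0 (ltW z0) (_ : 0 <= x - y); rewrite subr_ge0 => /(_ yx).
lra.
Qed.

(* [t] and [s] dominate the pairs [u3, u0] and [u2, u1] up to relabelling. *)
Lemma pair_reduction k a u0 u1 u2 u3 : 0 < k -> 0 < a -> a <= 1 ->
  0 <= u0 <= 1 -> 0 <= u1 <= 1 -> 0 <= u2 <= 1 -> 0 <= u3 <= 1 ->
  u0 * u3 <= k * a -> u1 * u2 <= k * a ->
  u0 * u1 <= a -> u0 * u2 <= a -> u1 * u3 <= a -> u2 * u3 <= a ->
  exists t s x y, [/\ 0 < s, s <= t, t <= 1, t * s = a & u0 + u1 + u2 + u3 = x + y]
    /\ [/\ x <= 2 * t, (k * s <= t -> x <= t + k * s), y <= 2 * s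
       & (k * t <= s -> y <= s + k * t)].
Proof.
move=> k0 a0 a1.
pose top (u0 u1 u2 u3 : R) := [&& u0 <= u3, u1 <= u3, u2 <= u3 & u1 <= u2].
have main : forall (u0 u1 u2 u3 : R), top u0 u1 u2 u3 ->
  0 <= u0 <= 1 -> 0 <= u1 <= 1 -> 0 <= u2 <= 1 -> 0 <= u3 <= 1 ->
  u0 * u3 <= k * a -> u1 * u2 <= k * a -> u2 * u3 <= a ->
  exists t s x y, [/\ 0 < s, s <= t, t <= 1, t * s = a & u0 + u1 + u2 + u3 = x + y]
    /\ [/\ x <= 2 * t, (k * s <= t -> x <= t + k * s), y <= 2 * s
       & (k * t <= s -> y <= s + k * t)].
  move=> {}u0 {}u1 {}u2 {}u3 /and4P[u03 u13 u23 u12] /andP[p0 q0] /andP[p1 q1] /andP[p2 q2] /andP[p3 q3].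
  move=> b03 b12 a23.
  have ra : 0 < Num.sqrt a by rewrite sqrtr_gt0.
  have ra2 : Num.sqrt a * Num.sqrt a = a by rewrite -expr2 sqr_sqrtr// ltW.
  have ra1 : Num.sqrt a <= 1 by rewrite -sqrtr1 ler_sqrt.
  (* [t] bounds [u3] and [s = a / t] bounds [u2]: either [t = u3] and [u2 u3 <= a] applies, or
     [t = s = sqrt a] and [u2 <= u3] does. The maximum with [sqrt a] ensures [s <= t]. *)
  pose t := Num.max u3 (Num.sqrt a).
  have rt : Num.sqrt a <= t by rewrite /t le_max lexx orbT.
  have t0 : 0 < t by exact: lt_le_trans rt.
  have u3t : u3 <= t by rewrite /t le_max lexx.
  pose s := a / t.
  have ts : t * s = a by rewrite /s mulrC divfK// gt_eqF.
  have s0 : 0 < s by rewrite divr_gt0.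
  have st : s <= t.
    rewrite -(ler_pM2l t0) ts -{1}ra2.
    by apply: ler_pM => //; exact: ltW.
  have u2s : u2 <= s.
    rewrite /s ler_pdivlMr//; have [h|h] := leP (Num.sqrt a) u3.
      by rewrite /t (max_l h).
    rewrite /t (max_r (ltW h)) -[leRHS]ra2 ler_pM2r//.
    exact/ltW/(le_lt_trans u23).
  exists t, s, (u0 + u3), (u1 + u2); split; split => //.
  - by rewrite /t ge_max q3.
  - by ring.
  - lra.
  - move=> kst.
    rewrite (_ : k * s = k * a / t); last by rewrite -ts; field; rewrite gt_eqF.
    apply: pair_bound => //; first exact: le_trans u3t.
    by rewrite -ts expr2 mulrCA ler_pM2l.
  - lra.
  - move=> kts.
    rewrite (_ : k * t = k * a / s); last by rewrite -ts; field; rewrite gt_eqF.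
    apply: pair_bound => //; first exact: le_trans u2s.
    by rewrite -ts expr2 mulrA ler_pM2r.
move=> h0 h1 h2 h3 b03 b12 a01 a02 a13 a23.
(* The relabellings used from here on permute the constraints; they bring the largest value to the
   place of [u3] and the larger one of the other pair to [u2]. *)
wlog u03 : u0 u1 u2 u3 h0 h1 h2 h3 b03 b12 a01 a02 a13 a23 / u0 <= u3.
  move=> H; have [?|/ltW ?] := leP u0 u3; first exact: H.
  rewrite (_ : u0 + u1 + u2 + u3 = u3 + u2 + u1 + u0); last by ring.
  by apply: H => //; rewrite mulrC.
wlog u12 : u0 u1 u2 u3 h0 h1 h2 h3 b03 b12 a01 a02 a13 a23 u03 / u1 <= u2.
  move=> H; have [?|/ltW ?] := leP u1 u2; first exact: H.
  rewrite (_ : u0 + u1 + u2 + u3 = u0 + u2 + u1 + u3); last by ring.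
  by apply: H => //; rewrite mulrC.
have [u23|/ltW u32] := leP u2 u3.
  by apply: main => //; rewrite /top u03 u23 u12 (le_trans u12).
rewrite (_ : u0 + u1 + u2 + u3 = u1 + u0 + u3 + u2); last by ring.
apply: main => //; last by rewrite mulrC.
by rewrite /top u12 u32 u03 (le_trans u03).
Qed.

(** [t ^ 2 + c - M t] is convex in [t], hence nonpositive on [[T, 1]] as soon as it is so at both
    ends. *)
Let chord_bound (T t c M : R) : T <= t <= 1 -> T ^+ 2 + c <= M * T -> 1 + c <= M ->
  t ^+ 2 + c <= M * t.
Proof.
move=> /andP[Tt t1] hT h1.
have [T1|T1] := ltP T 1; last first.
  have -> : t = 1 by apply/eqP; rewrite eq_le t1 (le_trans T1).
  by rewrite expr1n mulr1.
have T1' : 0 < 1 - T by rewrite subr_gt0.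
rewrite -subr_ge0 -(pmulr_rge0 _ T1').
rewrite (_ : _ * _ = (1 - t) * (M * T - (T ^+ 2 + c)) + (t - T) * (M - (1 + c))
   + (1 - T) * ((t - T) * (1 - t))); last by ring.
by rewrite !addr_ge0 ?mulr_ge0 ?subr_ge0// ltW.
Qed.

Variables (k u0 u1 u2 u3 : R).
Hypotheses (k0 : 0 < k) (k4 : k < 4).
Local Notation q := (4 - k).
Hypotheses (h0 : 0 <= u0 <= 1) (h1 : 0 <= u1 <= 1) (h2 : 0 <= u2 <= 1)
  (h3 : 0 <= u3 <= 1).
Hypotheses (b03 : q ^+ 2 * (u0 * u3) <= 1) (b12 : q ^+ 2 * (u1 * u2) <= 1).
Hypotheses (a01 : k * q ^+ 2 * (u0 * u1) <= 1) (a02 : k * q ^+ 2 * (u0 * u2) <= 1)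
  (a13 : k * q ^+ 2 * (u1 * u3) <= 1) (a23 : k * q ^+ 2 * (u2 * u3) <= 1).

Let q0 : 0 < q. Proof. by rewrite subr_gt0. Qed.
Let a := (k * q ^+ 2)^-1.
Let a0 : 0 < a. Proof. by rewrite invr_gt0 mulr_gt0// exprn_gt0. Qed.
Let S := u0 + u1 + u2 + u3.

Let aP x : k * q ^+ 2 * x <= 1 -> x <= a.
Proof. by move=> h; rewrite /a -[leRHS]mul1r ler_pdivlMr 1?mulrC// mulr_gt0// exprn_gt0. Qed.

Let bP (x : R) : q ^+ 2 * x <= 1 -> x <= k * a.
Proof.
move=> h; rewrite /a (_ : k * _ = (q ^+ 2)^-1); last by field; rewrite !gt_eqF.
by rewrite -[leRHS]mul1r ler_pdivlMr 1?mulrC// exprn_gt0.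
Qed.

Let reduction : a <= 1 -> exists t s x y,
  [/\ 0 < s, s <= t, t <= 1, t * s = a & S = x + y]
    /\ [/\ x <= 2 * t, (k * s <= t -> x <= t + k * s), y <= 2 * s
       & (k * t <= s -> y <= s + k * t)].
Proof. by move=> a1; apply: pair_reduction; rewrite ?aP ?bP. Qed.

(** [(1 - x) (1 - y) >= 0] gives [x + y <= 1 + x y], applied to the two pairs whose products are at
    most [q ^ -2]. *)
Lemma sum_le_pairs : q * S <= 2 * (q + q^-1).
Proof.
have pair x y : 0 <= x <= 1 -> 0 <= y <= 1 -> q ^+ 2 * (x * y) <= 1 ->
    q * (x + y) <= q + q^-1.
  move=> /andP[x0 x1] /andP[y0 y1] xy.
  rewrite -(ler_pM2l q0) [leRHS]mulrDr divff ?gt_eqF//.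
  have : 0 <= q ^+ 2 * ((1 - x) * (1 - y)).
    by rewrite mulr_ge0 ?sqr_ge0// mulr_ge0 ?subr_ge0.
  rewrite !expr2 in xy *; lra.
have := pair _ _ h0 h3 b03; have := pair _ _ h1 h2 b12; rewrite /S; lra.
Qed.

Let kq2 : 0 < k * q ^+ 2. Proof. by rewrite mulr_gt0// exprn_gt0. Qed.
Let kqa : k * q ^+ 2 * a = 1. Proof. by rewrite /a divff// gt_eqF. Qed.

Lemma sum_le_four : q * S <= 4 * q.
Proof.
rewrite mulrC ler_pM2r// /S.
case/andP: h0 h1 h2 h3 => _ ? /andP[_ ?] /andP[_ ?] /andP[_ ?]; lra.
Qed.

Let le_sqr (x y : R) : 0 <= x -> 0 <= y -> x * x <= y * y -> x <= y.
Proof. by move=> x0 y0; rewrite -!expr2 ler_pXn2r// nnegrE. Qed.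

(** The sum is at most [2 (t + s)], and [t + s <= 1 + t s = 1 + a]. If [a > 1], already the trivial
    bound [4 q] is small enough. *)
Lemma sum_le_generic M : k * q ^+ 2 + 1 <= k * q * M -> q * S <= 2 * M.
Proof.
move=> hM.
have {}hM : q * (1 + a) <= M.
  rewrite -(ler_pM2l (mulr_gt0 k0 q0)).
  rewrite [leLHS](_ : _ = k * q ^+ 2 + k * q ^+ 2 * a); last by ring.
  by rewrite kqa.
have [a1|a1] := leP a 1; last first.
  apply: (le_trans sum_le_four); have : q * 1 <= q * a by rewrite ler_pM2l// ltW.
  by move: hM; rewrite mulrDr; lra.
have [t [s [x [y [[s0 st t1 ts ->] [xt _ ys _]]]]]] := reduction a1.
have h : 0 <= q * ((1 - t) * (1 - s)).
  by rewrite mulr_ge0 ?(ltW q0)// mulr_ge0 ?subr_ge0// (le_trans st).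
have h' : q * (x + y) <= q * (2 * t + 2 * s) by rewrite ler_pM2l// lerD.
by rewrite -ts in hM; lra.
Qed.

(** [k q <= 1] means [k <= a], so [k t <= s] and both pairs admit the sharp estimate; the sum is
    then at most [(1 + k) (t + s) <= (1 + k) (1 + a)]. *)
Lemma sum_le_small M : k * q <= 1 -> 1 <= k * q ^+ 2 ->
  (1 + k) * (k * q ^+ 2 + 1) <= 2 * k * q * M -> q * S <= 2 * M.
Proof.
move=> kq1 kq21 hM.
have {}hM : q * ((1 + k) * (1 + a)) <= 2 * M.
  rewrite -(ler_pM2l (mulr_gt0 k0 q0)).
  rewrite [leLHS](_ : _ = (1 + k) * (k * q ^+ 2 + k * q ^+ 2 * a)); last by ring.
  by rewrite kqa (le_trans hM)// (_ : 2 * k * q * M = k * q * (2 * M))//; ring.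
have a1 : a <= 1 by rewrite /a invf_le1.
have ka : k <= a.
  apply: aP; rewrite [leLHS](_ : _ = (k * q) ^+ 2); last by ring.
  by rewrite expr_le1// mulr_ge0// ltW.
have k1 : k <= 1 by exact: le_trans a1.
have [t [s [x [y [[s0 st t1 ts ->] [_ xt _ ys]]]]]] := reduction a1.
have t0 : 0 < t by exact: lt_le_trans st.
have kst : k * s <= t by apply: (le_trans _ st); rewrite ler_piMl// ltW.
have kts : k * t <= s.
  rewrite -(ler_pM2l t0) ts mulrCA -expr2 (le_trans _ ka)//.
  by rewrite ler_piMr ?(ltW k0)// expr_le1// ltW.
apply: le_trans hM; rewrite ler_pM2l//.
apply: (le_trans (lerD (xt kst) (ys kts))).
rewrite [leLHS](_ : _ = (1 + k) * (t + s)); last by ring.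
rewrite ler_pM2l ?addr_gt0// -ts.
have : 0 <= (1 - t) * (1 - s) by rewrite mulr_ge0 ?subr_ge0// (le_trans st).
lra.
Qed.

(** Multiplication by [t], with [t s = a], turns the claim into the quadratic inequality of
    [chord_bound]. *)
Let chord_le N T : 0 < T -> T <= 1 -> T ^+ 2 + (k + 2) * a <= N * T ->
  1 + (k + 2) * a <= N ->
  forall t s, T <= t -> t <= 1 -> t * s = a -> t + k * s + 2 * s <= N.
Proof.
move=> T0 T1 hT h1' t s Tt t1 ts; have t0 : 0 < t by exact: lt_le_trans Tt.
rewrite -(ler_pM2r t0).
have := @chord_bound T t ((k + 2) * a) N; rewrite Tt t1 => /(_ isT hT h1').
by apply: le_trans; rewrite -ts le_eqVlt; apply/orP; left; apply/eqP; ring.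
Qed.

Let vertex M : k * q ^+ 2 + k + 2 <= 2 * k * q * M -> 1 + (k + 2) * a <= 2 * M / q.
Proof.
move=> hM; rewrite ler_pdivlMr// -(ler_pM2l (mulr_gt0 k0 q0)).
rewrite [leLHS](_ : _ = k * q ^+ 2 + (k + 2) * (k * q ^+ 2 * a)); last by ring.
rewrite kqa mulr1 addrA; apply: (le_trans hM).
by rewrite (_ : 2 * k * q * M = k * q * (2 * M))//; ring.
Qed.

(** The condition [k t <= s] reads [t <= T] with [T = 1 / (k q)]. Below [T] the bound
    [(1 + k) (t + s)] is largest at [T]; above it, [t + k s + 2 s] is convex in [t] and is checked
    at [T] and at 1. *)
Lemma sum_le_medium M : k <= 1 -> 1 <= k * q ->
  (1 + k) ^+ 2 <= 2 * k * M -> k * q ^+ 2 + k + 2 <= 2 * k * q * M -> q * S <= 2 * M.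
Proof.
move=> k1 kq1 hM1 /vertex hM2.
pose N := 2 * M / q; rewrite -/N in hM2.
suff : S <= N by rewrite ler_pdivlMr// mulrC.
have kq0 : 0 < k * q by rewrite mulr_gt0.
pose T := (k * q)^-1.
have T0 : 0 < T by rewrite invr_gt0.
have T1 : T <= 1 by rewrite invf_le1.
have aT : a = k * T ^+ 2 by rewrite /a /T; field; rewrite !gt_eqF.
have hT : (1 + k) ^+ 2 * T <= N.
  rewrite /N ler_pdivlMr// -(ler_pM2l k0) (_ : k * (2 * M) = 2 * k * M); last by ring.
  apply: le_trans hM1.
  by rewrite [leLHS](_ : _ = (1 + k) ^+ 2) // /T; field; rewrite !gt_eqF.
have a1 : a <= 1.
  rewrite aT; apply: (@le_trans _ _ (1 * 1)); last by rewrite mulr1.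
  by rewrite ler_pM ?sqr_ge0// ?(ltW k0)// expr_le1// ltW.
have [t [s [x [y [[s0 st t1 ts ->] [_ xt y2 ys]]]]]] := reduction a1.
have t0 : 0 < t by exact: lt_le_trans st.
have kst : k * s <= t by apply: (le_trans _ st); rewrite ler_piMl// ltW.
have [kts|kts] := leP (k * t) s.
  apply: (le_trans (lerD (xt kst) (ys kts))); apply: le_trans hT.
  rewrite [leLHS](_ : _ = (1 + k) * (t + s)); last by ring.
  rewrite expr2 -mulrA ler_pM2l ?addr_gt0// -(ler_pM2l t0).
  have tT : t <= T.
    apply: le_sqr; rewrite ?(ltW t0) ?(ltW T0)// -(ler_pM2l k0) -!expr2 -aT -ts.
    by rewrite expr2 mulrCA ler_pM2l.
  have kTt : k * T <= t.
    apply: le_sqr; rewrite ?(ltW t0) ?mulr_ge0 ?(ltW T0) ?(ltW k0)//.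
    apply: (@le_trans _ _ (t * s)); last by rewrite ler_pM2l.
    rewrite ts aT [leLHS](_ : _ = k * (k * T ^+ 2)); last by ring.
    by rewrite ler_piMl// mulr_ge0 ?sqr_ge0// ltW.
  have : 0 <= (T - t) * (t - k * T) by rewrite mulr_ge0 ?subr_ge0.
  by rewrite [t * (t + s)]mulrDr ts aT expr2; lra.
apply: (le_trans (lerD (xt kst) y2)).
apply: (chord_le T0 T1 _ hM2 _ t1 ts).
  rewrite aT [leLHS](_ : _ = (1 + k) ^+ 2 * T * T); last by ring.
  by rewrite ler_pM2r.
apply: le_sqr; rewrite ?(ltW t0) ?(ltW T0)// -(ler_pM2l k0) -!expr2 -aT -ts.
by rewrite expr2 [leRHS]mulrCA ler_pM2l// ltW.
Qed.

(** For [k >= 1] the pair bounded by [s] only gets [2 s]. The condition [k s <= t] reads [t >= T]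
    with [T = 1 / q]; below [T] the bound is [2 (t + s)], above it the convex function of the
    previous case. *)
Lemma sum_le_large M : 1 <= k -> 1 <= q ->
  k + 1 <= k * M -> k * q ^+ 2 + k + 2 <= 2 * k * q * M -> q * S <= 2 * M.
Proof.
move=> k1 q1 hM1 /vertex hM2.
pose N := 2 * M / q; rewrite -/N in hM2.
suff : S <= N by rewrite ler_pdivlMr// mulrC.
pose T := q^-1.
have T0 : 0 < T by rewrite invr_gt0.
have T1 : T <= 1 by rewrite invf_le1.
have aT : k * a = T ^+ 2 by rewrite /a /T; field; rewrite !gt_eqF.
have hT : 2 * (T + T / k) <= N.
  rewrite /N ler_pdivlMr// -(ler_pM2l k0).
  rewrite [leLHS](_ : _ = 2 * (k + 1)); last by rewrite /T; field; rewrite !gt_eqF.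
  by rewrite mulrCA ler_pM2l.
have a1 : a <= 1.
  apply: (@le_trans _ _ (k * a)); first by rewrite ler_peMl// ltW.
  by rewrite aT expr_le1// ltW.
have [t [s [x [y [[s0 st t1 ts ->] [x2 xt y2 _]]]]]] := reduction a1.
have t0 : 0 < t by exact: lt_le_trans st.
have aTk : a = T * (T / k) by rewrite mulrA -expr2 -aT; field; rewrite gt_eqF.
have [kst|kst] := leP (k * s) t.
  apply: (le_trans (lerD (xt kst) y2)).
  apply: (chord_le T0 T1 _ hM2 _ t1 ts).
    rewrite [leLHS](_ : _ = 2 * (T + T / k) * T); last first.
      by rewrite aTk; field; rewrite gt_eqF.
    by rewrite ler_pM2r.
  apply: le_sqr; rewrite ?(ltW t0) ?(ltW T0)// -!expr2 -aT -ts.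
  by rewrite mulrCA expr2 ler_pM2l.
apply: (le_trans (lerD x2 y2)); apply: le_trans hT.
rewrite -mulrDr ler_pM2l// -(ler_pM2l t0).
have tT : t <= T.
  apply: le_sqr; rewrite ?(ltW t0) ?(ltW T0)// -!expr2 -aT -ts.
  by rewrite [leRHS]mulrCA expr2 ler_pM2l// ltW.
have Tkt : T / k <= t.
  apply: le_sqr; rewrite ?(ltW t0) ?divr_ge0 ?(ltW T0) ?(ltW k0)//.
  apply: (@le_trans _ _ (t * s)); last by rewrite ler_pM2l.
  rewrite ts aTk ler_wpM2r ?divr_ge0 ?(ltW T0) ?(ltW k0)//.
  by rewrite ler_pdivrMr// ler_peMr// ltW.
have : 0 <= (T - t) * (t - T / k) by rewrite mulr_ge0 ?subr_ge0.
by rewrite [t * (t + s)]mulrDr ts aTk; lra.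
Qed.

End Optimisation.

(** * The critical shape *)

Section CriticalParameter.
Context {R : realType}.
Implicit Types c k : R.

Lemma ln4 : ln 4 = 2 * ln 2 :> R.
Proof. by rewrite (_ : 4 = 2 ^+ 2 :> R) ?lnXn ?mulr_natl//; ring. Qed.

Lemma ideal_integral_gt0 (k : R) : 0 < k < 4 -> 0 < ideal_integral k.
Proof.
move=> k04; apply: (lt_le_trans _ (ideal_integral_ge2 k04)).
have /andP[k0 k4] := k04; have [l2 u2] := andP (@ln2_bounds R).
have lk : ln k <= 2 * ln 2.
  by rewrite -ln4 ler_ln ?posrE// ltW.
have h1 : 0 <= k * (5 / 18 - ln k / 6).
  by rewrite mulr_ge0 ?(ltW k0)//; lra.
have h2 : 0 <= k ^+ 2 * (4 - k) by rewrite mulr_ge0 ?sqr_ge0// subr_ge0 ltW.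
have h3 : 0 <= k ^+ 2 by exact: sqr_ge0.
rewrite -addrA; apply: ltr_wpDr; first by move: h2 h3; clear; lra.
by apply: ltr_wpDr => //; move: lk u2; clear; lra.
Qed.

(** On [[0, 1/10]] the function [c (4 - c) ^ 2] has slope at least 10, so evaluating it at two
    rational points encloses the root. *)
Lemma crit_bounds c : 0 < c -> c < 10^-1 -> c * (4 - c) ^+ 2 = 1 ->
  645 / 10 ^+ 4 + 676 / 10 ^+ 7 + 680 / 10 ^+ 10 + 2 / 10 ^+ 11
  <= c <= 645 / 10 ^+ 4 + 676 / 10 ^+ 7 + 680 / 10 ^+ 10 + 4 / 10 ^+ 11.
Proof.
move=> c0 c1 cE; set x := (X in X <= _); set y := (X in _ && (_ <= X)).
have mono (a b : R) : 0 <= a -> a <= b -> b <= 10^-1 ->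
    10 * (b - a) <= b * (4 - b) ^+ 2 - a * (4 - a) ^+ 2.
  move=> a0 ab b1.
  have -> : b * (4 - b) ^+ 2 - a * (4 - a) ^+ 2 =
    10 * (b - a) + (b - a) * (6 - 8 * (a + b) + b ^+ 2 + a * b + a ^+ 2) by ring.
  rewrite lerDl mulr_ge0 ?subr_ge0//.
  have : 0 <= a * b by rewrite mulr_ge0// (le_trans a0).
  have := sqr_ge0 a; have := sqr_ge0 b; lra.
apply/andP; split; rewrite leNgt; apply/negP => h.
- have := mono c x (ltW c0) (ltW h) _; rewrite cE /x => /(_ _).
  move: h; rewrite /x; lra.
- have := mono y c _ (ltW h) (ltW c1); rewrite cE /y => /(_ _).
  move: h; rewrite /y; lra.
Qed.

(** The equation gives [ln c = - 2 ln (4 - c)], and [4 / (4 - c) = (1 + t) / (1 - t)] with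
    [t = c / (8 - c)] near 0.008, where two terms of the series are enough. *)
Lemma ln_crit_bounds c : 0 < c -> c < 10^-1 -> c * (4 - c) ^+ 2 = 1 ->
  - (2740 / 10 ^+ 3 + 41 / 10 ^+ 6 + 491 / 10 ^+ 9)
  <= ln c <= - (2740 / 10 ^+ 3 + 41 / 10 ^+ 6 + 486 / 10 ^+ 9).
Proof.
move=> c0 c1 cE; have [l2 u2] := andP (@ln2_bounds R); have [lc uc] := andP (crit_bounds c0 c1 cE).
pose t := c / (8 - c).
have p8 : 0 < 8 - c by move: uc; clear; lra.
have p4 : 0 < 4 - c by move: uc; clear; lra.
have tl : 8 / 10 ^+ 3 + 136 / 10 ^+ 6 + 628 / 10 ^+ 9 + 89 / 10 ^+ 11 <= t.
  by rewrite /t ler_pdivlMr//; move: lc; clear; lra.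
have tu : t <= 8 / 10 ^+ 3 + 136 / 10 ^+ 6 + 628 / 10 ^+ 9 + 90 / 10 ^+ 11.
  by rewrite /t ler_pdivrMr//; move: uc; clear; lra.
have t01 : 0 <= t < 1 by apply/andP; move: tl tu; clear; split; lra.
have t03 : 0 <= t <= 3^-1 by apply/andP; move: tl tu; clear; split; lra.
have E : (1 + t) / (1 - t) = 4 / (4 - c).
  rewrite /t; field; rewrite !gt_eqF//=; move: uc; clear; lra.
clearbody t.
have lcE : ln c = - (2 * ln (4 - c)).
  have cV : c = ((4 - c) ^+ 2)^-1.
    by rewrite -[LHS](mulfK (_ : (4 - c) ^+ 2 != 0)) ?cE ?mul1r// expf_neq0// gt_eqF.
  rewrite [in LHS]cV.
  rewrite lnV ?posrE ?exprn_gt0// lnXn//; ring.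
have := ln_atanh_ge 2 t01; have := ln_atanh_le_third 2 t03.
rewrite E ln_div ?posrE// ln4 /atanh_sum !big_ord_recr big_ord0 /= /double /=.
have t0 : 0 <= t by case/andP: t03.
have pow (x y b : R) n : 0 <= x -> x <= y -> y ^+ n <= b -> x ^+ n <= b.
  by move=> x0 xy; apply: le_trans; rewrite lerXn2r ?nnegrE// (le_trans x0).
have t3u : t ^+ 3 <= 53 / 10 ^+ 8 + 87 / 10 ^+ 10.
  by apply: (pow _ (8 / 10 ^+ 3 + 1367 / 10 ^+ 7)) ; move: t0 tu; clear; lra.
have t3l : 53 / 10 ^+ 8 + 86 / 10 ^+ 10 <= t ^+ 3.
  apply: (@le_trans _ _ ((8 / 10 ^+ 3 + 1366 / 10 ^+ 7) ^+ 3)); first by clear; lra.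
  by apply: (pow _ _ _ _ _ _ (lexx _)); move: tl; clear; lra.
have t5u : t ^+ 5 <= 10 / 10 ^+ 11.
  by apply: (pow _ (1 / 10 ^+ 2)) ; move: t0 tu; clear; lra.
move: l2 u2 lc uc tl tu t3u t3l t5u; rewrite lcE; clear.
by move=> *; apply/andP; split; lra.
Qed.

End CriticalParameter.

Section CriticalValue.
Context {R : realType}.
Implicit Types c k : R.

(** Every term [c ^ n (A - m ln c)] is nonnegative, increases with the power of [c] and decreases
    with [ln c] when these are varied separately, so the enclosures are inserted term by term. *)
Lemma ideal_integral_crit c : 0 < c -> c < 10^-1 -> c * (4 - c) ^+ 2 = 1 ->
  4788 / 10 ^+ 3 + 70 / 10 ^+ 6 + 8 / 10 ^+ 8 <=
  ideal_integral c <= 4788 / 10 ^+ 3 + 70 / 10 ^+ 6 + 11 / 10 ^+ 8.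
Proof.
move=> c0 c1 cE; have [lc uc] := andP (crit_bounds c0 c1 cE); have [ll lu] := andP (ln_crit_bounds c0 c1 cE).
have c04 : 0 < c < 4 by rewrite c0; move: uc; clear; lra.
have := ideal_integral_le c04; have := ideal_integral_ge c04.
move: (ln c) ll lu => l ll lu; cbv beta zeta => h1 h2.
have mono n (a b A m l1 l2 : R) : 0 <= a -> a <= b -> 0 <= A -> 0 <= m ->
    l2 <= l1 -> l1 <= 0 -> a ^+ n * (A - l1 * m) <= b ^+ n * (A - l2 * m).
  move=> a0 ab A0 m0 l21 l10; apply: ler_pM; rewrite ?exprn_ge0//.
  - by rewrite -mulNr; apply: addr_ge0 => //; apply: mulr_ge0; rewrite ?oppr_ge0.
  - by apply: lerXn2r; rewrite ?nnegrE// (le_trans a0).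
  - by rewrite lerD2l lerN2 ler_wpM2r.
have l0 : l <= 0 by move: lu; clear; lra.
have c0' := ltW c0.
have ln0 : - (2740 / 10 ^+ 3 + 41 / 10 ^+ 6 + 486 / 10 ^+ 9) <= 0 :> R by clear; lra.
have cl0 : 0 <= 645 / 10 ^+ 4 + 676 / 10 ^+ 7 + 680 / 10 ^+ 10 + 2 / 10 ^+ 11 :> R.
  by clear; lra.
have lower n (A m : R) A0 m0 := @mono n _ _ A m _ _ cl0 lc A0 m0 lu ln0.
have upper n (A m : R) A0 m0 := @mono n _ _ A m _ _ c0' uc A0 m0 ll l0.
have inv4 : (1 - c / 4)^-1 <= 1 + 165 / 10 ^+ 4.
  rewrite -[leLHS]mul1r ler_pdivrMr; move: lc uc; clear; lra.
have A1 : 0 <= 5 / 18 :> R by clear; lra.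
have m1 : 0 <= 6^-1 :> R by clear; lra.
have A2 : 0 <= 47 / 900 :> R by clear; lra.
have m2 : 0 <= 30^-1 :> R by clear; lra.
have A3 : 0 <= 319 / (140 * 210) :> R by clear; lra.
have m3 : 0 <= 140^-1 :> R by clear; lra.
have A4 : 0 <= 1879 / (630 * 1260) :> R by clear; lra.
have m4 : 0 <= 630^-1 :> R by clear; lra.
have h4 : c ^+ 4 / (1 - c / 4) * (1879 / (630 * 1260) - l / 630) <=
    (1 + 165 / 10 ^+ 4) * (c ^+ 4 * (1879 / (630 * 1260) - l / 630)).
  rewrite [c ^+ 4 / _]mulrC -mulrA; apply: ler_wpM2r; last exact: inv4.
  apply: mulr_ge0; first exact: exprn_ge0.
  by move: l0; clear; lra.
apply/andP; split.
- apply: le_trans h1; move: (lower 1%N _ _ A1 m1) (lower 2%N _ _ A2 m2) lu.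
  move: (lower 3%N _ _ A3 m3) (lower 4%N _ _ A4 m4); clear; lra.
- apply: (le_trans h2); move: (upper 1%N _ _ A1 m1) (upper 2%N _ _ A2 m2) ll h4.
  move: (upper 3%N _ _ A3 m3) (upper 4%N _ _ A4 m4); clear.
  move: (_ / (1 - _) * _) => Y; lra.
Qed.

End CriticalValue.

(** * The density bound over all shapes *)

Section Optimum.
Context {R : realType}.
Implicit Types c k : R.

Definition max_density c := (4 - c + (4 - c)^-1) / ideal_integral c.

Lemma inv_crit c : c < 10^-1 -> c * (4 - c) ^+ 2 = 1 -> (4 - c)^-1 = c * (4 - c).
Proof.
move=> c1 cE; have q0 : 4 - c != 0 by rewrite gt_eqF//; lra.
by apply: (mulIf q0); rewrite mulVf// -mulrA -expr2 cE.
Qed.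

Lemma max_density_bounds c : 0 < c -> c < 10^-1 -> c * (4 - c) ^+ 2 = 1 ->
  `|max_density c - (874 / 10 ^+ 3 + 994 / 10 ^+ 6 + 29 / 10 ^+ 8)| < 1 / 10 ^+ 8.
Proof.
move=> c0 c1 cE; have [lc uc] := andP (crit_bounds c0 c1 cE).
have [lF uF] := andP (ideal_integral_crit c0 c1 cE).
have q0 : 0 < 4 - c by move: uc; clear; lra.
have -> : max_density c = (4 - c + c * (4 - c)) / ideal_integral c.
  by rewrite /max_density inv_crit.
have num_lo : 4189 / 10 ^+ 3 + 534 / 10 ^+ 6 + 20 / 10 ^+ 9 <= 4 - c + c * (4 - c).
  have : c * c <= c * (645 / 10 ^+ 4 + 676 / 10 ^+ 7 + 680 / 10 ^+ 10 + 4 / 10 ^+ 11).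
    by rewrite ler_pM2l.
  by move: lc uc; clear; lra.
have num_hi : 4 - c + c * (4 - c) <= 4189 / 10 ^+ 3 + 534 / 10 ^+ 6 + 21 / 10 ^+ 9.
  have : c * (645 / 10 ^+ 4 + 676 / 10 ^+ 7 + 680 / 10 ^+ 10 + 2 / 10 ^+ 11) <= c * c.
    by rewrite ler_pM2l.
  by move: lc uc; clear; lra.
have F0 : 0 < ideal_integral c by move: lF; clear; lra.
move: (ideal_integral c) (4 - c + c * (4 - c)) lF uF num_lo num_hi F0.
clear => F N lF uF lN uN F0.
rewrite ltr_norml; apply/andP; split.
  by rewrite ltrBrDr ltr_pdivlMr//; move: uF lN; clear; lra.
by rewrite ltrBlDr ltr_pdivrMr//; move: lF uN; clear; lra.
Qed.

Lemma max_density_coarse c : 0 < c -> c < 10^-1 -> c * (4 - c) ^+ 2 = 1 ->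
  875 / 10 ^+ 3 - 1 / 10 ^+ 4 <= max_density c <= 875 / 10 ^+ 3.
Proof.
move=> c0 c1 cE; have := max_density_bounds c0 c1 cE; rewrite ltr_norml => /andP[].
by move: (max_density c) => d *; apply/andP; split; lra.
Qed.

(** From [c] down to [k] the left side grows by at most [c - k], while the right side gains at least
    [7/10] of the density times [1 - k / c], and [1 - k / c >= 10 (c - k)]. *)
Lemma optimum_left c k : 0 < c -> c < 10^-1 -> c * (4 - c) ^+ 2 = 1 ->
  0 < k -> k <= c -> 4 - k + (4 - k)^-1 <= max_density c * ideal_integral k.
Proof.
move=> c0 c1 cE k0 kc; have [dl du] := andP (max_density_coarse c0 c1 cE).
have q30 : 0 < 4 - c by move: c1; clear; lra.
have F0 : 0 < ideal_integral c.
  by have [+ _] := andP (ideal_integral_crit c0 c1 cE); move: (ideal_integral c); clear => F; lra.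
have d0 : 0 < max_density c by apply: divr_gt0 => //; apply: addr_gt0; rewrite ?invr_gt0.
have cl15 : c <= 15^-1 by have [_] := andP (crit_bounds c0 c1 cE); clear; lra.
have q0 : 0 < 4 - k by move: kc c1; clear; lra.
have hF := ideal_integral_left k0 kc cl15.
have {hF} : max_density c * (ideal_integral c + 7 / 10 * (1 - k / c)) <= max_density c * ideal_integral k by rewrite ler_pM2l.
apply: le_trans; rewrite mulrDr {1}/max_density divfK ?gt_eqF//.
have hinv : (4 - k)^-1 <= (4 - c)^-1 by rewrite lef_pV2 ?posrE// lerD2l lerN2.
have h10 : 10 * (c - k) <= 1 - k / c.
  rewrite -(ler_pM2r c0) mulrBl divfK ?gt_eqF// mul1r.
  by have := mulr_ge0 (_ : 0 <= c - k) (_ : 0 <= 1 - 10 * c); rewrite !subr_ge0 => /(_ kc); move: c1; clear; lra.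
have : 6 / 10 * (10 * (c - k)) <= max_density c * (7 / 10) * (1 - k / c).
  apply: ler_pM => //; first by rewrite mulr_ge0// subr_ge0.
  by move: dl; move: (max_density c); clear => d; lra.
by rewrite -[max_density c * _ * _]mulrA; move: hinv kc; move: (max_density c * _) (4 - k)^-1 (4 - c)^-1; clear => *; lra.
Qed.

(** [ideal_integral_right] bounds the right side below by an affine function of [k - c]. The
    difference is then a polynomial in [k - c] whose constant term vanishes by the equation for [c]
    and whose linear coefficient is positive. *)
Lemma optimum_right c k : 0 < c -> c < 10^-1 -> c * (4 - c) ^+ 2 = 1 ->
  c <= k -> k <= 10^-1 -> (1 + k) * (k * (4 - k) ^+ 2 + 1) <=
    2 * k * (4 - k) * (max_density c * ideal_integral k).
Proof.
move=> c0 c1 cE ck k1; have [dl du] := andP (max_density_coarse c0 c1 cE).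
have q30 : 0 < 4 - c by move: c1; clear; lra.
have F0 : 0 < ideal_integral c.
  by have [+ _] := andP (ideal_integral_crit c0 c1 cE); move: (ideal_integral c); clear => F; lra.
have d0 : 0 < max_density c by apply: divr_gt0 => //; apply: addr_gt0; rewrite ?invr_gt0.
have k4 : k < 4 by move: k1; clear; lra.
have hF := ideal_integral_right c0 ck k4.
(* The equation gives [1 / (c (4 - c)) = 4 - c], and [7/2] is [4] times the upper bound
   [875 / 10 ^ 3] of the density. *)
have hM : (4 - c) * (1 + c - 7 / 2 * (k - c)) <= max_density c * ideal_integral k.
  have : max_density c * ideal_integral c <=
      max_density c * (ideal_integral k + (k / c - 1) / (1 - c / 4)) by rewrite ler_pM2l.
  rewrite {1}/max_density divfK ?gt_eqF// inv_crit//.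
  have -> : (k / c - 1) / (1 - c / 4) = 4 * (k - c) * (4 - c).
    have : (k / c - 1) / (1 - c / 4) = 4 * (k - c) * (c * (4 - c))^-1.
      by field; rewrite !gt_eqF//=; move: q30; clear; lra.
    move=> ->; congr (_ * _); apply: (mulIf (_ : c * (4 - c) != 0)).
      by rewrite gt_eqF// mulr_gt0.
    by rewrite mulVf ?gt_eqF ?mulr_gt0// mulrCA -expr2 cE.
  have : max_density c * (4 * (k - c) * (4 - c)) <= 875 / 10 ^+ 3 * (4 * (k - c) * (4 - c)).
    by rewrite ler_wpM2r// mulr_ge0 ?(ltW q30)// mulr_ge0// subr_ge0.
  by rewrite mulrDr; clear; lra.
have k0 : 0 < k by exact: lt_le_trans ck.
have m0 : 0 < 2 * k * (4 - k) by rewrite mulr_gt0 ?subr_gt0// mulr_gt0.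
apply: le_trans (_ : 2 * k * (4 - k) * ((4 - c) * (1 + c - 7 / 2 * (k - c))) <= _); last first.
  by rewrite ler_pM2l.
rewrite -subr_ge0 [leRHS](_ : _ = (1 + c) * (c * (4 - c) ^+ 2 - 1) + (k - c) *
  ((15 - 120 * c + 57 * c ^+ 2 - 7 * c ^+ 3) + (99 * c - 18 * c ^+ 2 - 128) * (k - c)
   + (35 - 11 * c) * (k - c) ^+ 2 - (k - c) ^+ 3)); last by field.
rewrite cE subrr mulr0 add0r mulr_ge0 ?subr_ge0//.
have [lc uc] := andP (crit_bounds c0 c1 cE).
have {}uc : c <= 65 / 10 ^+ 3 by move: uc; clear; lra.
have {}lc : 64 / 10 ^+ 3 <= c by move: lc; clear; lra.
have e1 : 0 <= c ^+ 2 * (57 - 7 * c) by rewrite mulr_ge0 ?sqr_ge0//; move: uc; clear; lra.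
have kc0 : 0 <= k - c by rewrite subr_ge0.
have e2 : 0 <= c * (99 - 18 * c) * (k - c).
  by rewrite mulr_ge0// mulr_ge0 ?(ltW c0)//; move: uc; clear; lra.
have e3 : 0 <= (k - c) ^+ 2 * (35 - 11 * c - (k - c)).
  by rewrite mulr_ge0 ?sqr_ge0//; move: uc k1 c0; clear; lra.
by move: e1 e2 e3 uc lc k1; clear; lra.
Qed.

Lemma optimum_lower c k U m P : 0 < c -> c < 10^-1 -> c * (4 - c) ^+ 2 = 1 ->
  0 < k < 4 -> ln k <= U -> 0 < m -> 0 <= P ->
  P <= m * ((875 / 10 ^+ 3 - 1 / 10 ^+ 4) * ideal_lower U k) -> P <= m * (max_density c * ideal_integral k).
Proof.
move=> c0 c1 cE k04 lU m0 P0 hP; apply: (le_trans hP).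
have D0 : 0 < 875 / 10 ^+ 3 - 1 / 10 ^+ 4 :> R by lra.
rewrite ler_pM2l//; apply: ler_pM.
- exact: ltW.
- by have := le_trans P0 hP; rewrite pmulr_rge0// pmulr_rge0.
- by case/andP: (max_density_coarse c0 c1 cE).
- exact: ideal_integral_lower.
Qed.

Lemma optimum_regions c k : 0 < c -> c < 10^-1 -> c * (4 - c) ^+ 2 = 1 ->
    10^-1 < k -> k < 4 -> let M := max_density c * ideal_integral k in
  [\/ [/\ k * (4 - k) <= 1, 1 <= k * (4 - k) ^+ 2
         & (1 + k) * (k * (4 - k) ^+ 2 + 1) <= 2 * k * (4 - k) * M],
      [/\ k <= 1, 1 <= k * (4 - k), (1 + k) ^+ 2 <= 2 * k * M
         & k * (4 - k) ^+ 2 + k + 2 <= 2 * k * (4 - k) * M],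
      [/\ 1 <= k, 1 <= 4 - k, k + 1 <= k * M
         & k * (4 - k) ^+ 2 + k + 2 <= 2 * k * (4 - k) * M]
    | k * (4 - k) ^+ 2 + 1 <= k * (4 - k) * M \/ 4 * (4 - k) <= 2 * M].
Proof.
move=> c0 c1 cE k1 k4 M.
have k0 : 0 < k by move: k1; clear; lra.
have k04 : 0 < k < 4 by rewrite k0.
have q0 : 0 < 4 - k by rewrite subr_gt0.
have kq0 : 0 < k * (4 - k) by rewrite mulr_gt0.
have kqq0 : 0 <= k * (4 - k) ^+ 2 by rewrite mulr_ge0 ?sqr_ge0// ltW.
have kq20 : 0 < 2 * k * (4 - k) by rewrite -mulrA mulr_gt0.
have low L x U m P : ln x <= L -> 0 < x -> U = cubic_log L x k -> 0 < m -> 0 <= P ->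
    P <= m * ((875 / 10 ^+ 3 - 1 / 10 ^+ 4) * ideal_lower U k) -> P <= m * M.
  move=> lx x0 -> m0 P0; apply: optimum_lower => //.
  exact: ln_le_cubic_log.
have low_3_16 := low _ _ _ _ _ (@ln_3_16 R) _ erefl.
have low_1_2 := low _ _ _ _ _ (@ln_1_2 R) _ erefl.
have low_3_4 := low _ _ _ _ _ (@ln_3_4 R) _ erefl.
have low_3_2 := low _ _ _ _ _ (@ln_3_2 R) _ erefl.
have low_2 := low _ _ _ _ _ (@ln_2 R) _ erefl.
have low_5_2 := low _ _ _ _ _ (@ln_5_2 R) _ erefl.
have p2 : 0 <= k * (4 - k) ^+ 2 + k + 2 by move: kqq0 k0; clear; lra.
have [kle1|kgt1] := leP k 1.
  have [kq1|kq1] := leP (k * (4 - k)) 1.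
    (* Below 1 the equation [k (4 - k) = 1] has the root [2 - sqrt 3], about 0.26795; the rationals
       0.268 and 0.267 enclose it, and the intervals of the polynomial bounds overlap
       accordingly. *)
    have k268 : k <= 268 / 1000.
      rewrite leNgt; apply/negP => h.
      have : 0 <= (1 - k) * (k - 268 / 1000) by rewrite mulr_ge0 ?subr_ge0// ltW.
      by move: kq1 h; clear; lra.
    apply: Or41; split => //.
      have : 0 <= k * (4 - k) * (3 / 10 - k).
        by rewrite mulr_ge0 ?(ltW kq0)//; move: k268; clear; lra.
      have : 0 <= (k - 10^-1) * (39 / 10 - k) by rewrite mulr_ge0//; move: k1 k4 kle1; clear; lra.
      by clear; lra.
    apply: low_3_16 => //.
      by rewrite mulr_ge0//; move: kqq0 k0; clear; lra.
    by apply: small_bound; rewrite (ltW k1).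
  have k267 : 267 / 1000 <= k.
    rewrite leNgt; apply/negP => h.
    have : 0 <= (267 / 1000 - k) * (3733 / 1000 - k).
      by rewrite mulr_ge0 ?subr_ge0 ?(ltW h)//; move: h; clear; lra.
    by move: kq1 h; clear; lra.
  apply: Or42; split => //; first exact: ltW.
  - have [k9|k9] := leP k (9 / 10).
      apply: low_1_2 => //; [exact: mulr_gt0 | exact: sqr_ge0 |].
      by apply: medium_chord_bound_left; rewrite k267.
    apply: low_3_4 => //; [exact: mulr_gt0 | exact: sqr_ge0 |].
    by apply: medium_chord_bound_right; rewrite (ltW k9).
  - have [k8|k8] := leP k (8 / 10).
      by apply: low_1_2 => //; apply: vertex_bound_left; rewrite k267.
    apply: low_3_2 => //.
    by apply: vertex_bound_middle; rewrite (ltW k8); move: kle1; clear; lra.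
have [k3|k3] := leP k 3.
  apply: Or43; split; first exact: ltW.
  - by move: k3; clear; lra.
  - have [k28|k28] := leP k (28 / 10).
      apply: low_2 => //; first by move: k0; clear; lra.
      by apply: large_chord_bound_left; rewrite (ltW kgt1).
    apply: low_5_2 => //; first by move: k0; clear; lra.
    by apply: large_chord_bound_right; rewrite (ltW k28).
  - have [k25|k25] := leP k (25 / 10).
      apply: low_3_2 => //.
      by apply: vertex_bound_middle; rewrite k25 andbT; move: kgt1; clear; lra.
    apply: low_5_2 => //.
    by apply: vertex_bound_right; rewrite (ltW k25).
(* Beyond 3.5 the trivial bound [4 (4 - k)] is below 2, and it is enough that the target [M] is at
   least 1. *)
apply: Or44; have [k35|k35] := leP k (35 / 10); [left|right].
  apply: low_5_2 => //; first by move: kqq0; clear; lra.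
  by apply: generic_bound; rewrite (ltW k3).
have [l2 u2] := andP (@ln2_bounds R).
have lk : ln k <= 138 / 10 ^+ 2 + 63 / 10 ^+ 4.
  apply: (@le_trans _ _ (ln 4)); first by rewrite ler_ln ?posrE// ltW.
  by rewrite ln4; move: u2; clear; lra.
apply: (@le_trans _ _ 2); first by move: k35; clear; lra.
apply: (optimum_lower c0 c1 cE k04 lk) => //.
rewrite /ideal_lower.
have e1 : 0 <= k ^+ 2 * (4 - k) by rewrite mulr_ge0 ?sqr_ge0// ltW.
have e2 : 0 <= (k - 35 / 10) ^+ 2 by exact: sqr_ge0.
by move: e1 e2 k35; clear; lra.
Qed.

Let kq_le1 k : 0 < k -> k <= 10^-1 -> k * (4 - k) <= 1.
Proof. by move=> k0 k1; have := sqr_ge0 k; rewrite expr2; lra. Qed.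

Let crit_le c k : 0 < c -> c * (4 - c) ^+ 2 = 1 -> c <= k -> k <= 10^-1 ->
  1 <= k * (4 - k) ^+ 2.
Proof.
move=> c0 cE ck k1; rewrite -{1}cE -subr_ge0.
rewrite [leRHS](_ : _ = (k - c) * ((4 - k) ^+ 2 - c * (8 - k - c))); last by ring.
rewrite mulr_ge0 ?subr_ge0//.
have : 0 <= c * (k + c) by rewrite mulr_ge0 ?addr_ge0 ?(ltW c0)// (le_trans (ltW c0)).
by have := sqr_ge0 k; lra.
Qed.

Section Bound.
Variables (c k u0 u1 u2 u3 : R).
Hypotheses (c0 : 0 < c) (c1 : c < 10^-1) (cE : c * (4 - c) ^+ 2 = 1).
Hypotheses (k0 : 0 < k) (k4 : k < 4).
Hypotheses (h0 : 0 <= u0 <= 1) (h1 : 0 <= u1 <= 1) (h2 : 0 <= u2 <= 1)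
  (h3 : 0 <= u3 <= 1).
Hypotheses (b03 : (4 - k) ^+ 2 * (u0 * u3) <= 1) (b12 : (4 - k) ^+ 2 * (u1 * u2) <= 1).
Hypotheses (a01 : k * (4 - k) ^+ 2 * (u0 * u1) <= 1) (a02 : k * (4 - k) ^+ 2 * (u0 * u2) <= 1)
  (a13 : k * (4 - k) ^+ 2 * (u1 * u3) <= 1) (a23 : k * (4 - k) ^+ 2 * (u2 * u3) <= 1).

Let M := max_density c * ideal_integral k.

Let k04 : 0 < k < 4. Proof. by rewrite k0. Qed.
Let q0 : 0 < 4 - k. Proof. by rewrite subr_gt0. Qed.

Lemma sum_le_optimum : (4 - k) * (u0 + u1 + u2 + u3) <= 2 * M.
Proof.
have [kc|/ltW ck] := leP k c.
  apply: (le_trans (sum_le_pairs k4 h0 h1 h2 h3 b03 b12)).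
  by rewrite ler_pM2l//; exact: optimum_left.
have [k1|k1] := leP k 10^-1.
  apply: sum_le_small => //; last exact: optimum_right.
  - exact: kq_le1.
  - exact: (crit_le c0 cE).
have [[*]|[*]|[*]|[?|hM]] := optimum_regions c0 c1 cE k1 k4.
- exact: sum_le_small.
- exact: sum_le_medium.
- exact: sum_le_large.
- exact: sum_le_generic.
- exact: (le_trans (sum_le_four k4 h0 h1 h2 h3)).
Qed.

End Bound.
End Optimum.

(** * Tetrahedra with a plane of symmetry *)

Section IdealTetrahedra.
Context {R : realType}.
Implicit Types (e f p : pt3 R).

Definition ideal4 e0 e1 e2 e3 : Prop :=
  [/\ dot e0 e0 = 1, dot e1 e1 = 1, dot e2 e2 = 1, dot e3 e3 = 1
    & vol4 e0 e1 e2 e3 != 0].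

(* Holds when a reflection swaps [e1] and [e2] and fixes [e0] and [e3]. *)
Definition kite e0 e1 e2 e3 : Prop :=
  chord e0 e1 * chord e2 e3 = chord e0 e2 * chord e1 e3.

(** The modulus of a cross ratio of the four ideal points: each vertex occurs once above and once
    below, so rescalings of the null vectors cancel. *)
Definition kite_ratio e0 e1 e2 e3 : R :=
  chord e0 e3 * chord e1 e2 / (chord e0 e1 * chord e2 e3).

Lemma chordE e f : dot e e = 1 -> dot f f = 1 -> chord e f = dot (e - f) (e - f) / 2.
Proof.
move=> he hf; have -> : dot (e - f) (e - f) = dot e e + dot f f - 2 * dot e f.
  by rewrite /dot /=; ring.
by rewrite he hf /chord; field.
Qed.

Lemma chord_ge0 e f : dot e e = 1 -> dot f f = 1 -> 0 <= chord e f.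
Proof. by move=> he hf; rewrite chordE// divr_ge0// dot_ge0. Qed.

Lemma chord_eq0 e f : dot e e = 1 -> dot f f = 1 -> chord e f = 0 -> e = f.
Proof.
move=> he hf; rewrite chordE// => /eqP; rewrite mulf_eq0 invr_eq0 pnatr_eq0 orbF.
by move=> /eqP/dot_eq0/eqP; rewrite subr_eq0 => /eqP.
Qed.

Lemma det3_mul (A B C A' B' C' : pt3 R) : det3 A B C * det3 A' B' C' =
  det3 (dot A A', dot A B', dot A C') (dot B A', dot B B', dot B C')
       (dot C A', dot C B', dot C C').
Proof. by rewrite /det3 /dot /=; ring. Qed.

Lemma vol4E e0 e1 e2 e3 : vol4 e0 e1 e2 e3 =
  det3 e0 e2 e3 - det3 e1 e2 e3 - det3 e0 e1 e3 + det3 e0 e1 e2.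
Proof. by rewrite /vol4 /det3 /=; ring. Qed.

Lemma det3_relation (e0 e1 e2 e3 f : pt3 R) :
  det3 e1 e2 e3 * dot e0 f - det3 e0 e2 e3 * dot e1 f
  + det3 e0 e1 e3 * dot e2 f - det3 e0 e1 e2 * dot e3 f = 0.
Proof. by rewrite /det3 /dot; ring. Qed.

Section Klein.
Variables e0 e1 e2 e3 : pt3 R.

(** The double transpositions act transitively on the vertices and preserve the hull, [vol4], [kite]
    and [kite_ratio]; results about [e0] thereby apply to every vertex. *)
Lemma vol4_1032 : vol4 e1 e0 e3 e2 = vol4 e0 e1 e2 e3.
Proof. by rewrite /vol4 /det3 /=; ring. Qed.
Lemma vol4_2301 : vol4 e2 e3 e0 e1 = vol4 e0 e1 e2 e3.
Proof. by rewrite /vol4 /det3 /=; ring. Qed.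
Lemma vol4_3210 : vol4 e3 e2 e1 e0 = vol4 e0 e1 e2 e3.
Proof. by rewrite /vol4 /det3 /=; ring. Qed.

Let hull4_sub f0 f1 f2 f3 g0 g1 g2 g3 :
  (forall w0 w1 w2 w3, [/\ 0 <= w0, 0 <= w1, 0 <= w2 & 0 <= w3] ->
     w0 + w1 + w2 + w3 = 1 -> hull4 g0 g1 g2 g3 (bary f0 f1 f2 f3 w0 w1 w2 w3)) ->
  hull4 f0 f1 f2 f3 `<=` hull4 g0 g1 g2 g3.
Proof. by move=> H p [w0 [w1 [w2 [w3 [w0123 [ws ->]]]]]]; exact: H. Qed.

Let hull4_1032_sub f0 f1 f2 f3 : hull4 f0 f1 f2 f3 `<=` hull4 f1 f0 f3 f2.
Proof.
apply: hull4_sub => w0 w1 w2 w3 [? ? ? ?] ws; exists w1, w0, w3, w2; split => //.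
by split; [rewrite -ws; ring | rewrite /bary; apply: pt3P; rewrite /= /GRing.scale/=; ring].
Qed.

Let hull4_2301_sub f0 f1 f2 f3 : hull4 f0 f1 f2 f3 `<=` hull4 f2 f3 f0 f1.
Proof.
apply: hull4_sub => w0 w1 w2 w3 [? ? ? ?] ws; exists w2, w3, w0, w1; split => //.
by split; [rewrite -ws; ring | rewrite /bary; apply: pt3P; rewrite /= /GRing.scale/=; ring].
Qed.

Lemma hull4_1032 : hull4 e1 e0 e3 e2 = hull4 e0 e1 e2 e3.
Proof. by apply/seteqP; split; exact: hull4_1032_sub. Qed.

Lemma hull4_2301 : hull4 e2 e3 e0 e1 = hull4 e0 e1 e2 e3.
Proof. by apply/seteqP; split; exact: hull4_2301_sub. Qed.

End Klein.

Lemma hull4_3210 e0 e1 e2 e3 : hull4 e3 e2 e1 e0 = hull4 e0 e1 e2 e3.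
Proof. by rewrite -hull4_1032 hull4_2301 -hull4_1032 hull4_1032. Qed.

Lemma ideal4_1032 e0 e1 e2 e3 : ideal4 e0 e1 e2 e3 -> ideal4 e1 e0 e3 e2.
Proof. by case=> *; split => //; rewrite vol4_1032. Qed.
Lemma ideal4_2301 e0 e1 e2 e3 : ideal4 e0 e1 e2 e3 -> ideal4 e2 e3 e0 e1.
Proof. by case=> *; split => //; rewrite vol4_2301. Qed.
Lemma ideal4_3210 e0 e1 e2 e3 : ideal4 e0 e1 e2 e3 -> ideal4 e3 e2 e1 e0.
Proof. by case=> *; split => //; rewrite vol4_3210. Qed.

Lemma kite_1032 e0 e1 e2 e3 : kite e0 e1 e2 e3 -> kite e1 e0 e3 e2.
Proof. by rewrite /kite (chordC e1 e0) (chordC e3 e2) => ->; rewrite mulrC. Qed.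
Lemma kite_2301 e0 e1 e2 e3 : kite e0 e1 e2 e3 -> kite e2 e3 e0 e1.
Proof. by rewrite /kite (chordC e2 e0) (chordC e3 e1) mulrC. Qed.
Lemma kite_3210 e0 e1 e2 e3 : kite e0 e1 e2 e3 -> kite e3 e2 e1 e0.
Proof. by move=> /kite_2301/kite_1032. Qed.

Lemma kite_ratio_1032 e0 e1 e2 e3 : kite_ratio e1 e0 e3 e2 = kite_ratio e0 e1 e2 e3.
Proof.
by rewrite /kite_ratio (chordC e1 e0) (chordC e3 e2) [chord e1 e2 * _]mulrC.
Qed.
Lemma kite_ratio_2301 e0 e1 e2 e3 : kite_ratio e2 e3 e0 e1 = kite_ratio e0 e1 e2 e3.
Proof.
rewrite /kite_ratio (chordC e2 e1) (chordC e3 e0) [_ * chord e0 e3]mulrC.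
by rewrite [chord e2 e3 * _]mulrC.
Qed.
Lemma kite_ratio_3210 e0 e1 e2 e3 : kite_ratio e3 e2 e1 e0 = kite_ratio e0 e1 e2 e3.
Proof. by rewrite kite_ratio_1032 kite_ratio_2301. Qed.

Section Ideal4.
Variables e0 e1 e2 e3 : pt3 R.
Hypothesis h : ideal4 e0 e1 e2 e3.
Local Notation N01 := (chord e0 e1).
Local Notation N02 := (chord e0 e2).
Local Notation N03 := (chord e0 e3).
Local Notation N12 := (chord e1 e2).
Local Notation N13 := (chord e1 e3).
Local Notation N23 := (chord e2 e3).

Let h0 : dot e0 e0 = 1. Proof. by case: h. Qed.
Let h1 : dot e1 e1 = 1. Proof. by case: h. Qed.
Let h2 : dot e2 e2 = 1. Proof. by case: h. Qed.
Let h3 : dot e3 e3 = 1. Proof. by case: h. Qed.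
Let d0 : vol4 e0 e1 e2 e3 != 0. Proof. by case: h. Qed.

Let gt0 e f : dot e e = 1 -> dot f f = 1 -> (e = f -> vol4 e0 e1 e2 e3 = 0) ->
  0 < chord e f.
Proof.
move=> he hf H; rewrite lt_neqAle chord_ge0// andbT eq_sym.
by apply: contra d0 => /eqP/(chord_eq0 he hf)/H/eqP.
Qed.

Lemma ideal4_chord_gt0 :
  [/\ 0 < N01, 0 < N02, 0 < N03 & [/\ 0 < N12, 0 < N13 & 0 < N23]].
Proof.
by do 2?split; apply: gt0 => // ->; rewrite /vol4 /det3 /=; ring.
Qed.

(* Minus the Gram determinant of the Lorentz products of the vertices; [rel] below is
   the vanishing of the Gram determinant of four vectors of R^3. *)
Lemma vol4_sqr : vol4 e0 e1 e2 e3 ^+ 2 =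
  2 * (N01 * N23) * (N02 * N13) + 2 * (N01 * N23) * (N03 * N12)
  + 2 * (N02 * N13) * (N03 * N12)
  - (N01 * N23) ^+ 2 - (N02 * N13) ^+ 2 - (N03 * N12) ^+ 2.
Proof.
pose D0 := det3 e1 e2 e3; pose D1 := det3 e0 e2 e3.
pose D2 := det3 e0 e1 e3; pose D3 := det3 e0 e1 e2.
have rel : D3 * D0 * dot e0 e3 - D3 * D1 * dot e1 e3 + D3 * D2 * dot e2 e3 - D3 * D3 = 0.
  rewrite -(mulr0 D3) -(det3_relation e0 e1 e2 e3 e3) h3 -/D0 -/D1 -/D2 -/D3.
  by move: D0 D1 D2 D3 (dot e0 e3) (dot e1 e3) (dot e2 e3) => *; ring.
have -> : vol4 e0 e1 e2 e3 ^+ 2 = D1 * D1 + D0 * D0 + D2 * D2 + D3 * D3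
    - 2 * (D1 * D0) - 2 * (D1 * D2) + 2 * (D1 * D3) + 2 * (D0 * D2)
    - 2 * (D0 * D3) - 2 * (D2 * D3).
  by rewrite vol4E -/D0 -/D1 -/D2 -/D3; clear rel; move: D0 D1 D2 D3 => *; ring.
rewrite -[LHS]addr0 -[X in _ + X]rel /D0 /D1 /D2 /D3 !det3_mul.
rewrite h0 h1 h2 h3 (dotC e1 e0) (dotC e2 e0) (dotC e3 e0) (dotC e2 e1).
by rewrite (dotC e3 e1) (dotC e3 e2) /det3 /chord /=; ring.
Qed.

Lemma kite_ratio_gt0 : 0 < kite_ratio e0 e1 e2 e3.
Proof.
have [n01 n02 n03 [n12 n13 n23]] := ideal4_chord_gt0.
by apply: divr_gt0; exact: mulr_gt0.
Qed.

Hypothesis hk : kite e0 e1 e2 e3.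

(** With two equal products, [vol4_sqr] factors as [X (4 P - X)], where [X = N03 N12] and
    [P = N01 N23]; nondegeneracy makes it positive. *)
Lemma kite_ratio_lt4 : kite_ratio e0 e1 e2 e3 < 4.
Proof.
have [n01 n02 n03 [n12 n13 n23]] := ideal4_chord_gt0.
have P0 : 0 < N01 * N23 by exact: mulr_gt0.
rewrite /kite_ratio ltr_pdivrMr//.
have : 0 < vol4 e0 e1 e2 e3 ^+ 2 by rewrite exprn_even_gt0.
rewrite vol4_sqr -hk.
rewrite (_ : _ - _ = (N03 * N12) * (4 * (N01 * N23) - N03 * N12)); last by ring.
by rewrite pmulr_rgt0 ?mulr_gt0// subr_gt0.
Qed.

End Ideal4.
End IdealTetrahedra.

(** * Volume of a kite tetrahedron *)

Section KiteVolume.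
Context {R : realType}.

Let subst_kernel (t x : R) := t / (1 - x + t * x) ^+ 2.

Let den_gt0 (t x : R) : 0 < t -> 0 <= x <= 1 -> 0 < 1 - x + t * x.
Proof.
move=> t0 /andP[x0 x1]; have [->|x1'] := eqVneq x 1.
  by rewrite subrr add0r mulr1.
by apply: ltr_wpDr; rewrite ?mulr_ge0 ?(ltW t0)// subr_gt0 lt_neqAle x1'.
Qed.

Let quad01 (k x : R) : 0 < k < 4 -> 0 < x < 1 -> 0 < k * (x * (1 - x)) < 1.
Proof.
move=> /andP[k0 k4] /andP[x0 x1]; rewrite !mulr_gt0 ?subr_gt0//=.
apply: (@le_lt_trans _ _ (k * 4^-1)); last by lra.
by rewrite ler_pM2l//; have := sqr_ge0 (x - 2^-1); rewrite expr2; lra.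
Qed.

(** The substitution is the projective map of [[0, 1]] that fixes the end points and has derivative
    [t] at 0. *)
Lemma ideal_integral_subst (k t : R) : 0 < k < 4 -> 0 < t ->
  (\int[leb R]_(x in `]0%R, 1%R[)
    (ln_ratio (k * (t * x / (1 - x + t * x) * (1 - t * x / (1 - x + t * x))))
      * (t / (1 - x + t * x) ^+ 2))%:E)%E = (ideal_integral k)%:E.
Proof.
move=> k04 t0; rewrite -ideal_integral_fin//.
pose h (x : R) := t * x / (1 - x + t * x).
have den x : x \in `[0, 1] -> 0 < 1 - x + t * x.
  by rewrite in_itv/=; exact: den_gt0.
rewrite (@ge0_substitution01 _ h (subst_kernel t)
  (fun x => ln_ratio (k * (x * (1 - x)))))//.
- by rewrite /h mulr0 mul0r.
- by rewrite /h subrr add0r divff// mulr1 gt_eqF.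
- move=> x y xi yi xy; have dx := den _ xi; have dy := den _ yi.
  rewrite /h ltr_pdivrMr// mulrAC ltr_pdivlMr// -subr_gt0.
  by rewrite (_ : _ - _ = t * (y - x)) ?mulr_gt0 ?subr_gt0//; ring.
- move=> x /den dx; rewrite /h /subst_kernel; der_eq; first by rewrite gt_eqF.
  by rewrite /=; field; rewrite gt_eqF.
- move=> x /den dx.
  have [q dq] : exists q, is_derive (x : R) (1 : R) (subst_kernel t) q.
    by rewrite /subst_kernel; eexists; der; rewrite expf_neq0// gt_eqF.
  exact: is_derive_continuous dq.
- move=> x xi; rewrite /subst_kernel divr_ge0 ?(ltW t0)//; exact: sqr_ge0.
- by move=> x; rewrite in_itv/= => x01; apply: ln_ratio_ge0; exact: quad01.
- by move=> x; rewrite in_itv/= => x01; exact: continuous_integrand.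
Qed.

Variables e0 e1 e2 e3 : pt3 R.
Hypotheses (h : ideal4 e0 e1 e2 e3) (hk : kite e0 e1 e2 e3).
Local Notation N01 := (chord e0 e1).
Local Notation N02 := (chord e0 e2).
Local Notation N03 := (chord e0 e3).
Local Notation N12 := (chord e1 e2).
Local Notation N13 := (chord e1 e3).
Local Notation N23 := (chord e2 e3).
Local Notation k := (kite_ratio e0 e1 e2 e3).

(** The kite relation says [N01 / N02 = N13 / N23 = t], so both affine factors are multiples of
    [1 - x + t x]. The projective reparametrisation of the edge [e1 e2] with this [t] reduces the
    integrand to one depending on [k] alone. *)
Lemma hyp_vol_kite : hyp_vol (hull4 e0 e1 e2 e3) =
  `|vol4 e0 e1 e2 e3| / (4 * (N01 * N23)) * ideal_integral k.
Proof.
have [h0 h1 h2 h3 d0] := h.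
have [n01 n02 n03 [n12 n13 n23]] := ideal4_chord_gt0 h.
have k04 : 0 < k < 4 by rewrite kite_ratio_gt0//= kite_ratio_lt4.
pose t := N01 / N02.
have t0 : 0 < t by exact: divr_gt0.
have e01 : N01 = t * N02 by rewrite /t divfK// gt_eqF.
have e13 : N13 = t * N23.
  by apply: (mulfI (_ : N02 != 0)); rewrite ?gt_eqF// -hk e01; ring.
pose hx (x : R) := t * x / (1 - x + t * x).
have den (x : R) : 0 < x < 1 -> 0 < 1 - x + t * x.
  by case/andP=> x0 x1; apply: den_gt0; rewrite ?(ltW x0)// ltW.
have hx01 (x : R) : 0 < x < 1 -> 0 < hx x < 1.
  move=> x01; have dx := den _ x01; have /andP[x0 x1] := x01.
  apply/andP; split; first by apply: divr_gt0 => //; exact: mulr_gt0.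
  by rewrite /hx ltr_pdivrMr// mul1r ltrDr subr_gt0.
have XE (x : R) : (N01 * x + N02 * (1 - x)) * (N13 * x + N23 * (1 - x)) =
    N02 * N23 * (1 - x + t * x) ^+ 2.
  by rewrite e01 e13; ring.
have YE (x : R) : 0 < x < 1 -> N03 * (N12 * x * (1 - x)) =
    k * (hx x * (1 - hx x)) * (N02 * N23 * (1 - x + t * x) ^+ 2).
  move=> x01; have dx := den _ x01; rewrite /kite_ratio /hx e01.
  by field; rewrite !gt_eqF//= ?mulr_gt0.
have X0 (x : R) : 0 < x < 1 -> 0 < N02 * N23 * (1 - x + t * x) ^+ 2.
  by move=> /den dx; rewrite mulr_gt0 ?exprn_gt0 ?mulr_gt0.
have lt1 (x : R) : 0 < x < 1 -> 0 < k * (hx x * (1 - hx x)) < 1.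
  by move=> /hx01; exact: quad01.
rewrite (hyp_vol_ideal_hull h0 h1 h2 h3 d0)//; last first.
  move=> x x01; rewrite XE YE// gtr_pMl ?X0//.
  by case/andP: (lt1 _ x01).
rewrite (_ : (\int[_]_(x in _) _)%E = ((4 * (N01 * N23))^-1 * ideal_integral k)%:E).
  by rewrite -EFinM /= -[RHS]mulrA.
rewrite EFinM -(ideal_integral_subst k04 t0) -ge0_integralZl_EFin//.
- apply: eq_integral => x; rewrite inE/= in_itv/= => x01.
  have dx := den _ x01; have X0x := X0 _ x01; have /andP[y0 y1] := lt1 _ x01.
  rewrite XE YE// -EFinM -/(hx x); congr EFin.
  move: (k * (hx x * (1 - hx x))) y0 y1 => y y0 y1.
  have -> : N02 * N23 * (1 - x + t * x) ^+ 2 / (y * (N02 * N23 * (1 - x + t * x) ^+ 2)) = y^-1.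
    by field; rewrite !gt_eqF.
  rewrite lnV ?posrE// /ln_ratio -[X in _ / (X - _)]mul1r -mulrBl e01.
  have y1' : 0 < 1 - y by rewrite subr_gt0.
  by field; rewrite !gt_eqF.
- move=> x; rewrite /= in_itv/= => x01; have dx := den _ x01.
  rewrite lee_fin; apply: mulr_ge0; last by apply: divr_ge0; [exact: ltW|exact: sqr_ge0].
  by apply: ln_ratio_ge0; exact: lt1.
- apply/measurable_EFinP; apply: open_continuous_measurable_fun => // x.
  rewrite inE/= in_itv/= => x01; have dx := den _ x01.
  have /andP[y0 y1] := lt1 _ x01; rewrite /hx in y0 y1.
  have [q dq] : exists q, is_derive x (1 : R) (fun x : R =>
      ln_ratio (k * (t * x / (1 - x + t * x) * (1 - t * x / (1 - x + t * x))))
      * (t / (1 - x + t * x) ^+ 2)) q.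
    by rewrite /ln_ratio; eexists; der; rewrite ?expf_neq0 ?gt_eqF ?subr_gt0.
  exact: is_derive_continuous dq.
- by rewrite invr_ge0 mulr_ge0// mulr_ge0// ltW.
Qed.

End KiteVolume.

(** * Tangency of a horoball and the opposite face plane *)

Section KiteFace.
Context {R : realType}.

(** [e1] with weight 0 fills the first slot of [bary], so the plane does not mention the opposite
    vertex; [plane3_bary] puts that vertex back. *)
Definition plane3 (e1 e2 e3 : pt3 R) : set (pt3 R) :=
  [set p | H3 p /\ exists w1 w2 w3 : R,
     w1 + w2 + w3 = 1 /\ p = bary e1 e1 e2 e3 0 w1 w2 w3].

(* The radius at which a horoball at [e0] touches the plane of [e1, e2, e3]. *)
Definition kite_crit (e0 e1 e2 e3 : pt3 R) : R :=
  (4 - kite_ratio e0 e1 e2 e3) * (chord e0 e1 * chord e0 e2 * chord e0 e3)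
  / (2 * (chord e0 e1 * chord e2 e3)).

Lemma quad_gt0_near0 (a b c : R) : 0 < a ->
  exists2 t : R, 0 < t < 1 & 0 < a + b * t + c * t ^+ 2.
Proof.
move=> a0; pose M := a + `|b| + `|c|.
have nb := normr_ge0 b; have nc := normr_ge0 c.
have M0 : 0 < M by rewrite /M -addrA ltr_pwDl// addr_ge0.
have t0 : 0 < a / (2 * M) by rewrite divr_gt0// mulr_gt0.
have tM : a / (2 * M) * M = a / 2 by field; rewrite gt_eqF.
have t1 : a / (2 * M) < 1.
  by rewrite -(ltr_pM2r M0) tM mul1r /M; lra.
exists (a / (2 * M)); first by rewrite t0.
set t := a / (2 * M) in t0 tM t1 *.
have hb : - `|b| * t <= b * t by rewrite ler_pM2r// lerNl ler_normr lexx orbT.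
have hc : - `|c| * t <= c * t ^+ 2.
  apply: (@le_trans _ _ (- `|c| * t ^+ 2)).
    rewrite !mulNr lerN2 expr2 mulrA ler_piMr ?(ltW t1)//.
    by rewrite mulr_ge0// ltW.
  by rewrite ler_wpM2r ?sqr_ge0// lerNl ler_normr lexx orbT.
have : (`|b| + `|c|) * t <= M * t.
  by rewrite ler_pM2r// /M -addrA lerDr ltW.
rewrite mulrC in tM.
lra.
Qed.

Lemma plane3_bary (e0 e1 e2 e3 : pt3 R) w1 w2 w3 :
  bary e1 e1 e2 e3 0 w1 w2 w3 = bary e0 e1 e2 e3 0 w1 w2 w3.
Proof. by rewrite /bary !scale0r. Qed.

Variables e0 e1 e2 e3 : pt3 R.
Hypotheses (h : ideal4 e0 e1 e2 e3) (hk : kite e0 e1 e2 e3).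
Local Notation N01 := (chord e0 e1).
Local Notation N02 := (chord e0 e2).
Local Notation N03 := (chord e0 e3).
Local Notation N12 := (chord e1 e2).
Local Notation N13 := (chord e1 e3).
Local Notation N23 := (chord e2 e3).
Local Notation k := (kite_ratio e0 e1 e2 e3).
Local Notation crit := (kite_crit e0 e1 e2 e3).

Let n01 : 0 < N01. Proof. by have [] := ideal4_chord_gt0 h. Qed.
Let n02 : 0 < N02. Proof. by have [] := ideal4_chord_gt0 h. Qed.
Let n03 : 0 < N03. Proof. by have [] := ideal4_chord_gt0 h. Qed.
Let n12 : 0 < N12. Proof. by have [_ _ _ []] := ideal4_chord_gt0 h. Qed.
Let n13 : 0 < N13. Proof. by have [_ _ _ []] := ideal4_chord_gt0 h. Qed.
Let n23 : 0 < N23. Proof. by have [_ _ _ []] := ideal4_chord_gt0 h. Qed.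
Let k0 : 0 < k. Proof. exact: kite_ratio_gt0. Qed.
Let q0 : 0 < 4 - k. Proof. by rewrite subr_gt0 kite_ratio_lt4. Qed.

Let N13E : N13 = N01 * N23 / N02.
Proof. by rewrite hk mulrAC divff ?mul1r// gt_eqF. Qed.

Let N12E : N12 = k * (N01 * N23) / N03.
Proof. by rewrite /kite_ratio; field; rewrite !gt_eqF. Qed.

Lemma kite_crit_gt0 : 0 < crit.
Proof. by rewrite /kite_crit divr_gt0 ?mulr_gt0. Qed.

Definition face_dist (w1 w2 w3 : R) := w1 * N01 + w2 * N02 + w3 * N03.
Definition face_form (w1 w2 w3 : R) := 2 * (w1 * w2 * N12 + w1 * w3 * N13 + w2 * w3 * N23).

(* In the coordinates [v_i = w_i * chord e0 e_i] the squared distance minus the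
   critical multiple of the form is a sum of squares. *)
Lemma face_form_sos w1 w2 w3 :
  face_dist w1 w2 w3 ^+ 2 - crit * face_form w1 w2 w3 =
  (w3 * N03 - (w1 * N01 + w2 * N02) * (2 - k) / 2) ^+ 2
  + k * (4 - k) / 4 * (w1 * N01 - w2 * N02) ^+ 2.
Proof.
rewrite /face_dist /face_form /kite_crit N13E N12E; move: k k0 => c c0.
by field; rewrite !gt_eqF.
Qed.

Lemma face_dist_ge w1 w2 w3 : crit * face_form w1 w2 w3 <= face_dist w1 w2 w3 ^+ 2.
Proof.
rewrite -subr_ge0 face_form_sos addr_ge0 ?sqr_ge0// mulr_ge0 ?sqr_ge0//.
by rewrite divr_ge0// mulr_ge0// ltW.
Qed.

Let unit0 : dot e0 e0 = 1. Proof. by case: h. Qed.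
Let unit1 : dot e1 e1 = 1. Proof. by case: h. Qed.
Let unit2 : dot e2 e2 = 1. Proof. by case: h. Qed.
Let unit3 : dot e3 e3 = 1. Proof. by case: h. Qed.

Let pt w1 w2 w3 := bary e1 e1 e2 e3 0 w1 w2 w3.

Let ptE w1 w2 w3 : w1 + w2 + w3 = 1 ->
  chord e0 (pt w1 w2 w3) = face_dist w1 w2 w3 /\
  1 - dot (pt w1 w2 w3) (pt w1 w2 w3) = face_form w1 w2 w3.
Proof.
move=> ws; have ws' : 0 + w1 + w2 + w3 = 1 by rewrite add0r.
rewrite /pt (plane3_bary e0); split.
  by rewrite chord_bary// /face_dist mul0r add0r.
by rewrite chord_self_bary// /face_form; ring.
Qed.

(** Both squares in [face_form_sos] vanish at [v1 = v2 = 1], [v3 = 2 - k], and this is the sum of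
    the corresponding weights. For [k > 2] the third weight is negative and the tangent point lies
    outside the triangle, so positivity of the sum needs an argument. *)
Let optimal_sum := N01^-1 + N02^-1 + (2 - k) / N03.

Let optimal_dist : face_dist N01^-1 N02^-1 ((2 - k) / N03) = 4 - k.
Proof. by rewrite /face_dist !mulVf ?divfK ?gt_eqF//; ring. Qed.

Let optimal_form : crit * face_form N01^-1 N02^-1 ((2 - k) / N03) = (4 - k) ^+ 2.
Proof.
apply/esym/eqP; rewrite -subr_eq0 -{1}optimal_dist face_form_sos; apply/eqP.
by rewrite !mulVf ?divfK ?gt_eqF//; field.
Qed.

(* The sum is the time coordinate of a future timelike vector. *)
Let optimal_sum_gt0 : 0 < optimal_sum.
Proof.
pose X := bary e0 e1 e2 e3 0 N01^-1 N02^-1 ((2 - k) / N03).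
set w1 := N01^-1; set w2 := N02^-1; set w3 := (2 - k) / N03.
have QE : optimal_sum ^+ 2 - dot X X = face_form w1 w2 w3.
  rewrite /X dot_bary !(dotC (bary _ _ _ _ _ _ _ _)) !dot_bary unit1 unit2 unit3.
  rewrite /face_form /chord /optimal_sum (dotC e2 e1) (dotC e3 e1) (dotC e3 e2).
  by rewrite -/w1 -/w2 -/w3; ring.
have NE : optimal_sum - dot e0 X = 4 - k.
  rewrite -optimal_dist /X dot_bary /face_dist /chord /optimal_sum.
  by rewrite -/w1 -/w2 -/w3; ring.
have Q0 : 0 < face_form w1 w2 w3.
  by rewrite -(pmulr_rgt0 _ kite_crit_gt0) optimal_form exprn_gt0.
rewrite ltNge; apply/negP => W0.
have cs := dot_cauchy X unit0.
have : (dot e0 X - optimal_sum) * (- (dot e0 X + optimal_sum)) > 0.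
  rewrite (_ : _ * _ = optimal_sum ^+ 2 - dot e0 X ^+ 2); last by ring.
  by apply: lt_le_trans Q0 _; rewrite -QE lerB.
have : dot e0 X - optimal_sum < 0 by rewrite -opprB NE oppr_lt0.
move=> hneg; rewrite nmulr_rgt0// oppr_lt0 => hpos.
have := q0; rewrite -NE; lra.
Qed.

Let o1 := N01^-1 / optimal_sum.
Let o2 := N02^-1 / optimal_sum.
Let o3 := (2 - k) / N03 / optimal_sum.

Let osum : o1 + o2 + o3 = 1.
Proof. by rewrite /o1 /o2 /o3 -!mulrDl divff// gt_eqF. Qed.

Let odist : face_dist o1 o2 o3 = (4 - k) / optimal_sum.
Proof. by rewrite -optimal_dist /face_dist /o1 /o2 /o3; ring. Qed.

Let oform : crit * face_form o1 o2 o3 = face_dist o1 o2 o3 ^+ 2.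
Proof.
rewrite odist expr_div_n -optimal_form /face_form /o1 /o2 /o3.
by rewrite -exprVn; ring.
Qed.

Let oform_gt0 : 0 < face_form o1 o2 o3.
Proof.
by rewrite -(pmulr_rgt0 _ kite_crit_gt0) oform exprn_gt0 ?odist ?divr_gt0.
Qed.

Let pt_H3 w1 w2 w3 : w1 + w2 + w3 = 1 -> 0 < face_form w1 w2 w3 ->
  plane3 e1 e2 e3 (pt w1 w2 w3).
Proof.
move=> ws Q0; have [_ QE] := ptE ws.
by split; [rewrite /H3/= -subr_gt0 QE | exists w1, w2, w3].
Qed.

Let face_eq w1 w2 w3 : w1 + w2 + w3 = 1 ->
  face_dist w1 w2 w3 ^+ 2 <= crit * face_form w1 w2 w3 ->
  [/\ w1 = o1, w2 = o2 & w3 = o3].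
Proof.
move=> ws; rewrite -subr_le0 face_form_sos => le0.
have s1 := sqr_ge0 (w3 * N03 - (w1 * N01 + w2 * N02) * (2 - k) / 2).
have s2 := sqr_ge0 (w1 * N01 - w2 * N02).
have kq0 : 0 < k * (4 - k) / 4 by apply: divr_gt0 => //; exact: mulr_gt0.
have s2' : 0 <= k * (4 - k) / 4 * (w1 * N01 - w2 * N02) ^+ 2 by rewrite mulr_ge0// ltW.
have /eqP : (w1 * N01 - w2 * N02) ^+ 2 = 0.
  apply/eqP; rewrite eq_le s2 andbT -(pmulr_rle0 _ kq0); lra.
rewrite sqrf_eq0 subr_eq0 => /eqP v12.
have /eqP : (w3 * N03 - (w1 * N01 + w2 * N02) * (2 - k) / 2) ^+ 2 = 0.
  by apply/eqP; rewrite eq_le s1 andbT; lra.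
rewrite sqrf_eq0 subr_eq0 -v12 => /eqP v3.
have e1' : w1 = w1 * N01 * N01^-1 by rewrite mulfK// gt_eqF.
have e2' : w2 = w1 * N01 * N02^-1 by rewrite v12 mulfK// gt_eqF.
have e3' : w3 = w1 * N01 * ((2 - k) / N03).
  by apply: (mulIf (_ : N03 != 0)); rewrite ?gt_eqF// v3; field; rewrite gt_eqF.
have vW : w1 * N01 = optimal_sum^-1.
  apply: (mulIf (_ : optimal_sum != 0)); first by rewrite gt_eqF.
  rewrite [RHS]mulVf ?gt_eqF//.
  transitivity (w1 * N01 * N01^-1 + w1 * N01 * N02^-1 + w1 * N01 * ((2 - k) / N03)).
    by rewrite /optimal_sum; ring.
  by rewrite -e3' -e2' -e1'.
by split; [rewrite e1' | rewrite e2' | rewrite e3']; rewrite vW mulrC.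
Qed.

Lemma face_unique s p : s <= crit -> horoball e0 s p -> plane3 e1 e2 e3 p ->
  p = pt o1 o2 o3 /\ s = crit.
Proof.
move=> sc [_ ps] [pH [w1 [w2 [w3 [ws pE]]]]].
have [NE QE] := ptE ws; rewrite -/(chord e0 p) pE NE QE in ps.
have Q0 : 0 < face_form w1 w2 w3 by rewrite -QE /pt -pE subr_gt0.
have hle : face_dist w1 w2 w3 ^+ 2 <= crit * face_form w1 w2 w3.
  by rewrite (le_trans ps)// ler_pM2r.
split; first by rewrite pE; have [-> -> ->] := face_eq ws hle.
apply/eqP; rewrite eq_le sc/= -(ler_pM2r Q0).
exact: le_trans (face_dist_ge _ _ _) ps.
Qed.

Lemma face_touch_point : horoball e0 crit (pt o1 o2 o3) /\ plane3 e1 e2 e3 (pt o1 o2 o3).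
Proof.
have hp := pt_H3 osum oform_gt0; split => //; split; first by case: hp.
by have [NE QE] := ptE osum; rewrite -/(chord e0 _) NE QE oform.
Qed.

(** For a larger radius the tangent point satisfies the horoball inequality strictly, so a short
    move from it towards [e1] yields a second common point. The two differ in their chord to [e1],
    which is [c] and [(1 - t) c] with [c > 0]. *)
Lemma face_unique_le s :
  (forall p q, (horoball e0 s `&` plane3 e1 e2 e3) p ->
     (horoball e0 s `&` plane3 e1 e2 e3) q -> p = q) -> s <= crit.
Proof.
move=> H; rewrite leNgt; apply/negP => cs.
have strict : 0 < s * face_form o1 o2 o3 - face_dist o1 o2 o3 ^+ 2.
  by rewrite -oform -mulrBl mulr_gt0// subr_gt0.
have s0 : 0 < s by exact: lt_trans kite_crit_gt0 cs.
set D := face_dist _ _ _ in strict; set F := face_form _ _ _ in strict.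
pose c := o2 * N12 + o3 * N13.
have c0 : 0 < c.
  have -> : c = 2 * (N01 * N23 / (N02 * N03)) / optimal_sum.
    rewrite /c /o2 /o3 N12E N13E; move: optimal_sum k optimal_sum_gt0 => W k' W0.
    by field; rewrite !gt_eqF.
  by rewrite !(divr_gt0, mulr_gt0).
have [t /andP[t0 t1]] := quad_gt0_near0 (s * (2 * c - 2 * F) - 2 * D * (N01 - D))
  (s * (F - 2 * c) - (N01 - D) ^+ 2) strict.
pose w1 := (1 - t) * o1 + t; pose w2 := (1 - t) * o2; pose w3 := (1 - t) * o3.
have -> : s * F - D ^+ 2 + (s * (2 * c - 2 * F) - 2 * D * (N01 - D)) * t
    + (s * (F - 2 * c) - (N01 - D) ^+ 2) * t ^+ 2 =
    s * face_form w1 w2 w3 - face_dist w1 w2 w3 ^+ 2.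
  by rewrite /face_form /face_dist /w1 /w2 /w3 /c /D /F /face_dist /face_form; ring.
move=> tpos.
have ws : w1 + w2 + w3 = 1.
  rewrite (_ : _ + w3 = (1 - t) * (o1 + o2 + o3) + t); last by rewrite /w1 /w2 /w3; ring.
  by rewrite osum; ring.
have in_both v1 v2 v3 : v1 + v2 + v3 = 1 ->
    0 < s * face_form v1 v2 v3 - face_dist v1 v2 v3 ^+ 2 ->
    (horoball e0 s `&` plane3 e1 e2 e3) (pt v1 v2 v3).
  move=> vs pos; have [NE QE] := ptE vs.
  have Q0 : 0 < face_form v1 v2 v3.
    rewrite -(pmulr_rgt0 _ s0); apply: le_lt_trans (sqr_ge0 (face_dist v1 v2 v3)) _.
    by rewrite -subr_gt0.
  have hp := pt_H3 vs Q0; split => //; split; first by case: hp.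
  by rewrite -/(chord e0 _) NE QE -subr_ge0 ltW.
have e : pt o1 o2 o3 = pt w1 w2 w3 by apply: H; exact: in_both.
have chE v1 v2 v3 : v1 + v2 + v3 = 1 -> chord e1 (pt v1 v2 v3) = v2 * N12 + v3 * N13.
  move=> vs; rewrite /pt chord_bary ?add0r//.
  by rewrite [chord e1 e1](_ : _ = 0) ?mulr0 ?add0r// /chord unit1 subrr.
have := congr1 (chord e1) e; rewrite !chE// -/c.
rewrite (_ : w2 * N12 + w3 * N13 = (1 - t) * c); last by rewrite /w2 /w3 /c; ring.
have : 0 < t * c by exact: mulr_gt0.
lra.
Qed.

Lemma face_touchP s : touches (horoball e0 s) (plane3 e1 e2 e3) <-> s = crit.
Proof.
split=> [[p tp]|->].
  have pp : (horoball e0 s `&` plane3 e1 e2 e3) p by rewrite tp.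
  have sc : s <= crit by apply: face_unique_le => x y; rewrite tp => -> ->.
  by case: pp => p1 p2; case: (face_unique sc p1 p2).
exists (pt o1 o2 o3); apply/seteqP; split=> [p [p1 p2]|_ ->]; last exact: face_touch_point.
by have [-> _] := face_unique (lexx _) p1 p2.
Qed.

Lemma hyp_vol_kite_horoball s : 0 < s -> s <= crit ->
  hyp_vol (horoball e0 s `&` hull4 e0 e1 e2 e3) =
  `|vol4 e0 e1 e2 e3| * (s / (4 * N01 * N02 * N03)).
Proof.
move=> s0 sc; apply: hyp_vol_horoball => //; first by case: h.
move=> w1 w2 w3 w10 w20 w30 _; apply: le_trans (face_dist_ge _ _ _).
by rewrite ler_wpM2r// /face_form mulr_ge0// !addr_ge0// !mulr_ge0// ltW.
Qed.

End KiteFace.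

(** * Tangency of horoballs *)

Section HoroballPairs.
Context {R : realType}.
Implicit Types (e f p q : pt3 R) (s t : R).

(* Gram determinant of the two ideal points and [p]: the component of
   [homog p] orthogonal to both is spacelike. *)
Lemma chord_product_ge e f p : dot e e = 1 -> dot f f = 1 -> 0 < chord e f ->
  chord e f * (1 - dot p p) <= 2 * (chord e p * chord f p).
Proof.
move=> he hf n0.
have := dot_cauchy (chord e f *: p - chord f p *: e - chord e p *: f) he.
rewrite -subr_ge0.
rewrite (_ : _ - _ = chord e f * (2 * (chord e p * chord f p) -
    chord e f * (1 - dot p p))); first by rewrite pmulr_rge0// subr_ge0.
set y := _ - _ - _.
have eyE : dot e y = chord e f - chord f p - chord e p.
  have -> : dot e y = chord e f * dot e p - chord f p * dot e e - chord e p * dot e f.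
    by rewrite /y /dot /= /GRing.scale/=; ring.
  by rewrite he /chord; ring.
have -> : dot y y = chord e f ^+ 2 * dot p p + chord f p ^+ 2 * dot e e
   + chord e p ^+ 2 * dot f f - 2 * chord e f * chord f p * dot e p
   - 2 * chord e f * chord e p * dot f p + 2 * chord f p * chord e p * dot e f.
  by rewrite /y /dot /= /GRing.scale/=; ring.
rewrite eyE he hf; have -> : dot e p = 1 - chord e p by rewrite /chord; ring.
have -> : dot f p = 1 - chord f p by rewrite /chord; ring.
have -> : dot e f = 1 - chord e f by rewrite /chord; ring.
ring.
Qed.

Section Pair.
Variables (e f : pt3 R) (s t : R).
Hypotheses (he : dot e e = 1) (hf : dot f f = 1) (n0 : 0 < chord e f).
Hypotheses (s0 : 0 < s) (t0 : 0 < t).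
Local Notation N := (chord e f).

Let chord_gt0 g p : dot g g = 1 -> H3 p -> 0 < chord g p.
Proof.
move=> hg pH; rewrite subr_gt0; have := dot_cauchy p hg => hc.
rewrite ltNge; apply/negP => h1.
have : 1 <= dot g p ^+ 2 by rewrite expr_ge1// (le_trans _ h1).
by move=> /le_trans/(_ hc); rewrite leNgt pH.
Qed.

Let meet_bound c p : H3 p -> 0 <= c ->
  chord e p ^+ 2 * chord f p ^+ 2 <= c * (1 - dot p p) ^+ 2 -> N ^+ 2 <= 4 * c.
Proof.
move=> pH c0 hle; have Q0 : 0 < 1 - dot p p by rewrite subr_gt0.
rewrite -(@ler_pM2r _ ((1 - dot p p) ^+ 2)) ?exprn_gt0// -exprMn.
apply: (@le_trans _ _ ((2 * (chord e p * chord f p)) ^+ 2)).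
  rewrite ler_sqr ?nnegrE; first exact: chord_product_ge.
    by rewrite mulr_ge0// ltW.
  by rewrite mulr_ge0// mulr_ge0// ltW// chord_gt0.
have -> : (2 * (chord e p * chord f p)) ^+ 2 = 4 * (chord e p ^+ 2 * chord f p ^+ 2).
  by ring.
by rewrite -[leRHS]mulrA ler_pM2l.
Qed.

(** The product of the two horoball inequalities bounds the chords of [p] from above,
    [chord_product_ge] from below. *)
Lemma horoball_meet p : horoball e s p -> horoball f t p -> N ^+ 2 <= 4 * s * t.
Proof.
move=> [pH pe] [_ pf]; rewrite -mulrA; apply: (meet_bound pH).
  by rewrite mulr_ge0// ltW.
rewrite [leRHS](_ : _ = s * (1 - dot p p) * (t * (1 - dot p p))); last by ring.
by apply: ler_pM => //; exact: sqr_ge0.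
Qed.

(* By strict concavity the midpoint lies in the interior of both horoballs. *)
Lemma horoball_meet2 p q : p <> q -> horoball e s p -> horoball f t p ->
  horoball e s q -> horoball f t q -> N ^+ 2 < 4 * s * t.
Proof.
move=> pq [pH pe] [_ pf] [qH qe] [_ qf].
pose m : pt3 R := 2^-1 *: (p + q).
have pq0 : 0 < dot (p - q) (p - q).
  rewrite lt_neqAle eq_sym dot_ge0 andbT; apply/eqP => /dot_eq0/eqP.
  by rewrite subr_eq0 => /eqP.
have Qm : 1 - dot m m = ((1 - dot p p) + (1 - dot q q)) / 2 + dot (p - q) (p - q) / 4.
  by rewrite /m /dot /= /GRing.scale/=; field.
have Np g : chord g m = (chord g p + chord g q) / 2.
  by rewrite /m /chord /dot /= /GRing.scale/=; field.
have Q0 : 0 < 1 - dot m m.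
  by rewrite Qm addr_gt0// ?divr_gt0// addr_gt0// subr_gt0.
have strict g r : 0 < r -> chord g p ^+ 2 <= r * (1 - dot p p) ->
    chord g q ^+ 2 <= r * (1 - dot q q) ->
    chord g m ^+ 2 <= r * (1 - dot m m - dot (p - q) (p - q) / 4).
  move=> r0 h1 h2; rewrite Np Qm addrK.
  by have := sqr_ge0 (chord g p - chord g q); rewrite !expr2 in h1 h2 *; lra.
have me := strict e s s0 pe qe; have mf := strict f t t0 pf qf.
pose d := (1 - dot m m - dot (p - q) (p - q) / 4) / (1 - dot m m).
have dE : 1 - dot m m - dot (p - q) (p - q) / 4 = d * (1 - dot m m).
  by rewrite /d divfK// gt_eqF.
have d1 : d < 1 by rewrite ltr_pdivrMr// mul1r gtrBl divr_gt0.
have d0 : 0 <= d.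
  by rewrite /d divr_ge0 ?(ltW Q0)// Qm addrK divr_ge0// addr_ge0// subr_ge0 ltW.
clearbody d; apply: (@le_lt_trans _ _ (4 * (s * d * (t * d)))).
  apply: (@meet_bound _ m); first by rewrite /H3/= -subr_gt0.
    by apply: mulr_ge0; apply: mulr_ge0 => //; exact: ltW.
  rewrite [leRHS](_ : _ = s * (d * (1 - dot m m)) * (t * (d * (1 - dot m m)))).
    by rewrite -dE; apply: ler_pM => //; exact: sqr_ge0.
  by ring.
rewrite (_ : 4 * _ = 4 * s * t * d ^+ 2); last by ring.
by rewrite gtr_pMr ?mulr_gt0// expr_lt1.
Qed.

(** The geodesic joining the two centres. Membership in either horoball is a one-sided bound on the
    ratio [a / b]. *)
Let arc a b : pt3 R := (a + b)^-1 *: (a *: e + b *: f).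

Let arcE a b : 0 < a -> 0 < b ->
  [/\ chord e (arc a b) = b * N / (a + b), chord f (arc a b) = a * N / (a + b)
    & 1 - dot (arc a b) (arc a b) = 2 * a * b * N / (a + b) ^+ 2].
Proof.
move=> a0 b0; have ab0 : a + b != 0 by rewrite gt_eqF// addr_gt0.
split.
- have -> : chord e (arc a b) = 1 - (a * dot e e + b * dot e f) / (a + b).
    by rewrite /arc /chord /dot /= /GRing.scale/=; field.
  by rewrite he /chord; field.
- have -> : chord f (arc a b) = 1 - (a * dot e f + b * dot f f) / (a + b).
    by rewrite /arc /chord /dot /= /GRing.scale/=; field.
  by rewrite hf /chord; field.
- have -> : dot (arc a b) (arc a b) =
      (a ^+ 2 * dot e e + 2 * a * b * dot e f + b ^+ 2 * dot f f) / (a + b) ^+ 2.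
    by rewrite /arc /dot /= /GRing.scale/=; field.
  by rewrite he hf /chord; field.
Qed.

Let arc_H3 a b : 0 < a -> 0 < b -> H3 (arc a b).
Proof.
move=> a0 b0; have [_ _ QE] := arcE a0 b0; rewrite /H3/= -subr_gt0 QE.
by rewrite divr_gt0 ?exprn_gt0 ?addr_gt0// !mulr_gt0.
Qed.

Let arc_in a b : 0 < a -> 0 < b -> b * N <= 2 * s * a -> a * N <= 2 * t * b ->
  horoball e s (arc a b) /\ horoball f t (arc a b).
Proof.
move=> a0 b0 h1 h2; have [ne nf QE] := arcE a0 b0.
have ab : 0 < (a + b) ^+ 2 by rewrite exprn_gt0 ?addr_gt0.
split; split; try exact: arc_H3.
- rewrite -/(chord _ _) ne QE expr_div_n mulrA ler_pM2r ?invr_gt0// expr2.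
  have : b * N * (b * N) <= 2 * s * a * (b * N) by rewrite ler_pM2r// mulr_gt0.
  lra.
- rewrite -/(chord _ _) nf QE expr_div_n mulrA ler_pM2r ?invr_gt0// expr2.
  have : a * N * (a * N) <= 2 * t * b * (a * N) by rewrite ler_pM2r// mulr_gt0.
  lra.
Qed.

Lemma horoball_touchP : touches (horoball e s) (horoball f t) <-> N ^+ 2 = 4 * s * t.
Proof.
have ss : 0 < 2 * s by rewrite mulr_gt0.
have tt : 0 < 2 * t by rewrite mulr_gt0.
split=> [[p tp]|hN].
  have [p1 p2] : (horoball e s `&` horoball f t) p by rewrite tp.
  have hle := horoball_meet p1 p2; apply/eqP; rewrite eq_le hle/= leNgt.
  apply/negP => hlt.
  (* These are the points where the geodesic crosses the two horospheres. If [N ^ 2 < 4 s t], both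
     lie in the intersection, and their coincidence would force equality. *)
  have in1 := @arc_in N (2 * s) n0 ss; have in2 := @arc_in (2 * t) N tt n0.
  have q1 : arc N (2 * s) = p.
    suff : (horoball e s `&` horoball f t) (arc N (2 * s)) by rewrite tp.
    by apply: in1 => //; lra.
  have q2 : arc (2 * t) N = p.
    suff : (horoball e s `&` horoball f t) (arc (2 * t) N) by rewrite tp.
    by apply: in2 => //; lra.
  have [c1 c1' _] := arcE n0 ss; have [c2 c2' _] := arcE tt n0.
  rewrite q1 in c1 c1'; rewrite q2 in c2 c2'.
  have n0' := n0.
  have ch0 : 0 < chord e p by rewrite c1 divr_gt0 ?mulr_gt0// addr_gt0.
  have r1 : chord f p * (2 * s) = chord e p * N.
    by rewrite c1 c1'; field; rewrite gt_eqF// addr_gt0.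
  have r2 : chord f p * N = chord e p * (2 * t).
    by rewrite c2 c2'; field; rewrite gt_eqF// addr_gt0.
  have : chord e p * N ^+ 2 = chord e p * (4 * s * t).
    rewrite expr2 mulrA -r1 mulrAC r2; ring.
  by move=> /(mulfI (lt0r_neq0 ch0)) E; rewrite E ltxx in hlt.
have [q1 q2] : horoball e s (arc N (2 * s)) /\ horoball f t (arc N (2 * s)).
  by apply: arc_in => //; lra.
exists (arc N (2 * s)); apply/seteqP; split=> [p [p1 p2]|_ -> //].
apply: contrapT => pq; have := horoball_meet2 pq p1 p2 q1 q2.
by rewrite hN ltxx.
Qed.

Let open_strict g r : open [set p : pt3 R | chord g p ^+ 2 < r * (1 - dot p p)].
Proof.
rewrite (_ : [set p | _] = (fun p : pt3 R => r * (1 - dot p p) - chord g p ^+ 2)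
    @^-1` [set x : R | 0 < x]); last first.
  by apply/seteqP; split => p /=; rewrite subr_gt0.
apply: open_comp; last exact: open_gt.
move=> p _.
have c1 : {for p, continuous (fun p : pt3 R => p.1.1)}.
  by apply: (@continuous_comp _ _ _ fst fst); exact: cvg_fst.
have c2 : {for p, continuous (fun p : pt3 R => p.1.2)}.
  by apply: (@continuous_comp _ _ _ fst snd); [exact: cvg_fst|exact: cvg_snd].
have c3 : {for p, continuous (fun p : pt3 R => p.2)} by exact: cvg_snd.
have cst (x : R) : {for p, continuous (fun _ : pt3 R => x)} by exact: cvg_cst.
have cdot (a1 a2 a3 b1 b2 b3 : pt3 R -> R) :
    {for p, continuous a1} -> {for p, continuous a2} -> {for p, continuous a3} ->
    {for p, continuous b1} -> {for p, continuous b2} -> {for p, continuous b3} ->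
    {for p, continuous (fun p => a1 p * b1 p + a2 p * b2 p + a3 p * b3 p)}.
  by move=> *; do 2?apply: cvgD; exact: cvgM.
have cc : {for p, continuous (fun p : pt3 R => chord g p)}.
  by apply: cvgB; [exact: cst|exact: cdot].
apply: cvgB; last by apply: (cvgM cc cc).
by apply: cvgM; [exact: cst|apply: cvgB; [exact: cst|exact: cdot]].
Qed.

Let strict_sub g r : 0 < r ->
  [set p : pt3 R | chord g p ^+ 2 < r * (1 - dot p p)] `<=` (horoball g r)°.
Proof.
move=> r0; rewrite -open_subsetE; last exact: open_strict.
move=> p /= hp; split; last exact: ltW.
rewrite /H3/= -subr_gt0 -(pmulr_rgt0 _ r0); exact: le_lt_trans (sqr_ge0 _) hp.
Qed.

Lemma horoball_interiorP : (horoball e s)° `&` (horoball f t)° = set0 <-> 4 * s * t <= N ^+ 2.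
Proof.
split=> [H|hN].
  rewrite leNgt; apply/negP => hlt.
  (* The ratio [a / b] is the mean of [N / (2 s)] and [2 t / N], the ratios at the two
     horospheres. *)
  pose a := N ^+ 2 + 4 * s * t; pose b := 4 * s * N.
  have a0 : 0 < a by rewrite /a addr_gt0 ?exprn_gt0// !mulr_gt0.
  have b0 : 0 < b by rewrite /b !mulr_gt0.
  have [ne nf QE] := arcE a0 b0.
  have ab : 0 < (a + b) ^+ 2 by apply: exprn_gt0; exact: addr_gt0.
  suff : ((horoball e s)° `&` (horoball f t)°) (arc a b) by rewrite H.
  have hs : 0 < s * (4 * s * t - N ^+ 2) by rewrite mulr_gt0// subr_gt0.
  have hn : 0 < N * (4 * s * t - N ^+ 2) by rewrite mulr_gt0// subr_gt0.
  split; apply: strict_sub => //=.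
  - rewrite ne QE expr_div_n mulrA ltr_pM2r ?invr_gt0//.
    have : 0 < b * N * (2 * s * a - b * N).
      rewrite (_ : 2 * s * a - b * N = 2 * (s * (4 * s * t - N ^+ 2))).
        by apply: mulr_gt0; [exact: mulr_gt0|exact: mulr_gt0].
      by rewrite /a /b; ring.
    by rewrite expr2; clearbody a b; lra.
  - rewrite nf QE expr_div_n mulrA ltr_pM2r ?invr_gt0//.
    have : 0 < a * N * (2 * t * b - a * N).
      rewrite (_ : 2 * t * b - a * N = N * (4 * s * t - N ^+ 2)).
        by apply: mulr_gt0 => //; exact: mulr_gt0.
      by rewrite /a /b; ring.
    by rewrite expr2; clearbody a b; lra.
rewrite -subset0 => p [p1 p2].
have : nbhs p ((horoball e s)° `&` (horoball f t)°).
  by apply: filterI; exact: nbhs_interior.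
move=> /nbhs_ballP[r /= r0 rsub].
(* A common interior point brings a second common point nearby, to which the strict inequality of
   [horoball_meet2] applies. *)
pose q : pt3 R := (p.1.1 + r / 2, p.1.2, p.2).
have r2 : 0 < r / 2 by rewrite divr_gt0.
have [q1 q2] : ((horoball e s)° `&` (horoball f t)°) q.
  apply: rsub; split; last exact: ballxx.
  split; last exact: ballxx.
  rewrite /ball /= opprD addNKr normrN gtr0_norm// ltr_pdivrMr//.
  by rewrite mulr_natr mulr2n ltrDl.
have pq : p <> q.
  move=> /(congr1 (fun x : pt3 R => x.1.1)) /= /eqP; rewrite -subr_eq0 opprD addNKr.
  by rewrite oppr_eq0 gt_eqF.
have := horoball_meet2 pq (interior_subset p1) (interior_subset p2)
  (interior_subset q1) (interior_subset q2).
by rewrite ltNge hN.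
Qed.

End Pair.
End HoroballPairs.

(** * Densities of arrangements *)

Section FourPoints.
Context {R : realType}.

Lemma sum_I4 (V : nmodType) (F : 'I_4 -> V) :
  \sum_i F i = F v0 + F v1 + F v2 + F v3.
Proof.
rewrite !big_ord_recr big_ord0 /= add0r.
by do 3?congr (_ + _); congr F; exact: val_inj.
Qed.

Lemma I4P (P : 'I_4 -> Prop) : P v0 -> P v1 -> P v2 -> P v3 -> forall i, P i.
Proof.
move=> p0 p1 p2 p3 [[|[|[|[|//]]]] i];
  [move: p0|move: p1|move: p2|move: p3]; congr P; exact: val_inj.
Qed.

Definition weights4 (T : Type) (a b c d : T) : 'I_4 -> T := tnth [tuple a; b; c; d].

Lemma tetrahedronE (E : 'I_4 -> pt3 R) :
  tetrahedron E = hull4 (E v0) (E v1) (E v2) (E v3).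
Proof.
apply/seteqP; split=> p.
  move=> [w [w0 ws ->]]; exists (w v0), (w v1), (w v2), (w v3).
  by split => //; split; [rewrite -ws sum_I4 | rewrite sum_I4].
move=> [w0 [w1 [w2 [w3 [[? ? ? ?] [ws ->]]]]]].
exists (weights4 w0 w1 w2 w3); split; last by rewrite sum_I4.
  exact: I4P.
by rewrite sum_I4.
Qed.

Let det_cramer1 (A B C : pt3 R) : (B.1.2 * C.2 - B.2 * C.1.2) *: A
  + (C.1.2 * A.2 - C.2 * A.1.2) *: B + (A.1.2 * B.2 - A.2 * B.1.2) *: C =
  (det3 A B C, 0, 0).
Proof. by rewrite /det3; apply: pt3P; rewrite /= /GRing.scale/=; ring. Qed.

Let det_cramer2 (A B C : pt3 R) : (B.2 * C.1.1 - B.1.1 * C.2) *: A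
  + (C.2 * A.1.1 - C.1.1 * A.2) *: B + (A.2 * B.1.1 - A.1.1 * B.2) *: C =
  (0, det3 A B C, 0).
Proof. by rewrite /det3; apply: pt3P; rewrite /= /GRing.scale/=; ring. Qed.

Let det_cramer3 (A B C : pt3 R) : (B.1.1 * C.1.2 - B.1.2 * C.1.1) *: A
  + (C.1.1 * A.1.2 - C.1.2 * A.1.1) *: B + (A.1.1 * B.1.2 - A.1.2 * B.1.1) *: C =
  (0, 0, det3 A B C).
Proof. by rewrite /det3; apply: pt3P; rewrite /= /GRing.scale/=; ring. Qed.

(** If the determinant vanished, the Cramer relations would make the cross product of [A] and [B]
    zero; then [A] and [B] are proportional, which independence excludes. *)
Lemma det3_neq0 (A B C : pt3 R) :
  (forall a b c, a *: A + b *: B + c *: C = 0 -> [/\ a = 0, b = 0 & c = 0]) ->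
  det3 A B C != 0.
Proof.
move=> H; apply/eqP => d0.
have [_ _ c1] := H _ _ _ (etrans (det_cramer1 A B C) (congr1 (fun d => (d, 0, 0)) d0)).
have [_ _ c2] := H _ _ _ (etrans (det_cramer2 A B C) (congr1 (fun d => (0, d, 0)) d0)).
have [_ _ c3] := H _ _ _ (etrans (det_cramer3 A B C) (congr1 (fun d => (0, 0, d)) d0)).
have [_ a1 _] : [/\ B.1.1 = 0, - A.1.1 = 0 & 0 = 0 :> R].
  by apply: H; apply: pt3P; rewrite /= /GRing.scale/=; lra.
have [_ a2 _] : [/\ B.1.2 = 0, - A.1.2 = 0 & 0 = 0 :> R].
  by apply: H; apply: pt3P; rewrite /= /GRing.scale/=; lra.
have [_ a3 _] : [/\ B.2 = 0, - A.2 = 0 & 0 = 0 :> R].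
  by apply: H; apply: pt3P; rewrite /= /GRing.scale/=; lra.
have [/eqP + _ _] : [/\ 1 = 0 :> R, 0 = 0 :> R & 0 = 0 :> R].
  by apply: H; apply: pt3P; rewrite /= /GRing.scale/=; lra.
by rewrite oner_eq0.
Qed.

Lemma vol4_det3 (e0 e1 e2 e3 : pt3 R) :
  vol4 e0 e1 e2 e3 = - det3 (e1 - e0) (e2 - e0) (e3 - e0).
Proof. by rewrite /vol4 /det3 /=; ring. Qed.

Lemma ideal_tetrahedronP (E : 'I_4 -> pt3 R) :
  ideal_tetrahedron E <-> ideal4 (E v0) (E v1) (E v2) (E v3).
Proof.
split=> [[Eb Ei]|[h0 h1 h2 h3 d0]].
  split; try exact: Eb; rewrite vol4_det3 oppr_eq0; apply: det3_neq0 => a b c abc.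
  have H := Ei (weights4 (- (a + b + c)) a b c) _ _.
  have {}H : forall i, weights4 (- (a + b + c)) a b c i = 0.
    apply: H; rewrite sum_I4 /weights4 /=.
      by rewrite /tnth/=; ring.
    rewrite -[RHS]abc /tnth /=; apply: pt3P; rewrite /= /GRing.scale/=; ring.
  by split; [exact: (H v1)|exact: (H v2)|exact: (H v3)].
split; first by apply: I4P.
move=> w; rewrite !sum_I4 => ws wE.
have dE : det3 (E v1 - E v0) (E v2 - E v0) (E v3 - E v0) != 0.
  by move: d0; rewrite vol4_det3 oppr_eq0.
have wv0 : w v0 = - (w v1 + w v2 + w v3) by lra.
have {}wE : w v1 *: (E v1 - E v0) + w v2 *: (E v2 - E v0) + w v3 *: (E v3 - E v0) = 0.
  by rewrite -[RHS]wE wv0; apply: pt3P; rewrite /= /GRing.scale/=; ring.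
move: (E v1 - E v0) (E v2 - E v0) (E v3 - E v0) wE dE => A B C wE dE.
have x1 := congr1 (fun p : pt3 R => p.1.1) wE; have x2 := congr1 (fun p : pt3 R => p.1.2) wE.
have x3 := congr1 (fun p : pt3 R => p.2) wE; rewrite /= /GRing.scale/= in x1 x2 x3.
have z1 : w v1 = 0.
  apply: (mulIf dE); rewrite mul0r /det3.
  have := congr1 (fun x => x * (B.1.2 * C.2 - B.2 * C.1.2)) x1.
  have := congr1 (fun x => x * (B.1.1 * C.2 - B.2 * C.1.1)) x2.
  by have := congr1 (fun x => x * (B.1.1 * C.1.2 - B.1.2 * C.1.1)) x3; rewrite /=; lra.
have z2 : w v2 = 0.
  apply: (mulIf dE); rewrite mul0r /det3.
  have := congr1 (fun x => x * (A.1.2 * C.2 - A.2 * C.1.2)) x1.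
  have := congr1 (fun x => x * (A.1.1 * C.2 - A.2 * C.1.1)) x2.
  by have := congr1 (fun x => x * (A.1.1 * C.1.2 - A.1.2 * C.1.1)) x3; rewrite /=; lra.
have z3 : w v3 = 0.
  apply: (mulIf dE); rewrite mul0r /det3.
  have := congr1 (fun x => x * (A.1.2 * B.2 - A.2 * B.1.2)) x1.
  have := congr1 (fun x => x * (A.1.1 * B.2 - A.2 * B.1.1)) x2.
  by have := congr1 (fun x => x * (A.1.1 * B.1.2 - A.1.2 * B.1.1)) x3; rewrite /=; lra.
by apply: I4P => //; rewrite wv0 z1 z2 z3; ring.
Qed.

Section Faces.
Variable E : 'I_4 -> pt3 R.

Lemma face_plane0 : face_plane E v0 = plane3 (E v1) (E v2) (E v3).
Proof.
apply/seteqP; split=> p [pH].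
  move=> [w [wi ws pE]]; split; first exact: pH.
  exists (w v1), (w v2), (w v3); split.
    by rewrite -ws sum_I4 wi; ring.
  by rewrite pE sum_I4 wi /bary; apply: pt3P; rewrite /= /GRing.scale/=; ring.
move=> [a [b [c [abc pE]]]]; split => //.
exists (weights4 0 a b c); split => //.
  by rewrite -abc sum_I4 /weights4 /tnth /=; ring.
by rewrite pE sum_I4 /bary /weights4 /tnth /=; apply: pt3P; rewrite /= /GRing.scale/=; ring.
Qed.

(** The order of the vertices is that of the double transposition taking [v0] to [v1], so that the
    results on [plane3] apply after relabelling; likewise for the two faces below. *)
Lemma face_plane1 : face_plane E v1 = plane3 (E v0) (E v3) (E v2).
Proof.
apply/seteqP; split=> p [pH].
  move=> [w [wi ws pE]]; split; first exact: pH.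
  exists (w v0), (w v3), (w v2); split.
    by rewrite -ws sum_I4 wi; ring.
  by rewrite pE sum_I4 wi /bary; apply: pt3P; rewrite /= /GRing.scale/=; ring.
move=> [a [b [c [abc pE]]]]; split => //.
exists (weights4 a 0 c b); split => //.
  by rewrite -abc sum_I4 /weights4 /tnth /=; ring.
by rewrite pE sum_I4 /bary /weights4 /tnth /=; apply: pt3P; rewrite /= /GRing.scale/=; ring.
Qed.

Lemma face_plane2 : face_plane E v2 = plane3 (E v3) (E v0) (E v1).
Proof.
apply/seteqP; split=> p [pH].
  move=> [w [wi ws pE]]; split; first exact: pH.
  exists (w v3), (w v0), (w v1); split.
    by rewrite -ws sum_I4 wi; ring.
  by rewrite pE sum_I4 wi /bary; apply: pt3P; rewrite /= /GRing.scale/=; ring.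
move=> [a [b [c [abc pE]]]]; split => //.
exists (weights4 b c 0 a); split => //.
  by rewrite -abc sum_I4 /weights4 /tnth /=; ring.
by rewrite pE sum_I4 /bary /weights4 /tnth /=; apply: pt3P; rewrite /= /GRing.scale/=; ring.
Qed.

Lemma face_plane3 : face_plane E v3 = plane3 (E v2) (E v1) (E v0).
Proof.
apply/seteqP; split=> p [pH].
  move=> [w [wi ws pE]]; split; first exact: pH.
  exists (w v2), (w v1), (w v0); split.
    by rewrite -ws sum_I4 wi; ring.
  by rewrite pE sum_I4 wi /bary; apply: pt3P; rewrite /= /GRing.scale/=; ring.
move=> [a [b [c [abc pE]]]]; split => //.
exists (weights4 c b a 0); split => //.
  by rewrite -abc sum_I4 /weights4 /tnth /=; ring.
by rewrite pE sum_I4 /bary /weights4 /tnth /=; apply: pt3P; rewrite /= /GRing.scale/=; ring.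
Qed.

End Faces.
End FourPoints.

(** * Admissibility and density in terms of radii *)

Section KiteDensity.
Context {R : realType}.

(** Dividing the packing condition [4 s_i s_j <= N_ij ^ 2] by these identities turns it into a bound
    on [u_i u_j] with a constant depending on [k] only. *)
Lemma kite_crit_pairs (e0 e1 e2 e3 : pt3 R) : ideal4 e0 e1 e2 e3 -> kite e0 e1 e2 e3 ->
  [/\ 4 * (kite_crit e0 e1 e2 e3 * kite_crit e1 e0 e3 e2) =
        kite_ratio e0 e1 e2 e3 * (4 - kite_ratio e0 e1 e2 e3) ^+ 2 * chord e0 e1 ^+ 2,
      4 * (kite_crit e0 e1 e2 e3 * kite_crit e2 e3 e0 e1) =
        kite_ratio e0 e1 e2 e3 * (4 - kite_ratio e0 e1 e2 e3) ^+ 2 * chord e0 e2 ^+ 2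
    & 4 * (kite_crit e0 e1 e2 e3 * kite_crit e3 e2 e1 e0) =
        (4 - kite_ratio e0 e1 e2 e3) ^+ 2 * chord e0 e3 ^+ 2].
Proof.
move=> h hk; have [n01 n02 n03 [n12 n13 n23]] := ideal4_chord_gt0 h.
have N13E : chord e1 e3 = chord e0 e1 * chord e2 e3 / chord e0 e2.
  by rewrite hk mulrAC divff ?mul1r// gt_eqF.
have N12E : chord e1 e2 = kite_ratio e0 e1 e2 e3 * (chord e0 e1 * chord e2 e3) / chord e0 e3.
  by rewrite /kite_ratio; field; rewrite !gt_eqF.
rewrite /kite_crit (kite_ratio_1032 e0 e1 e2 e3) (kite_ratio_2301 e0 e1 e2 e3).
rewrite (kite_ratio_3210 e0 e1 e2 e3).
rewrite (chordC e1 e0) (chordC e2 e0) (chordC e3 e0) (chordC e2 e1) (chordC e3 e1).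
rewrite (chordC e3 e2) N12E N13E; move: (kite_ratio _ _ _ _) => k.
by split; field; rewrite !gt_eqF.
Qed.

Section Arrangement.
Variables (E : 'I_4 -> pt3 R) (s : 'I_4 -> R).
Hypotheses (hE : ideal_tetrahedron E) (hk : kite (E v0) (E v1) (E v2) (E v3)).

Let h : ideal4 (E v0) (E v1) (E v2) (E v3). Proof. exact/ideal_tetrahedronP. Qed.
Let h1 := ideal4_1032 h.
Let h2 := ideal4_2301 h.
Let h3 := ideal4_3210 h.
Let hk1 := kite_1032 hk.
Let hk2 := kite_2301 hk.
Let hk3 := kite_3210 hk.

Definition kite_crits : 'I_4 -> R := weights4
  (kite_crit (E v0) (E v1) (E v2) (E v3)) (kite_crit (E v1) (E v0) (E v3) (E v2))
  (kite_crit (E v2) (E v3) (E v0) (E v1)) (kite_crit (E v3) (E v2) (E v1) (E v0)).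

Local Notation k := (kite_ratio (E v0) (E v1) (E v2) (E v3)).

Lemma kite_crits_gt0 i : 0 < kite_crits i.
Proof.
by move: i; apply: I4P; rewrite /kite_crits /weights4 /tnth /=; exact: kite_crit_gt0.
Qed.

Lemma face_touches i r : touches (horoball (E i) r) (face_plane E i) <-> r = kite_crits i.
Proof.
move: i; apply: I4P; rewrite /kite_crits /weights4 /tnth /=.
- by rewrite face_plane0; exact: face_touchP.
- by rewrite face_plane1; exact: face_touchP.
- by rewrite face_plane2; exact: face_touchP.
- by rewrite face_plane3; exact: face_touchP.
Qed.

Lemma face_at_most_one i r :
  (forall p q, (horoball (E i) r `&` face_plane E i) p ->
     (horoball (E i) r `&` face_plane E i) q -> p = q) <-> r <= kite_crits i.
Proof.
have H (e0 e1 e2 e3 : pt3 R) : ideal4 e0 e1 e2 e3 -> kite e0 e1 e2 e3 ->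
    (forall p q, (horoball e0 r `&` plane3 e1 e2 e3) p ->
     (horoball e0 r `&` plane3 e1 e2 e3) q -> p = q) <-> r <= kite_crit e0 e1 e2 e3.
  move=> g gk; split; first exact: face_unique_le.
  move=> rc p q [p1 p2] [q1 q2].
  by have [-> _] := face_unique g gk rc p1 p2; have [-> _] := face_unique g gk rc q1 q2.
move: i; apply: I4P; rewrite /kite_crits /weights4 /tnth /=.
- by rewrite face_plane0; exact: H.
- by rewrite face_plane1; exact: H.
- by rewrite face_plane2; exact: H.
- by rewrite face_plane3; exact: H.
Qed.

Lemma chord_gt0 i j : i != j -> 0 < chord (E i) (E j).
Proof.
have [n01 n02 n03 [n12 n13 n23]] := ideal4_chord_gt0 h.
by move: i j; do 2!apply: I4P => //; rewrite chordC.
Qed.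

Lemma kite_density : (forall i, 0 < s i) -> (forall i, s i <= kite_crits i) ->
  density E (fun i => horoball (E i) (s i)) =
  (4 - k) * (\sum_i s i / kite_crits i) / (2 * ideal_integral k).
Proof.
move=> s0 sc; have [n01 n02 n03 [n12 n13 n23]] := ideal4_chord_gt0 h.
have k0 := kite_ratio_gt0 h; have k4 := kite_ratio_lt4 h hk.
have vol_gt0 : 0 < `|vol4 (E v0) (E v1) (E v2) (E v3)|.
  by rewrite normr_gt0; case: h.
have H (e0 e1 e2 e3 : pt3 R) r : ideal4 e0 e1 e2 e3 -> kite e0 e1 e2 e3 ->
    0 < r -> r <= kite_crit e0 e1 e2 e3 ->
    hyp_vol (horoball e0 r `&` hull4 e0 e1 e2 e3) = `|vol4 e0 e1 e2 e3| *
      ((4 - kite_ratio e0 e1 e2 e3) * (r / kite_crit e0 e1 e2 e3) /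
      (8 * (chord e0 e1 * chord e2 e3))).
  move=> g gk r0 rc; rewrite (hyp_vol_kite_horoball g gk r0 rc) /kite_crit.
  have [m01 m02 m03 [m12 m13 m23]] := ideal4_chord_gt0 g.
  have := kite_ratio_lt4 g gk; rewrite -subr_gt0; move: (4 - _) => q q0.
  by congr (_ * _); field; rewrite !gt_eqF.
have c0 := kite_crits_gt0.
have F0 : ideal_integral k != 0.
  by rewrite gt_eqF// ideal_integral_gt0// k0.
rewrite /density tetrahedronE !sum_I4 (H _ _ _ _ _ h hk (s0 v0) (sc v0)).
rewrite -{1}(hull4_1032 (E v0)) (H _ _ _ _ _ h1 hk1 (s0 v1) (sc v1)).
rewrite -{1}(hull4_2301 (E v0)) (H _ _ _ _ _ h2 hk2 (s0 v2) (sc v2)).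
rewrite -{1}(hull4_3210 (E v0)) (H _ _ _ _ _ h3 hk3 (s0 v3) (sc v3)).
rewrite hyp_vol_kite// (vol4_1032 (E v0)) (vol4_2301 (E v0)) (vol4_3210 (E v0)).
rewrite (kite_ratio_1032 (E v0)) (kite_ratio_2301 (E v0)) (kite_ratio_3210 (E v0)).
rewrite (chordC (E v1) (E v0)) (chordC (E v3) (E v2)).
rewrite [chord (E v2) (E v3) * chord (E v0) (E v1)]mulrC.
have P0 : 0 < chord (E v0) (E v1) * chord (E v2) (E v3) by exact: mulr_gt0.
rewrite /kite_crits /weights4 /tnth /=.
move: (_ * _) (`|_|) (ideal_integral _) P0 vol_gt0 F0 (s v0 / _) (s v1 / _) (s v2 / _) (s v3 / _).
move=> P V F P0 V0 F0 a b c d; field.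
by rewrite F0 !gt_eqF.
Qed.

Lemma kite_admissibleP : (forall i, 0 < s i) ->
  admissible E (fun i => horoball (E i) (s i)) <->
  (forall i j, i != j -> 4 * s i * s j <= chord (E i) (E j) ^+ 2) /\
  (forall i, s i <= kite_crits i).
Proof.
move=> s0; have hb i : dot (E i) (E i) = 1 by exact: hE.1.
split=> [[_ hp hf]|[hp hf]]; split.
- by move=> i j ij; apply/horoball_interiorP => //; [exact: chord_gt0|exact: hp].
- by move=> i; apply/face_at_most_one; exact: hf.
- by move=> i; exists (s i).
- by move=> i j ij; apply/horoball_interiorP => //; [exact: chord_gt0|exact: hp].
- by move=> i; apply/face_at_most_one.
Qed.

Lemma kite_density_le c : 0 < c -> c < 10^-1 -> c * (4 - c) ^+ 2 = 1 ->
  (forall i, 0 < s i) -> admissible E (fun i => horoball (E i) (s i)) ->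
  density E (fun i => horoball (E i) (s i)) <= max_density c.
Proof.
move=> c0 c1 cE s0 /(kite_admissibleP s0)[hp hf].
have k0 := kite_ratio_gt0 h; have k4 := kite_ratio_lt4 h hk.
rewrite kite_density// ler_pdivrMr ?mulr_gt0 ?ideal_integral_gt0 ?k0//.
rewrite mulrCA sum_I4; pose u i := s i / kite_crits i; rewrite -!/(u _).
have u01 i : 0 <= u i <= 1.
  by rewrite /u divr_ge0 ?(ltW (s0 i)) ?(ltW (kite_crits_gt0 i))//= ler_pdivrMr ?kite_crits_gt0// mul1r.
have pair i j m : i != j ->
    4 * (kite_crits i * kite_crits j) = m * chord (E i) (E j) ^+ 2 -> m * (u i * u j) <= 1.
  move=> ij mE; have ci := kite_crits_gt0 i; have cj := kite_crits_gt0 j.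
  have cij : 0 < chord (E i) (E j) ^+ 2 by rewrite exprn_gt0// chord_gt0.
  rewrite -(ler_pM2r cij) mul1r mulrAC -mE.
  rewrite [leLHS](_ : _ = 4 * s i * s j); first exact: hp.
  by rewrite /u; field; rewrite !gt_eqF.
have [p1 p2 p3] := kite_crit_pairs h hk.
have [r1 r2 r3] := kite_crit_pairs h1 hk1.
have [_ q2 q3] := kite_crit_pairs h2 hk2.
rewrite ?(kite_ratio_1032 (E v0)) ?(kite_ratio_2301 (E v0)) in r1 r2 r3 q2 q3.
apply: sum_le_optimum => //.
- by apply: pair => //; exact: p3.
- by apply: pair => //; exact: r3.
- by apply: pair => //; exact: p1.
- by apply: pair => //; exact: p2.
- by apply: pair => //; exact: r2.
- have [q1 _ _] := kite_crit_pairs h2 hk2; rewrite (kite_ratio_2301 (E v0)) in q1.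
  by apply: pair => //; exact: q1.
Qed.

End Arrangement.
End KiteDensity.

(** * Invariance under relabelling of the vertices *)

Section Relabelling.
Context {R : realType}.
Variables (f : 'I_4 -> 'I_4) (fI : injective f).
Implicit Types (E : 'I_4 -> pt3 R) (B : 'I_4 -> set (pt3 R)).

Let g := invF fI.
Let gf : cancel f g. Proof. exact: invF_f. Qed.

Lemma tetrahedron_relabel E : tetrahedron (E \o f) = tetrahedron E.
Proof.
apply/seteqP; split=> p [w [w0 ws ->]].
  exists (w \o g); split; first by move=> i; exact: w0.
    by rewrite -ws (reindex_inj fI); apply: eq_bigr => i _; rewrite /= gf.
  by rewrite [RHS](reindex_inj fI); apply: eq_bigr => i _; rewrite /= gf.
exists (w \o f); split; first by move=> i; exact: w0.
  by rewrite -ws [RHS](reindex_inj fI).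
by rewrite [LHS](reindex_inj fI).
Qed.

Lemma ideal_tetrahedron_relabel E : ideal_tetrahedron E -> ideal_tetrahedron (E \o f).
Proof.
move=> [Eb Ei]; split=> [i|w ws wE i]; first exact: Eb.
have H : forall i, (w \o g) i = 0.
  apply: Ei.
    by rewrite -[RHS]ws (reindex_inj fI); apply: eq_bigr => j _; rewrite /= gf.
  by rewrite -[RHS]wE (reindex_inj fI); apply: eq_bigr => j _; rewrite /= gf.
by have := H (f i); rewrite /= gf.
Qed.

Lemma face_plane_relabel E i : face_plane (E \o f) i `<=` face_plane E (f i).
Proof.
move=> p [pH [w [wi ws pE]]]; split => //; exists (w \o g); split.
- by rewrite /= gf.
- by rewrite -ws (reindex_inj fI); apply: eq_bigr => j _; rewrite /= gf.
- by rewrite pE [RHS](reindex_inj fI); apply: eq_bigr => j _; rewrite /= gf.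
Qed.

Lemma admissible_relabel E B : admissible E B -> admissible (E \o f) (B \o f).
Proof.
move=> [Bh Bp Bf]; split=> [i|i j ij|i p q [p1 p2] [q1 q2]]; first exact: Bh.
- by apply: Bp; rewrite (inj_eq fI).
- by apply: (Bf (f i)); split => //; exact: face_plane_relabel.
Qed.

Lemma density_relabel E B : density (E \o f) (B \o f) = density E B.
Proof.
rewrite /density tetrahedron_relabel; congr (_ / _).
by rewrite [RHS](reindex_inj fI).
Qed.

End Relabelling.

(** * From a reflection to the kite relation *)

Section PlaneSymmetry.
Context {R : realType}.

Variable E : 'I_4 -> pt3 R.
Hypothesis hE : ideal_tetrahedron E.

Let unit i : dot (E i) (E i) = 1. Proof. exact: hE.1. Qed.
Let h : ideal4 (E v0) (E v1) (E v2) (E v3). Proof. exact/ideal_tetrahedronP. Qed.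

Let weight_pair (w0 w1 w2 w3 a b c d e f : R) :
  [/\ 0 <= w0, 0 <= w1, 0 <= w2 & 0 <= w3] ->
  [/\ 0 < a, 0 < b, 0 < c & [/\ 0 < d, 0 < e & 0 < f]] -> w0 + w1 + w2 + w3 = 1 ->
  w0 * w1 * a + w0 * w2 * b + w0 * w3 * c + w1 * w2 * d + w1 * w3 * e + w2 * w3 * f = 0 ->
  [\/ [/\ w0 = 1, w1 = 0, w2 = 0 & w3 = 0], [/\ w0 = 0, w1 = 1, w2 = 0 & w3 = 0],
      [/\ w0 = 0, w1 = 0, w2 = 1 & w3 = 0] | [/\ w0 = 0, w1 = 0, w2 = 0 & w3 = 1]].
Proof.
move=> [p0 p1 p2 p3] [a0 b0 c0 [d0 e0 f0]] ws hz.
have t (x y z : R) : 0 <= x -> 0 <= y -> 0 < z -> 0 <= x * y * z.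
  by move=> *; rewrite !mulr_ge0// ltW.
have t1 := t _ _ _ p0 p1 a0; have t2 := t _ _ _ p0 p2 b0; have t3 := t _ _ _ p0 p3 c0.
have t4 := t _ _ _ p1 p2 d0; have t5 := t _ _ _ p1 p3 e0; have t6 := t _ _ _ p2 p3 f0.
have z (x y z : R) : 0 < z -> x * y * z = 0 -> x = 0 \/ y = 0.
  by move=> z0 /eqP; rewrite !mulf_eq0 (gt_eqF z0) orbF => /orP[/eqP ->|/eqP ->]; [left|right].
have q1 : w0 * w1 * a = 0 by lra.
have q2 : w0 * w2 * b = 0 by lra.
have q3 : w0 * w3 * c = 0 by lra.
have q4 : w1 * w2 * d = 0 by lra.
have q5 : w1 * w3 * e = 0 by lra.
have q6 : w2 * w3 * f = 0 by lra.
move: ws; clear -z a0 b0 c0 d0 e0 f0 q1 q2 q3 q4 q5 q6 => ws.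
case: (z _ _ _ a0 q1) => r1.
  case: (z _ _ _ d0 q4) => r2.
    by case: (z _ _ _ f0 q6) => r3; [apply: Or44|apply: Or43]; split => //; lra.
  by case: (z _ _ _ e0 q5) => r3; [apply: Or44|apply: Or42]; split => //; lra.
case: (z _ _ _ b0 q2) => r2.
  by case: (z _ _ _ f0 q6) => r3; [apply: Or44|apply: Or43]; split => //; lra.
by case: (z _ _ _ c0 q3) => r3; [apply: Or44|apply: Or41]; split => //; lra.
Qed.

(** In barycentric weights [1 - dot p p] is a positive combination of the products [w_i w_j]; if it
    vanishes, a single weight survives. *)
Lemma ideal_point_vertex p : tetrahedron E p -> dot p p = 1 -> exists i, p = E i.
Proof.
rewrite tetrahedronE => -[w0 [w1 [w2 [w3 [w0123 [ws pE]]]]]] pp.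
have := chord_self_bary (unit v0) (unit v1) (unit v2) (unit v3) ws.
rewrite -pE pp subrr => /esym/eqP; rewrite mulf_eq0 pnatr_eq0/= => /eqP hz.
have [[a b c d]|[a b c d]|[a b c d]|[a b c d]] :=
    weight_pair w0123 (ideal4_chord_gt0 h) ws hz;
  [exists v0|exists v1|exists v2|exists v3];
  by rewrite pE a b c d /bary !scale0r scale1r ?add0r ?addr0.
Qed.

Lemma vertex_tetrahedron i : tetrahedron E (E i).
Proof.
rewrite tetrahedronE; move: i; apply: I4P;
  [exists 1, 0, 0, 0|exists 0, 1, 0, 0|exists 0, 0, 1, 0|exists 0, 0, 0, 1];
  by split; split => //; rewrite ?addr0 ?add0r// /bary !scale0r scale1r ?add0r ?addr0.
Qed.

(** A Lorentz reflection keeps the vector of a vertex null, so its image is an ideal point of the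
    tetrahedron, that is, a vertex up to the scalar [t]. *)
Lemma reflected_vertex (u : R * pt3 R) i :
  0 < lorentz u u -> reflection u @` tetrahedron E = tetrahedron E ->
  exists j t, homog (E i) - (2 * lorentz (homog (E i)) u / lorentz u u) *: u
    = t *: homog (E j).
Proof.
move=> u0 hu; set c := 2 * _ / _; set X := homog (E i) - c *: u.
have XX : dot X.2 X.2 = X.1 ^+ 2.
  apply/eqP; rewrite -subr_eq0.
  have -> : dot X.2 X.2 - X.1 ^+ 2 = lorentz (homog (E i)) (homog (E i))
      - 2 * c * lorentz (homog (E i)) u + c ^+ 2 * lorentz u u.
    by rewrite /X /lorentz /dot /homog /= /GRing.scale/=; ring.
  have cu : c * lorentz u u = 2 * lorentz (homog (E i)) u by rewrite /c divfK// gt_eqF.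
  rewrite (_ : c ^+ 2 * _ = c * (c * lorentz u u)); last by ring.
  rewrite cu {1}/lorentz /homog /= unit; apply/eqP; ring.
(* A null vector with time coordinate 0 vanishes; then the null vector [homog (E i)] would be a
   multiple of the spacelike [u]. *)
have X10 : X.1 != 0.
  apply/eqP => X1; rewrite X1 expr2 mulr0 in XX.
  have X0 : homog (E i) = c *: u.
    apply/eqP; rewrite -subr_eq0 -/X; apply/eqP.
    by rewrite [LHS]surjective_pairing X1 (dot_eq0 XX).
  have : lorentz (homog (E i)) (homog (E i)) = 0.
    by rewrite /lorentz /homog /= unit; ring.
  rewrite {1 2}X0 (_ : lorentz _ _ = c ^+ 2 * lorentz u u); last first.
    by rewrite /lorentz /dot /= /GRing.scale/=; ring.
  move=> /eqP; rewrite mulf_eq0 sqrf_eq0 (gt_eqF u0) orbF => /eqP c0.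
  move: X0; rewrite c0 scale0r => /(congr1 fst) /= /eqP.
  by rewrite oner_eq0.
have : tetrahedron E (reflection u (E i)).
  by rewrite -hu; exists (E i) => //; exact: vertex_tetrahedron.
move=> /ideal_point_vertex; rewrite /reflection -/c -/X /dehomog.
have -> : dot (X.1^-1 *: X.2) (X.1^-1 *: X.2) = X.1 ^- 2 * dot X.2 X.2.
  by rewrite /dot /= /GRing.scale/= -exprVn; ring.
rewrite XX mulVf ?expf_neq0// => /(_ erefl)[j Xj].
exists j, X.1; rewrite /homog -Xj; case: (X) X10 => x p /= x0.
by rewrite -[RHS]/(x * 1, x *: (x^-1 *: p)) mulr1 scalerA divff// scale1r.
Qed.

Let lorentz_chord i j : lorentz (homog (E i)) (homog (E j)) = - chord (E i) (E j).
Proof. by rewrite /lorentz /homog /chord /=; ring. Qed.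

Let lorentz_sub (X Y Z : R * pt3 R) a b :
  lorentz Z (X - a *: Y) = lorentz Z X - a * lorentz Z Y /\
  lorentz Z (b *: X) = b * lorentz Z X.
Proof. by split; rewrite /lorentz /dot /= /GRing.scale/=; ring. Qed.

(** By affine independence the vectors [homog (E i)] span the whole space, where the Lorentz form is
    nondegenerate. *)
Let not_all_orthogonal (u : R * pt3 R) : 0 < lorentz u u ->
  exists i, lorentz (homog (E i)) u != 0.
Proof.
move=> u0; apply: contrapT => H.
have z i : lorentz (homog (E i)) u = 0.
  by apply/eqP/negPn/negP => hi; apply: H; exists i.
have d0 : det3 (E v1 - E v0) (E v2 - E v0) (E v3 - E v0) != 0.
  by have [_ _ _ _] := h; rewrite vol4_det3 oppr_eq0.
have y i : dot (E i - E v0) u.2 = 0.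
  rewrite (_ : dot _ _ = lorentz (homog (E i)) u - lorentz (homog (E v0)) u).
    by rewrite !z subrr.
  by rewrite /lorentz /dot /=; ring.
have u2 : u.2 = 0.
  move: (E v1 - E v0) (E v2 - E v0) (E v3 - E v0) (y v1) (y v2) (y v3) d0.
  rewrite /dot => A B C y1 y2 y3 d0.
  apply: pt3P => /=; apply: (mulfI d0); rewrite mulr0 /det3.
  - have := congr1 (fun x => x * (B.1.2 * C.2 - B.2 * C.1.2)) y1.
    have := congr1 (fun x => x * (C.1.2 * A.2 - C.2 * A.1.2)) y2.
    by have := congr1 (fun x => x * (A.1.2 * B.2 - A.2 * B.1.2)) y3; rewrite /=; lra.
  - have := congr1 (fun x => x * (B.2 * C.1.1 - B.1.1 * C.2)) y1.
    have := congr1 (fun x => x * (C.2 * A.1.1 - C.1.1 * A.2)) y2.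
    by have := congr1 (fun x => x * (A.2 * B.1.1 - A.1.1 * B.2)) y3; rewrite /=; lra.
  - have := congr1 (fun x => x * (B.1.1 * C.1.2 - B.1.2 * C.1.1)) y1.
    have := congr1 (fun x => x * (C.1.1 * A.1.2 - C.1.2 * A.1.1)) y2.
    by have := congr1 (fun x => x * (A.1.1 * B.1.2 - A.1.2 * B.1.1)) y3; rewrite /=; lra.
have := z v0; rewrite /lorentz u2 /homog /= mul1r => hz.
have u1 : u.1 = 0 by move: hz; rewrite /dot /=; lra.
by move: u0; rewrite /lorentz u1 u2 /dot /= !mulr0 !addr0 subrr ltxx.
Qed.

Lemma I4_others (i j : 'I_4) : i != j -> exists k l, uniq [:: k; i; j; l].
Proof.
by move: i j; do 2!apply: I4P => //; move=> _;
  first [exists v2, v3; done | exists v1, v3; done | exists v1, v2; done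
       | exists v0, v3; done | exists v0, v2; done | exists v0, v1; done].
Qed.

(** A vertex [i] not orthogonal to [u] is sent to another vertex [j], and the remaining two are
    orthogonal to [u]. Pairing the relation between [i] and [j] with each of these gives
    [N_ki = t N_kj] and [N_li = t N_lj]; eliminating [t] gives the kite relation. *)
Lemma plane_symmetric_kite : plane_symmetric E ->
  exists f : 'I_4 -> 'I_4, injective f /\
    kite (E (f v0)) (E (f v1)) (E (f v2)) (E (f v3)).
Proof.
move=> [u [u0 hu]]; have [i zi] := not_all_orthogonal u0.
pose c j := 2 * lorentz (homog (E j)) u / lorentz u u.
have c_eq0 j : c j = 0 -> lorentz (homog (E j)) u = 0.
  by move=> /eqP; rewrite /c !mulf_eq0 invr_eq0 (gt_eqF u0) orbF pnatr_eq0/= => /eqP.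
have ci : c i != 0 by apply: contra zi => /eqP/c_eq0 ->.
have [j [t hi]] := reflected_vertex i u0 hu; rewrite -/(c i) in hi.
(* A vertex on its own ray is orthogonal to [u]. *)
have fixed k r : homog (E k) - c k *: u = r *: homog (E k) -> c k = 0.
  move=> e; have e' : (1 - r) *: homog (E k) = c k *: u.
    by rewrite scalerBl scale1r -e opprB addrC subrK.
  have := congr1 (fun X => lorentz X X) e'.
  have Z a (X : R * pt3 R) : lorentz (a *: X) (a *: X) = a ^+ 2 * lorentz X X.
    by rewrite /lorentz /dot /= /GRing.scale/=; ring.
  rewrite !Z lorentz_chord /chord unit subrr oppr0 mulr0 => /esym/eqP.
  by rewrite mulf_eq0 sqrf_eq0 (gt_eqF u0) orbF => /eqP.
have ij : i != j.
  by apply: contra ci => /eqP ij; apply/eqP; apply: (fixed _ t); rewrite hi ij.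
have orth k : k != i -> k != j -> lorentz (homog (E k)) u = 0.
  move=> ki kj; apply: c_eq0; apply: contrapT => /eqP ck.
  have [m [r hk]] := reflected_vertex k u0 hu; rewrite -/(c k) in hk.
  have mk : m != k by apply: contra ck => /eqP mk; apply/eqP; apply: (fixed _ r); rewrite hk mk.
  (* If [k] were moved too, the differences of [i], [t j] and of [k], [r m] would both be multiples
     of [u]. Eliminating [u] leaves an affine relation with coefficient [- c i] at [k]. *)
  pose w (x : 'I_4) : R := c k * ((x == i)%:R - t * (x == j)%:R) - c i * ((x == k)%:R - r * (x == m)%:R).
  have sumD (V : lmodType R) (F : 'I_4 -> V) : \sum_x w x *: F x =
      c k *: (F i - t *: F j) - c i *: (F k - r *: F m).
    have one (x0 : 'I_4) : \sum_x (x == x0)%:R *: F x = F x0.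
      rewrite (bigD1 x0)//= eqxx scale1r big1 ?addr0// => x /negbTE ->.
      by rewrite scale0r.
    rewrite -!one !scaler_sumr -!sumrB !scaler_sumr -sumrB; apply: eq_bigr => x _.
    by rewrite /w scalerBl -!scalerA !scalerBl -!scalerA.
  have hom0 : c k *: (homog (E i) - t *: homog (E j)) - c i *: (homog (E k) - r *: homog (E m)) = 0.
    have hi' : homog (E i) - t *: homog (E j) = c i *: u by rewrite -hi opprB addrC subrK.
    have hk' : homog (E k) - r *: homog (E m) = c k *: u by rewrite -hk opprB addrC subrK.
    by rewrite hi' hk' !scalerA [c k * _]mulrC subrr.
  have w0 : forall x, w x = 0.
    apply: hE.2.
      have := congr1 fst hom0; rewrite /homog /= => h0.
      transitivity (\sum_x w x *: (1 : R^o)); last by rewrite sumD.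
      by apply: eq_bigr => x _; rewrite /GRing.scale/= mulr1.
    rewrite sumD; exact: (congr1 (fun X : R * pt3 R => X.2) hom0).
  have := w0 k; rewrite /w (negbTE ki) (negbTE kj) eqxx eq_sym (negbTE mk).
  by rewrite !mulr0 subrr mulr0 sub0r subr0 mulr1 => /eqP; rewrite oppr_eq0 (negbTE ci).
have ratio k : k != i -> k != j -> chord (E k) (E i) = t * chord (E k) (E j).
  move=> ki kj; have ok := orth _ ki kj.
  apply: oppr_inj; rewrite -mulrN -!lorentz_chord.
  have [_ <-] := lorentz_sub (homog (E j)) u (homog (E k)) 0 t.
  rewrite -hi; have [-> _] := lorentz_sub (homog (E i)) u (homog (E k)) (c i) 0.
  by rewrite ok mulr0 subr0.
have [k [l kijl]] := I4_others ij.
exists (weights4 k i j l); split; first exact/tuple_uniqP.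
rewrite /kite /weights4 /tnth /=.
move: kijl; rewrite /= !inE !negb_or => /and4P[/and3P[ki kj kl] /andP[_ il] jl _].
rewrite (ratio k)// (chordC (E i)) (ratio l) 1?eq_sym// (chordC (E l)).
by rewrite mulrAC mulrC mulrCA.
Qed.

End PlaneSymmetry.

(** * The extremal arrangement *)

Section Extremal.
Context {R : realType}.

Lemma plane_symmetric_density_le (E : 'I_4 -> pt3 R) (B : 'I_4 -> set (pt3 R)) c :
  0 < c -> c < 10^-1 -> c * (4 - c) ^+ 2 = 1 ->
  ideal_tetrahedron E -> plane_symmetric E -> admissible E B ->
  density E B <= max_density c.
Proof.
move=> c0 c1 cE hE hs hB; have [f [fI hk]] := plane_symmetric_kite hE hs.
rewrite -(density_relabel fI).
have {hB} := admissible_relabel fI hB; have {hE hs} := ideal_tetrahedron_relabel fI hE.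
rewrite -4!/((E \o f) _) in hk; move: (E \o f) hk (B \o f) => E' hk B' hE' hB'.
have /choice[s hs] : forall i, exists s : R, 0 < s /\ B' i = horoball (E' i) s.
  by move=> i; have [/(_ i)[s s0 Bi] _ _] := hB'; exists s.
have BE : B' = (fun i => horoball (E' i) (s i)) by apply/funext => i; exact: (hs i).2.
rewrite BE in hB' *.
exact: (kite_density_le hE' hk c0 c1 cE (fun i => (hs i).1) hB').
Qed.

Section ExtremalKite.
Variable E : 'I_4 -> pt3 R.
Hypotheses (hE : ideal_tetrahedron E) (hk : kite (E v0) (E v1) (E v2) (E v3)).
Local Notation k := (kite_ratio (E v0) (E v1) (E v2) (E v3)).
Hypothesis kE : k * (4 - k) ^+ 2 = 1.

Let h : ideal4 (E v0) (E v1) (E v2) (E v3). Proof. exact/ideal_tetrahedronP. Qed.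
Let k0 : 0 < k. Proof. exact: kite_ratio_gt0. Qed.
Let q0 : 0 < 4 - k. Proof. by rewrite subr_gt0; exact: kite_ratio_lt4. Qed.
Let qq0 : 0 < (4 - k) ^+ 2. Proof. exact: exprn_gt0. Qed.
Let hb i : dot (E i) (E i) = 1. Proof. exact: hE.1. Qed.
Let cr := kite_crits E.
Let cr0 i : 0 < cr i. Proof. exact: kite_crits_gt0. Qed.

Definition extremal_radii : 'I_4 -> R :=
  weights4 (cr v0 / (4 - k) ^+ 2) (cr v1 / (4 - k) ^+ 2) (cr v2) (cr v3).

Definition extremal_arrangement (i : 'I_4) : set (pt3 R) :=
  horoball (E i) (extremal_radii i).

Lemma extremal_radii_gt0 i : 0 < extremal_radii i.
Proof.
by move: i; apply: I4P; rewrite /extremal_radii /weights4 /tnth /=;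
  first [exact: cr0 | exact: divr_gt0].
Qed.

(** At the critical ratio, horoballs tangent to their opposite faces are also tangent to each other
    in the four pairs other than [03] and [12]. *)
Let pairs :
  [/\ 4 * (cr v0 * cr v3) = (4 - k) ^+ 2 * chord (E v0) (E v3) ^+ 2,
      4 * (cr v1 * cr v2) = (4 - k) ^+ 2 * chord (E v1) (E v2) ^+ 2,
      4 * (cr v0 * cr v1) = chord (E v0) (E v1) ^+ 2
    & [/\ 4 * (cr v0 * cr v2) = chord (E v0) (E v2) ^+ 2,
      4 * (cr v1 * cr v3) = chord (E v1) (E v3) ^+ 2
    & 4 * (cr v2 * cr v3) = chord (E v2) (E v3) ^+ 2]].
Proof.
have [p1 p2 p3] := kite_crit_pairs h hk.
have [_ r2 r3] := kite_crit_pairs (ideal4_1032 h) (kite_1032 hk).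
have [q1 _ _] := kite_crit_pairs (ideal4_2301 h) (kite_2301 hk).
rewrite (kite_ratio_1032 (E v0)) in r2 r3; rewrite (kite_ratio_2301 (E v0)) in q1.
rewrite kE !mul1r in p1 p2 r2 q1.
by [].
Qed.

(** Five tangencies for four radii: the faces fix [s v3] and [s v2], tangency then fixes [s v0] and
    [s v1], and the contact of the balls at [v2] and [v3] is consistent because of [kE]. *)
Lemma extremal_arrangementP B :
  arrangement3 E B <-> B = extremal_arrangement.
Proof.
have [p03 p12 p01 [p02 p13 p23]] := pairs.
have touch i j (a b : R) : i != j -> 0 < a -> 0 < b ->
    touches (horoball (E i) a) (horoball (E j) b) <-> chord (E i) (E j) ^+ 2 = 4 * a * b.
  by move=> ij a0 b0; apply: horoball_touchP => //; exact: chord_gt0.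
have e0 := extremal_radii_gt0.
split=> [[Bh [t3 t2] t23 t03 t12]|->].
  have /choice[s hs] : forall i, exists s : R, 0 < s /\ B i = horoball (E i) s.
    by move=> i; have [s ? ?] := Bh i; exists s.
  have s0 i : 0 < s i by exact: (hs i).1.
  have BE i : B i = horoball (E i) (s i) by exact: (hs i).2.
  rewrite !BE in t3 t2 t23 t03 t12.
  have s3E : s v3 = cr v3 by apply/(face_touches hE hk).
  have s2E : s v2 = cr v2 by apply/(face_touches hE hk).
  have s0E : s v0 = cr v0 / (4 - k) ^+ 2.
    have {}t03 := (touch v0 v3 _ _ isT (s0 _) (s0 _)).1 t03.
    rewrite t03 s3E in p03; apply: (mulIf (_ : 4 * cr v3 * (4 - k) ^+ 2 != 0)).
      by apply: lt0r_neq0; apply: mulr_gt0 => //; exact: mulr_gt0.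
    rewrite [RHS](_ : _ = 4 * (cr v0 * cr v3)); first by rewrite p03; ring.
    by field; exact: lt0r_neq0.
  have s1E : s v1 = cr v1 / (4 - k) ^+ 2.
    have {}t12 := (touch v1 v2 _ _ isT (s0 _) (s0 _)).1 t12.
    rewrite t12 s2E in p12; apply: (mulIf (_ : 4 * cr v2 * (4 - k) ^+ 2 != 0)).
      by apply: lt0r_neq0; apply: mulr_gt0 => //; exact: mulr_gt0.
    rewrite [RHS](_ : _ = 4 * (cr v1 * cr v2)); first by rewrite p12; ring.
    by field; exact: lt0r_neq0.
  apply/funext => i; rewrite BE /extremal_arrangement; congr horoball.
  by move: i; apply: I4P.
split.
- by move=> i; exists (extremal_radii i).
- by split; apply/(face_touches hE hk).
- by apply/touch => //; rewrite -p23 mulrA.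
- apply/touch => //; rewrite /extremal_radii /weights4 /tnth /=.
  apply: (mulfI (lt0r_neq0 qq0)); rewrite -p03; field; exact: lt0r_neq0.
- apply/touch => //; rewrite /extremal_radii /weights4 /tnth /=.
  apply: (mulfI (lt0r_neq0 qq0)); rewrite -p12; field; exact: lt0r_neq0.
Qed.

Hypothesis q1 : 1 <= 4 - k.

Lemma extremal_radii_le i : extremal_radii i <= cr i.
Proof.
move: i; apply: I4P; rewrite /extremal_radii /weights4 /tnth //=.
  by rewrite ler_pdivrMr// ler_peMr ?(ltW (cr0 _))// expr_ge1// ltW.
by rewrite ler_pdivrMr// ler_peMr ?(ltW (cr0 _))// expr_ge1// ltW.
Qed.

Lemma extremal_admissible : admissible E extremal_arrangement.
Proof.
apply/(kite_admissibleP hE hk); first exact: extremal_radii_gt0.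
split; last exact: extremal_radii_le.
have [p03 p12 p01 [p02 p13 p23]] := pairs.
have e0 := extremal_radii_gt0; have el := extremal_radii_le.
have main i j : 4 * (cr i * cr j) = chord (E i) (E j) ^+ 2 ->
    4 * extremal_radii i * extremal_radii j <= chord (E i) (E j) ^+ 2.
  by move=> <-; rewrite -mulrA ler_pM2l// ler_pM// ltW.
have := extremal_arrangementP extremal_arrangement; case=> _ /(_ erefl)[_ _ _ t03 t12].
have touch i j : i != j -> touches (extremal_arrangement i) (extremal_arrangement j) ->
    4 * extremal_radii i * extremal_radii j <= chord (E i) (E j) ^+ 2.
  move=> ij /horoball_touchP ->//; exact: chord_gt0.
have sym i j : 4 * extremal_radii i * extremal_radii j <= chord (E i) (E j) ^+ 2 ->
    4 * extremal_radii j * extremal_radii i <= chord (E j) (E i) ^+ 2.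
  by rewrite (chordC (E j)) mulrAC.
have m03 := touch v0 v3 isT t03; have m12 := touch v1 v2 isT t12.
have m01 := main _ _ p01; have m02 := main _ _ p02; have m13 := main _ _ p13.
have m23 := main _ _ p23.
by do 2!apply: I4P => //; move=> _; apply: sym.
Qed.

Lemma extremal_density : density E extremal_arrangement = max_density k.
Proof.
rewrite (kite_density hE hk extremal_radii_gt0 extremal_radii_le) sum_I4.
have F0 : 0 < ideal_integral k by rewrite ideal_integral_gt0// k0 -subr_gt0.
rewrite /extremal_radii /weights4 /tnth /= /max_density.
have c0 := cr0 v0; have c1 := cr0 v1; have c2 := cr0 v2; have c3 := cr0 v3.
rewrite -/(cr v0) -/(cr v1) -/(cr v2) -/(cr v3).
by field; rewrite !gt_eqF.
Qed.

End ExtremalKite.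
End Extremal.

(** * Trigonometric solution of the critical cubic *)

Section CriticalTetrahedron.
Context {R : realType}.

Lemma cos_triple (x : R) : cos (3 * x) = 4 * cos x ^+ 3 - 3 * cos x.
Proof.
have -> : 3 * x = x *+ 2 + x by ring.
rewrite cosD cos_mulr2n sin_mulr2n.
have sE : sin x * sin x = 1 - cos x ^+ 2.
  by rewrite -(cos2Dsin2 x) addrAC subrr add0r expr2.
rewrite [LHS](_ : _ = (cos x ^+ 2 *+ 2 - 1) * cos x - 2 * cos x * (sin x * sin x)).
  by rewrite sE; ring.
by ring.
Qed.

Let sqrt534 : Num.sqrt 3 * Num.sqrt 178 = Num.sqrt 534 :> R.
Proof. by rewrite -sqrtrM ?ler0n -?natrM. Qed.

(** The Pythagorean relation by which the cosine of the arctangent in [z3] is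
    [8001 / (356 sqrt 534)]. *)
Let trig_const : (8 * 10 ^+ 3 + 1) ^+ 2 + 73 ^+ 2 * (3 * 229) = 356 ^+ 2 * 534 :> R.
Proof. by ring. Qed.

Lemma cos_atan_z3 :
  cos (atan (73 / 8001 * Num.sqrt 3 * Num.sqrt 229)) * (356 * Num.sqrt 534) = 8001 :> R.
Proof.
have -> : (8001 : R) = 8 * 10 ^+ 3 + 1 by rewrite -natrX -natrM natr1.
have D0 : 0 < 8 * 10 ^+ 3 + 1 :> R by lra.
have s0 : 0 < Num.sqrt 534 :> R by rewrite sqrtr_gt0 ltr0n.
have s2 : Num.sqrt 534 ^+ 2 = 534 :> R by rewrite sqr_sqrtr ?ler0n.
have a2 : (Num.sqrt 3 * Num.sqrt 229) ^+ 2 = 3 * 229 :> R by rewrite exprMn !sqr_sqrtr ?ler0n.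
move: (8 * 10 ^+ 3 + 1) (Num.sqrt 534) trig_const D0 s0 s2 => D c tc D0 c0 c2.
rewrite cos_atan -mulrA.
move: (Num.sqrt 3 * Num.sqrt 229) a2 => a a2.
have -> : 1 + (73 / D * a) ^+ 2 = (356 * c / D) ^+ 2.
  apply: (mulIf (_ : D ^+ 2 != 0)); first by rewrite expf_neq0// gt_eqF.
  have -> : (356 * c / D) ^+ 2 * D ^+ 2 = 356 ^+ 2 * c ^+ 2 by field; rewrite gt_eqF.
  have -> : (1 + (73 / D * a) ^+ 2) * D ^+ 2 = D ^+ 2 + 73 ^+ 2 * a ^+ 2.
    by field; rewrite gt_eqF.
  by rewrite a2 c2.
have pos : 0 <= 356 * c / D.
  by apply: divr_ge0; [apply: mulr_ge0; [exact: ler0n|exact: ltW]|exact: ltW].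
rewrite sqrtr_sqr ger0_norm//.
by field; rewrite !gt_eqF.
Qed.

(* [z3 R] is the trigonometric solution of this cubic: [w = 73 * z3 R + 26] satisfies
   [w ^+ 3 = 6408 * w + 192024]. *)
Lemma z3_cubic : 73 * z3 R ^+ 3 + 78 * z3 R ^+ 2 - 60 * z3 R - 64 = 0.
Proof.
pose th : R := 1 / 3 * atan (73 / 8001 * Num.sqrt 3 * Num.sqrt 229).
have th3 : 3 * th = atan (73 / 8001 * Num.sqrt 3 * Num.sqrt 229).
  by rewrite /th; field.
have c3 : (4 * cos th ^+ 3 - 3 * cos th) * (356 * Num.sqrt 534) = 8 * 10 ^+ 3 + 1.
  rewrite -cos_triple th3.
  by rewrite cos_atan_z3 -natrX -natrM natr1.
have zE : z3 R = (4 * (Num.sqrt 534 * cos th) - 26) / 73.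
  by rewrite /z3 -/th -sqrt534; field.
have s2 : Num.sqrt 534 * Num.sqrt 534 = 534 :> R by rewrite -expr2 sqr_sqrtr ?ler0n.
rewrite zE; move: (Num.sqrt 534) (cos th) c3 s2 => r y c3 s2.
have r3 : (r * y) ^+ 3 = 534 * r * y ^+ 3.
  by rewrite -s2; ring.
have -> : 73 * ((4 * (r * y) - 26) / 73) ^+ 3 + 78 * ((4 * (r * y) - 26) / 73) ^+ 2
    - 60 * ((4 * (r * y) - 26) / 73) - 64 =
    (64 * (r * y) ^+ 3 - 12 * 534 * (4 * (r * y)) - 24 * (8 * 10 ^+ 3 + 1)) / 73 ^+ 2.
  by field.
by rewrite r3 -c3; field.
Qed.

(** Positivity of [cos th] and of [cos (3 th)] gives [3/4 < (cos th) ^ 2 <= 1], hence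
    [20 < sqrt 534 cos th < 93/4], which separates [z3] from the other roots of its cubic. *)
Lemma z3_bounds : 54 / 73 < z3 R < 67 / 73.
Proof.
pose th : R := 1 / 3 * atan (73 / 8001 * Num.sqrt 3 * Num.sqrt 229).
have zE : z3 R = (4 * (Num.sqrt 534 * cos th) - 26) / 73.
  by rewrite /z3 -/th -sqrt534; field.
have r0 : 0 < Num.sqrt 534 :> R by rewrite sqrtr_gt0 ltr0n.
have s2 : Num.sqrt 534 * Num.sqrt 534 = 534 :> R by rewrite -expr2 sqr_sqrtr ?ler0n.
have pi0 : 0 < pi :> R by exact: pi_gt0.
have y0 : 0 < cos th.
  apply: cos_gt0_pihalf; rewrite /th.
  have := atan_gtNpi2 (73 / 8001 * Num.sqrt 3 * Num.sqrt 229 : R).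
  have := atan_ltpi2 (73 / 8001 * Num.sqrt 3 * Num.sqrt 229 : R).
  by move: (atan _) pi0; clear => a p a1 a2; apply/andP; split; lra.
have y1 : cos th <= 1 by exact: cos_le1.
have th3 : 3 * th = atan (73 / 8001 * Num.sqrt 3 * Num.sqrt 229).
  by rewrite /th; field.
have c3 : 0 < 4 * cos th ^+ 3 - 3 * cos th.
  by rewrite -cos_triple th3; apply: cos_gt0_pihalf; apply/andP; split; [exact: atan_gtNpi2|exact: atan_ltpi2].
move: (z3 R) (Num.sqrt 534) (cos th) zE c3 r0 s2 y0 y1 => z r y zE c3 r0 s2 y0 y1.
have y34 : 3 / 4 < y * y.
  have : 0 < y * (4 * (y * y) - 3) by rewrite (_ : _ * _ = 4 * y ^+ 3 - 3 * y)//; ring.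
  by rewrite pmulr_rgt0//; clear; lra.
have ry0 : 0 < r * y by exact: mulr_gt0.
have ry2 : (r * y) * (r * y) = 534 * (y * y) by rewrite mulrACA s2.
have yy1 : y * y <= 1 by rewrite -[leRHS]mulr1; apply: ler_pM => //; exact: ltW.
have lo : 20 < r * y.
  rewrite ltNge; apply/negP => hle.
  have : (r * y) * (r * y) <= 20 * 20 by apply: ler_pM => //; exact: ltW.
  by rewrite ry2; move: y34; clear; lra.
have hi : r * y < 93 / 4.
  rewrite ltNge; apply/negP => hle.
  have : 93 / 4 * (93 / 4) <= (r * y) * (r * y) by apply: ler_pM => //; clear; lra.
  by rewrite ry2; move: yy1; clear; lra.
by apply/andP; split; rewrite zE; move: lo hi; clear; lra.
Qed.

End CriticalTetrahedron.

(** * The one-parameter family of symmetric tetrahedra *)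

Section SymmetricTetrahedron.
Context {R : realType}.

Section Vertices.
Variable z : R.
Hypothesis z1 : z ^+ 2 < 1.
Local Notation T := (symmetric_tetra z).

Let sq3 : Num.sqrt 3 * Num.sqrt 3 = 3 :> R. Proof. by rewrite -expr2 sqr_sqrtr. Qed.
Let sqz : Num.sqrt (1 - z ^+ 2) * Num.sqrt (1 - z ^+ 2) = 1 - z ^+ 2.
Proof. by rewrite -expr2 sqr_sqrtr// subr_ge0 ltW. Qed.

Let T0 : T v0 = (0, Num.sqrt (1 - z ^+ 2), z). Proof. by []. Qed.
Let T1 : T v1 = (Num.sqrt 3 / 2, 0, - (1 / 2)). Proof. by []. Qed.
Let T2 : T v2 = (- (Num.sqrt 3 / 2), 0, - (1 / 2)). Proof. by []. Qed.
Let T3 : T v3 = (0, 0, 1). Proof. by []. Qed.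

Lemma symmetric_tetra_ideal : ideal_tetrahedron T.
Proof.
apply/ideal_tetrahedronP; rewrite T0 T1 T2 T3; split; rewrite /dot /=.
- by rewrite mulr0 add0r sqz; ring.
- by move: sq3; move: (Num.sqrt 3) => s hs; lra.
- by move: sq3; move: (Num.sqrt 3) => s hs; lra.
- by ring.
rewrite vol4_det3 oppr_eq0 (_ : det3 _ _ _ = - (3 / 2 * (Num.sqrt 3 * Num.sqrt (1 - z ^+ 2)))).
  rewrite oppr_eq0; apply: lt0r_neq0; apply: mulr_gt0; first by lra.
  by apply: mulr_gt0; rewrite sqrtr_gt0// subr_gt0.
by rewrite /det3 /=; field.
Qed.

Lemma symmetric_tetra_chords :
  [/\ chord (T v0) (T v1) = 1 + z / 2, chord (T v0) (T v2) = 1 + z / 2,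
      chord (T v0) (T v3) = 1 - z & [/\ chord (T v1) (T v2) = 3 / 2,
      chord (T v1) (T v3) = 3 / 2 & chord (T v2) (T v3) = 3 / 2]].
Proof.
rewrite T0 T1 T2 T3 /chord /dot /=; split; [by field|by field|by ring|split; [|by field|by field]].
by move: sq3; move: (Num.sqrt 3) => s hs; lra.
Qed.

Lemma symmetric_tetra_kite : kite (T v0) (T v1) (T v2) (T v3).
Proof. by have [c1 c2 c3 [c4 c5 c6]] := symmetric_tetra_chords; rewrite /kite c1 c2 c5 c6. Qed.

Lemma symmetric_tetra_ratio :
  kite_ratio (T v0) (T v1) (T v2) (T v3) = (1 - z) / (1 + z / 2).
Proof.
have [c1 c2 c3 [c4 c5 c6]] := symmetric_tetra_chords.
by rewrite /kite_ratio c1 c3 c4 c6 -mulf_div divff ?mulr1//; apply: lt0r_neq0; lra.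
Qed.

Lemma symmetric_tetra_plane_symmetric : plane_symmetric T.
Proof.
(* The normal of the plane [x = 0], whose reflection exchanges the vertices [v1] and [v2]. *)
pose u : R * pt3 R := (0, (1, 0, 0)).
have refl (p : pt3 R) : reflection u p = (- p.1.1, p.1.2, p.2).
  rewrite /reflection /dehomog /homog /u /lorentz /dot /=.
  by apply: pt3P; rewrite /= /GRing.scale/=; field.
exists u; split; first by rewrite /u /lorentz /dot /=; lra.
have sub p : tetrahedron T p -> tetrahedron T (- p.1.1, p.1.2, p.2).
  rewrite tetrahedronE => -[w0 [w1 [w2 [w3 [[p0 p1 p2 p3] [ws ->]]]]]].
  exists w0, w2, w1, w3; split => //; split; first by rewrite -ws; ring.
  by rewrite /bary T0 T1 T2 T3; apply: pt3P; rewrite /= /GRing.scale/=; ring.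
apply/seteqP; split=> [_ [p hp <-]|p hp]; first by rewrite refl; exact: sub.
exists (- p.1.1, p.1.2, p.2); first exact: sub.
by rewrite refl /= opprK; case: p {hp} => -[].
Qed.

End Vertices.
End SymmetricTetrahedron.

(** Since [4 - k = 3 (1 + z) / (1 + z / 2)], the equation reads
    [9 (1 - z) (1 + z) ^ 2 = (1 + z / 2) ^ 3], which is the cubic of [z3_cubic]. *)
Lemma z3_ratio (R : realType) (k := (1 - z3 R) / (1 + z3 R / 2)) :
  [/\ 0 < k, k < 10^-1 & k * (4 - k) ^+ 2 = 1].
Proof.
have cub := @z3_cubic R; have /andP[zl zu] := @z3_bounds R.
rewrite /k; move: (z3 R) cub zl zu => z cub zl zu {k}.
have d0 : 0 < 1 + z / 2 by lra.
have k0 : 0 < (1 - z) / (1 + z / 2) by rewrite divr_gt0//; lra.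
have kE : (1 - z) / (1 + z / 2) * (4 - (1 - z) / (1 + z / 2)) ^+ 2 = 1.
  have -> : (1 - z) / (1 + z / 2) * (4 - (1 - z) / (1 + z / 2)) ^+ 2 =
      (1 - z) * (3 + 3 * z) ^+ 2 / (1 + z / 2) ^+ 3.
    by field; rewrite !gt_eqF//; lra.
  apply: (mulIf (_ : (1 + z / 2) ^+ 3 != 0)); first by rewrite expf_neq0// gt_eqF.
  by rewrite divfK ?mul1r ?expf_neq0 ?gt_eqF//; lra.
(* The bounds on [z3] only give [k <= 2/10]; between [1/10] and [2/10] the product [k (4 - k) ^ 2]
   already exceeds 1. *)
split => //; have ku : (1 - z) / (1 + z / 2) <= 2 / 10.
  by rewrite ler_pdivrMr//; lra.
move: ((1 - z) / (1 + z / 2)) k0 kE ku => k k0 kE ku; rewrite ltNge; apply/negP => kl.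
have : 10^-1 * (38 / 10) ^+ 2 <= k * (4 - k) ^+ 2.
  apply: ler_pM; [by lra|exact: sqr_ge0|exact kl|].
  by rewrite ler_sqr ?nnegrE; lra.
by rewrite kE; lra.
Qed.

Theorem theorem3p3 (R : realType) :
  let T3 : 'I_4 -> pt3 R := symmetric_tetra (z3 R) in
  [/\ ideal_tetrahedron T3,
      plane_symmetric T3,
      exists! B : 'I_4 -> set (pt3 R), arrangement3 T3 B
    & forall B3 : 'I_4 -> set (pt3 R), arrangement3 T3 B3 ->
        [/\ admissible T3 B3,
            forall (E : 'I_4 -> pt3 R) (B : 'I_4 -> set (pt3 R)),
              ideal_tetrahedron E -> plane_symmetric E -> admissible E B ->
              density E B <= density T3 B3
          & `|density T3 B3 - (874 / 10 ^+ 3 + 994 / 10 ^+ 6 + 29 / 10 ^+ 8)|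
              < 1 / 10 ^+ 8]].
Proof.
move=> T3; have [k0 k1 kE] := z3_ratio R.
have z1 : z3 R ^+ 2 < 1.
  have /andP[zl zu] := @z3_bounds R.
  by rewrite expr_lt1//; [move: zu|move: zl]; move: (z3 R) => z; lra.
have hT := symmetric_tetra_ideal z1; have hk := symmetric_tetra_kite (z3 R).
rewrite -(symmetric_tetra_ratio (z3 R)) in k0 k1 kE.
have hP := extremal_arrangementP hT hk kE.
split => //; first exact: symmetric_tetra_plane_symmetric.
  by exists (extremal_arrangement T3); split=> [|B /hP ->//]; exact/hP.
have q1 : 1 <= 4 - kite_ratio (T3 v0) (T3 v1) (T3 v2) (T3 v3).
  by move: k1; rewrite /T3; move: (kite_ratio _ _ _ _) => k; lra.
move=> B3 /hP ->; rewrite (extremal_density hT hk q1); split.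
- exact: extremal_admissible.
- by move=> E B hE hs hB; exact: plane_symmetric_density_le.
- exact: max_density_bounds.
Qed.
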